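(* Let $u\in\mathcal M({}^*\Omega_c)$, $x_0\in\Omega$ and $\xi_0\in\mathbf S$. Then the following are equivalent: (1) there exists $r\in\mathbb R_{>0}$ such that $u$ is $\mathcal M^\infty$-microlocally regular at $(x,\xi)$ for each $x\in B_{{}^*\mathbb R^d}(x_0,r)$ and each $\xi\in{}^*\mathbf S$ with $|\xi-\xi_0|\le r$; (2) there exist $\phi\in\mathcal M_c^\infty({}^*\Omega_c)$, $r\in\mathbb R_{>0}$ and $R\in{}^*\mathbb R_{ss}$ with $R>0$ such that $|\partial^\alpha\phi(x)|\le R$ and $|\phi(x)|\ge1/R$ for each $\alpha\in\mathbb N^d$ and each $x\in B_{{}^*\mathbb R^d}(x_0,r)$, and $$\widehat{\phi u}(\xi)\approxeq0\quad\text{for all }\xi\in{}^*\mathbb R^d_{fs}\text{ with }\left|\frac{\xi}{|\xi|}-\xi_0\right|\le r;$$ (3) there exist $\psi\in\mathcal D(\Omega)$ with $\psi(x_0)=1$ and a conic neighbourhood $\Gamma\subseteq\mathbb R^d$ of $\xi_0$ such that $$\widehat{\psi u}(\xi)\approxeq0\quad\text{for all }\xi\in{}^*\Gamma\cap{}^*\mathbb R^d_{fs}.$$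
   Context: Internal objects. Let $I=(0,1]$. For a nonempty set $A$ (a subset of $\mathbb R^d$ or $\mathbb C$), ${}^*A:=A^I/\!\sim$, where $(x_\varepsilon)_\varepsilon\sim(y_\varepsilon)_\varepsilon$ iff $x_\varepsilon=y_\varepsilon$ for all sufficiently small $\varepsilon$ (''for small $\varepsilon$''); classes are written $[x_\varepsilon]$, and $a\in A$ is identified with the class of the constant family. Functions and operations are extended $\varepsilon$-wise (a function $f$ is identified with its extension); a relation such as $\le,<$ holds between $[x_\varepsilon]$ and $[y_\varepsilon]$ iff it holds between $x_\varepsilon$ and $y_\varepsilon$ for small $\varepsilon$ (so the order on ${}^*\mathbb R$ is partial). For nonempty $A_\varepsilon\subseteq\mathbb R^d$, $[A_\varepsilon]:=\{[x_\varepsilon]:x_\varepsilon\in A_\varepsilon\text{ for small }\varepsilon\}$. For a set $X$ of functions $\mathbb R^d\to\mathbb C$, ${}^*X$ is the set of maps $[f_\varepsilon]:{}^*\mathbb R^d\to{}^*\mathbb C$, $[x_\varepsilon]\mapsto[f_\varepsilon(x_\varepsilon)]$, with $f_\varepsilon\in X$ for small $\varepsilon$; derivatives $\partial^\alpha$, integrals and the Fourier transform $\widehat{\ \cdot\ }$ are taken $\varepsilon$-wise. Let $\rho:=[\varepsilon]\in{}^*\mathbb R$. An element $x$ of ${}^*\mathbb R^d$ or ${}^*\mathbb C$ is moderate if $|x|\le\rho^{-N}$ for some $N\in\mathbb N$, and negligible ($x\approxeq0$) if $|x|\le\rho^n$ for each $n\in\mathbb N$; ${}^*\mathbb C_{\mathcal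 M}$ is the set of moderate elements of ${}^*\mathbb C$. ${}^*\mathbb R^d_{fs}:=\{x\in{}^*\mathbb R^d:(\exists a\in\mathbb R_{>0})\,|x|\ge\rho^{-a}\}$ and ${}^*\mathbb R^d_{ss}:=\{x\in{}^*\mathbb R^d:(\forall a\in\mathbb R_{>0})\,|x|\le\rho^{-a}\}$. Write $x\approx_{\mathrm{fast}}y$ if $|x-y|\le\rho^a$ for some $a\in\mathbb R_{>0}$. $B_{{}^*\mathbb R^d}(x_0,r)$ is the ball in ${}^*\mathbb R^d$ with centre $x_0$ and radius $r$. $\Omega\subseteq\mathbb R^d$ is open, and ${}^*\Omega_c:=\bigcup_K{}^*K$ over nonempty compact $K\subset\Omega$. For $A\subseteq{}^*\mathbb R^d$, $\mathcal M(A):=\{u\in{}^*(\mathcal C^\infty(\mathbb R^d)):\partial^\alpha u(x)\in{}^*\mathbb C_{\mathcal M}\ \forall\alpha\in\mathbb N^d,\forall x\in A\}$ and $\mathcal M^\infty(A):=\{u\in{}^*(\mathcal C^\infty(\mathbb R^d)):(\forall x\in A)(\exists N\in\mathbb N)(\forall\alpha\in\mathbb N^d)\,|\partial^\alpha u(x)|\le\rho^{-N}\}$. Let $\mathcal K(\mathbb R^d)$ be the set of nonempty compact subsets of $\mathbb R^d$ and ${}^*(\mathcal K(\mathbb R^d)):=\{[K_\varepsilon]:K_\varepsilon\in\mathcal K(\mathbb R^d)\text{ for small }\varepsilon\}$. $u$ is compactly supported in $A$ if there is $K\in{}^*(\mathcal K(\mathbb R^d))$, $K\subseteq A$, such that $u(x)=0$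 for every $x\in{}^*\mathbb R^d$ with $|x-a|>0$ for all $a\in K$. $\mathcal M_c(A)$ is the set of $u\in\mathcal M({}^*\mathbb R^d)$ compactly supported in $A$, and $\mathcal M_c^\infty(A):=\mathcal M^\infty(A)\cap\mathcal M_c(A)$. $\mathbf S:=\{x\in\mathbb R^d:|x|=1\}$. $u\in\mathcal M({}^*\Omega_c)$ is $\mathcal M^\infty$-microlocally regular at $(x_0,\xi_0)\in{}^*\Omega_c\times{}^*\mathbf S$ if there is $v\in\mathcal M_c({}^*\Omega_c)$ with $u(x)=v(x)$ for all $x\approx_{\mathrm{fast}}x_0$ and $\widehat v(\xi)\approxeq0$ for all $\xi\in{}^*\mathbb R^d_{fs}$ with $\frac{\xi}{|\xi|}\approx_{\mathrm{fast}}\xi_0$. This notion is only defined at points of ${}^*\Omega_c\times{}^*\mathbf S$, so in (1) the ball $B_{{}^*\mathbb R^d}(x_0,r)$ is understood to be contained in ${}^*\Omega_c$. $\mathcal D(\Omega)$ is the space of smooth functions with compact support in $\Omega$ (extended by $0$ to $\mathbb R^d$). A conic neighbourhood of $\xi_0$ in $\mathbb R^d$ is a cone with vertex $0$ containing a neighbourhood of $\xi_0$. *)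

(* Defs.v *)
From HB Require Import structures.
From mathcomp Require Import all_boot all_order all_algebra.
From mathcomp Require Import generic_quotient complex.
From mathcomp Require Import all_classical all_reals all_analysis.

Set Implicit Arguments.
Unset Strict Implicit.
Unset Printing Implicit Defensive.

Import Order.TTheory GRing.Theory Num.Theory.
Import numFieldNormedType.Exports.

Local Open Scope classical_set_scope.
Local Open Scope ring_scope.
Local Open Scope quotient_scope.

Section Nets.
Variable R : realType.

Definition eps_index : Type := {e : R | 0 < e <= 1}.

Definition small_eps : set_system eps_index :=
  filter_from [set e0 : R | 0 < e0]
    (fun e0 => [set e : eps_index | sval e <= e0]).

#[global] Instance small_eps_filter : ProperFilter small_eps.
Proof.
apply: filter_from_proper; last first.
  move=> e0 /= e0_gt0; have h : 0 < Num.min e0 1 <= 1.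
    by rewrite lt_min e0_gt0 ltr01 ge_min lexx orbT.
  by exists (@exist _ (fun e : R => 0 < e <= 1) _ h); rewrite /= ge_min lexx.
apply: filter_from_filter; first by exists 1; rewrite /= ltr01.
move=> a b /= a0 b0; exists (Num.min a b); first by rewrite /= lt_min a0 b0.
by move=> e /=; rewrite le_min => /andP[].
Qed.

End Nets.

Section Star.
Variable R : realType.

Definition net_eq (T : Type) (x y : eps_index R -> T) : bool :=
  `[< \forall e \near @small_eps R, x e = y e >].

Lemma net_eq_equiv (T : choiceType) : equiv_class_of (@net_eq T).
Proof.
split.
- by move=> x; apply/asboolP; near=> e.
- by move=> x y; apply/asboolP/asboolP; apply: filterS => e ->.
- move=> y x z /asboolP xy /asboolP yz; apply/asboolP.
  by apply: filterS2 xy yz => e -> ->.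
Unshelve. all: end_near. Qed.

Canonical net_eq_equivRel (T : choiceType) := EquivRelPack (@net_eq_equiv T).

(* {}^*T = T^I / ~; for A : set T, the set {}^*A is viewed inside {}^*T,
   see star_set below *)
Definition star (T : choiceType) : Type := {eq_quot (@net_eq_equivRel T)}.

Definition germ (T : choiceType) (x : eps_index R -> T) : star T :=
  \pi_({eq_quot (@net_eq_equivRel T)}) x.

Definition rep (T : choiceType) (x : star T) : eps_index R -> T :=
  repr (x : {eq_quot (@net_eq_equivRel T)}).

Definition sconst (T : choiceType) (a : T) : star T := germ (fun=> a).

(* The operations and relations below are computed on chosen representatives;
   the lemmas smap_germ, smap2_germ, srel_germ and internal_set_germ show that
   they can be computed on arbitrary representatives. *)
Definition smap (A B : choiceType) (f : A -> B) (x : star A) : star B :=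
  germ (fun e => f (rep x e)).

Definition smap2 (A B C : choiceType) (f : A -> B -> C)
    (x : star A) (y : star B) : star C :=
  germ (fun e => f (rep x e) (rep y e)).

Definition srel (A B : choiceType) (P : A -> B -> Prop)
    (x : star A) (y : star B) : Prop :=
  \forall e \near @small_eps R, P (rep x e) (rep y e).

Definition internal_set (T : choiceType) (A : eps_index R -> set T) :
    set (star T) :=
  [set x | \forall e \near @small_eps R, A e (rep x e)].

Definition star_set (T : choiceType) (A : set T) : set (star T) :=
  internal_set (fun=> A).

Lemma germP (T : choiceType) (x y : eps_index R -> T) :
  germ x = germ y <-> \forall e \near @small_eps R, x e = y e.
Proof.
split=> [/eqP|xy]; last by apply/eqP; rewrite /germ eqquotE; apply/asboolP.
by rewrite /germ eqquotE => /asboolP.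
Qed.

Lemma repK (T : choiceType) (x : star T) : germ (rep x) = x.
Proof. exact: reprK. Qed.

Lemma rep_germ (T : choiceType) (x : eps_index R -> T) :
  \forall e \near @small_eps R, rep (germ x) e = x e.
Proof. by apply/germP; rewrite repK. Qed.

Lemma smap_germ (A B : choiceType) (f : A -> B) (x : eps_index R -> A) :
  smap f (germ x) = germ (fun e => f (x e)).
Proof. by apply/germP; apply: filterS (rep_germ x) => e ->. Qed.

Lemma smap2_germ (A B C : choiceType) (f : A -> B -> C)
    (x : eps_index R -> A) (y : eps_index R -> B) :
  smap2 f (germ x) (germ y) = germ (fun e => f (x e) (y e)).
Proof.
by apply/germP; apply: filterS2 (rep_germ x) (rep_germ y) => e -> ->.
Qed.

Lemma srel_germ (A B : choiceType) (P : A -> B -> Prop)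
    (x : eps_index R -> A) (y : eps_index R -> B) :
  srel P (germ x) (germ y) <-> \forall e \near @small_eps R, P (x e) (y e).
Proof.
by split; apply: filterS3 (rep_germ x) (rep_germ y) => e -> ->.
Qed.

Lemma internal_set_germ (T : choiceType) (A : eps_index R -> set T)
    (x : eps_index R -> T) :
  internal_set A (germ x) <-> \forall e \near @small_eps R, A e (x e).
Proof. by split; apply: filterS2 (rep_germ x) => e ->. Qed.

(* Application of [f_eps] to [x_eps]. An internal function is represented by
   the class of the net (f_eps); by sapp_inj this is the same as the map
   [x_eps] |-> [f_eps(x_eps)]. *)
Definition sapp (A B : choiceType) (u : star (A -> B)) (x : star A) : star B :=
  smap2 (fun f a => f a) u x.

Lemma sapp_inj (A B : choiceType) (u v : star (A -> B)) :
  (forall x, sapp u x = sapp v x) -> u = v.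
Proof.
move=> uv; rewrite -(repK u) -(repK v); apply/germP.
have [[a0]|nA] := pselect (inhabited A); last first.
  by near=> e; apply/funext => a; exfalso; exact: nA (inhabits a).
pose P e a := rep u e a <> rep v e a.
pose x e := xget a0 (P e).
have := uv (germ x); rewrite /sapp => /germP xuv.
apply: filterS2 (rep_germ x) xuv => e -> xE.
apply: contrapT => neq.
have [a Pa] : exists a, P e a.
  by apply/not_existsP => h; apply: neq; apply/funext => a; apply: contrapT (h a).
by apply: (xgetPex a0 (ex_intro _ a Pa)).
Unshelve. all: end_near. Qed.

Definition sle : star R -> star R -> Prop := srel (fun a b : R => a <= b).
Definition slt : star R -> star R -> Prop := srel (fun a b : R => a < b).

Definition rho : star R := germ (fun e : eps_index R => sval e).
Definition rho_pow (a : R) : star R := smap (fun e : R => e `^ a) rho.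

Definition slow_scale (x : star R) : Prop :=
  forall a : R, 0 < a -> sle (smap (fun t : R => `|t|) x) (rho_pow (- a)).

End Star.

Arguments star_set R {T} A.
Arguments sconst R {T} a.

Section Euclidean.
Variables (R : realType) (d : nat).
Local Notation Rd := 'rV[R]_d.

Definition dotp (x y : Rd) : R := \sum_(i < d) x 0 i * y 0 i.

(* the norm `|x| provided by the library on 'rV[R]_d is the sup norm *)
Definition enorm (x : Rd) : R := Num.sqrt (dotp x x).

Definition sphere : set Rd := [set x | enorm x = 1].

Definition unit_dir (x : Rd) : Rd := (enorm x)^-1 *: x.

Definition pderiv (i : 'I_d) (f : Rd -> R[i]) (x : Rd) : R[i] :=
  Complex ('D_(delta_mx 0 i) (fun y => complex.Re (f y)) x)
          ('D_(delta_mx 0 i) (fun y => complex.Im (f y)) x).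

Definition iter_pderiv (s : seq 'I_d) (f : Rd -> R[i]) : Rd -> R[i] :=
  foldr pderiv f s.

Definition mderiv (alpha : 'I_d -> nat) (f : Rd -> R[i]) : Rd -> R[i] :=
  iter_pderiv (flatten [seq nseq (alpha i) i | i <- enum 'I_d]) f.

Definition smooth (f : Rd -> R[i]) : Prop :=
  forall s : seq 'I_d,
    [/\ continuous (fun y => complex.Re (iter_pderiv s f y)),
        continuous (fun y => complex.Im (iter_pderiv s f y)) &
        forall (i : 'I_d) (x : Rd),
          derivable (fun y => complex.Re (iter_pderiv s f y)) x (delta_mx 0 i)
          /\ derivable (fun y => complex.Im (iter_pderiv s f y)) x
               (delta_mx 0 i)].

Definition test_function (Omega : set Rd) (f : Rd -> R[i]) : Prop :=
  [/\ smooth f, compact (closure [set x | f x != 0])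
    & closure [set x | f x != 0] `<=` Omega].

Definition conic_nbhs (x0 : Rd) (Gamma : set Rd) : Prop :=
  (forall (t : R) (x : Rd), 0 < t -> Gamma x -> Gamma (t *: x))
  /\ nbhs x0 Gamma.

End Euclidean.

Arguments sphere R d : clear implicits.

(* The integral over R^n as an iterated Lebesgue integral. It is applied only
   to continuous compactly supported functions, for which this is the integral
   with respect to n-dimensional Lebesgue measure by Fubini's theorem. *)
Fixpoint iter_integral (R : realType) (n : nat) : ('rV[R]_n -> R) -> R :=
  match n return ('rV[R]_n -> R) -> R with
  | 0%N => fun f => f 0
  | m.+1 => fun f =>
      \int[@lebesgue_measure R]_(t in setT)
        @iter_integral R m (fun y : 'rV[R]_m =>
          f (row_mx (const_mx t : 'rV[R]_1) y : 'rV[R]_m.+1))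
  end.

Section Fourier.
Variables (R : realType) (d : nat).
Local Notation Rd := 'rV[R]_d.

Definition cintegral (f : Rd -> R[i]) : R[i] :=
  Complex (iter_integral (fun x => complex.Re (f x)))
          (iter_integral (fun x => complex.Im (f x))).

(* \hat f(xi) = \int f(x) exp(-i x.xi) dx *)
Definition fourier (f : Rd -> R[i]) (xi : Rd) : R[i] :=
  cintegral (fun x => f x * Complex (cos (dotp x xi)) (- sin (dotp x xi))).

End Fourier.

Section Internal.
Variables (R : realType) (d : nat).
Local Notation Rd := 'rV[R]_d.
Local Notation sRd := (star R 'rV[R]_d).
Local Notation sC := (star R R[i]).
Local Notation sFun := (star R ('rV[R]_d -> R[i])).

Definition sabs (z : sC) : star R R :=
  smap (fun w : R[i] => Normc.normc w) z.

Definition snorm (x : sRd) : star R R := smap (@enorm R d) x.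

Definition sdist (x y : sRd) : star R R :=
  smap2 (fun a b : Rd => enorm (a - b)) x y.

Definition moderate (z : sC) : Prop :=
  exists N : nat, sle (sabs z) (rho_pow (- N%:R)).

Definition approxeq0 (z : sC) : Prop :=
  forall n : nat, sle (sabs z) (rho_pow n%:R).

Definition fast_scale : set sRd :=
  [set x | exists2 a : R, 0 < a & sle (rho_pow (- a)) (snorm x)].

Definition near_fast (x y : sRd) : Prop :=
  exists2 a : R, 0 < a & sle (sdist x y) (rho_pow a).

Definition sball (x0 : sRd) (r : R) : set sRd :=
  [set x | slt (sdist x x0) (sconst R r)].

Definition star_c (Omega : set Rd) : set sRd :=
  [set x | exists K : set Rd,
     [/\ compact K, K !=set0, K `<=` Omega & star_set R K x]].

Definition smooth_internal : set sFun := star_set R (@smooth R d).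

Definition sderiv (alpha : 'I_d -> nat) (u : sFun) : sFun :=
  smap (mderiv alpha) u.

Definition sfourier (u : sFun) : sFun := smap (@fourier R d) u.

Definition smul (u v : sFun) : sFun :=
  smap2 (fun (f g : Rd -> R[i]) (x : Rd) => f x * g x) u v.

Definition M_space (A : set sRd) : set sFun :=
  [set u | smooth_internal u /\
     forall (alpha : 'I_d -> nat) (x : sRd),
       A x -> moderate (sapp (sderiv alpha u) x)].

Definition Minf_space (A : set sRd) : set sFun :=
  [set u | smooth_internal u /\
     forall x : sRd, A x -> exists N : nat, forall alpha : 'I_d -> nat,
       sle (sabs (sapp (sderiv alpha u) x)) (rho_pow (- N%:R))].

Definition internal_compacts : set (set sRd) :=
  [set K | exists2 Ke : eps_index R -> set Rd,
     \forall e \near @small_eps R, compact (Ke e) /\ Ke e !=set0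
     & K = internal_set Ke].

Definition compactly_supported_in (A : set sRd) (u : sFun) : Prop :=
  exists K : set sRd, [/\ internal_compacts K, K `<=` A &
    forall x : sRd,
      (forall a : sRd, K a -> slt (sconst R 0) (sdist x a)) ->
      sapp u x = sconst R 0].

Definition Mc_space (A : set sRd) : set sFun :=
  [set u | M_space setT u /\ compactly_supported_in A u].

Definition Mcinf_space (A : set sRd) : set sFun := Minf_space A `&` Mc_space A.

(* meaningful for x0 in star_c Omega and xi0 in star_set R (sphere R d) *)
Definition microlocally_regular (Omega : set Rd) (u : sFun)
    (x0 xi0 : sRd) : Prop :=
  exists v : sFun,
    [/\ Mc_space (star_c Omega) v,
        forall x : sRd, near_fast x x0 -> sapp u x = sapp v x &
        forall xi : sRd, fast_scale xi -> near_fast (smap (@unit_dir R d) xi) xi0 ->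
          approxeq0 (sapp (sfourier v) xi)].

End Internal.

Arguments fast_scale {R d}.

(* Main.v *)
Require Import Defs.
From HB Require Import structures.
From mathcomp Require Import all_boot all_order all_algebra.
From mathcomp Require Import generic_quotient complex.
From mathcomp Require Import all_classical all_reals all_analysis.
From mathcomp Require Import ring lra.

Set Implicit Arguments.
Unset Strict Implicit.
Unset Printing Implicit Defensive.

Import Order.TTheory GRing.Theory Num.Theory.
Import numFieldNormedType.Exports.

Local Open Scope classical_set_scope.
Local Open Scope ring_scope.

(* Every estimate rests on one multiplier lemma, [fourier_mul_bound]: if [th] has
   difference quotients of order up to [l] bounded by [C] and the transform of
   [w] is at most [be] within distance [ka] of [xi], then the transform of
   [th * w] at [xi] is at most a constant times [C * (be + W * ka ^- (l - 2d))].
   It is proved without Fourier inversion on R^d: integrals are limits of Riemann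
   sums on a finite grid, where [th] is an exact sum of characters. Working with
   differences instead of derivatives makes quotients and rescaled bumps easy.
   (2) => (1): near [x0] one has [ch * u = (ch / phi) * (phi * u)], and the
   differences of [ch / phi] are slow scale.
   (1) => (3): by saturation the local models [v] of [u] are uniform over the
   ball and the cone; [psi * u] is split by a partition of unity at the scale
   [eps ^ (1 / (m + 1))], and each piece [psi * ch_j * u = psi * ch_j * v_j] is
   estimated by the multiplier lemma, where [m] is chosen large after [l].
   (3) => (2): take [phi = psi] and [S = 1 - ln eps]. *)

(** The order of quantifiers shapes the proof. Each difference of a bump supported in a small cell
    costs a negative power of [eps], and the number [l] of differences is dictated by the growth
    exponent [N] of the local models and by the frequency shift [eps ^ (- a / 2)]. So [N] must be
    uniform over the ball and the cone and fixed before [m], which is the order provided by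
    [uniform_witness]. Then [m] can be so large that all differences together, and likewise the
    number of cells, cost at most [eps ^ -1]. Fast-scale frequencies enter because a shift by
    [eps ^ (- a / 2)] turns a frequency of size [eps ^ (- a)] by only [O(eps ^ (a / 2))]. Slow scale
    enters because dividing by [phi] produces a power of [S] whose exponent grows with [l], yet
    every such power stays below [eps ^ (- 1 / 2)]. Only pure differences along single axes are
    used: the largest coordinate of a grid frequency already yields all the decay. Grids and
    supports are measured in the sup norm, balls and directions in the Euclidean norm; the
    comparison produces the factors [d]. *)

Section OneDim.
Variable R : realType.
Local Notation mu := (@lebesgue_measure R).

(** * Riemann sums in one variable *)

Lemma continuous_integrable_itv (F : R -> R) (i : interval R) (a b : R) :
  continuous F -> [set` i] `<=` `[a, b] ->
  mu.-integrable [set` i] (EFin \o F).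
Proof.
move=> cF ib; apply: (@integrableS _ _ _ mu `[a, b]) => //.
apply: continuous_compact_integrable; first exact: segment_compact.
by apply: continuous_subspaceT => x; exact: cF.
Qed.

Lemma Rintegral_cell (F : R -> R) (c h v ep : R) :
  continuous F -> 0 < h ->
  (forall t, c <= t <= c + h -> `|F t - v| <= ep) ->
  `|\int[mu]_(t in `]c, c + h]) F t - h * v| <= ep * h.
Proof.
move=> cF h0 Fv.
have mE : fine (mu `]c, (c + h)]) = h.
  by rewrite lebesgue_measure_itv /= lte_fin ltrDl h0 /= addrAC subrr add0r.
have sub : [set` `]c, (c + h)]] `<=` `[c, (c + h)].
  by apply: subset_itvr; rewrite bnd_simp.
have iF := continuous_integrable_itv cF sub.
have icst r : mu.-integrable `]c, (c + h)] (EFin \o cst r).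
  by apply: (continuous_integrable_itv _ sub) => x; exact: cvg_cst.
have up : \int[mu]_(t in `]c, c + h]) F t <= (v + ep) * h.
  rewrite -[X in _ * X]mE -Rintegral_cst//.
  apply: le_Rintegral; [by []|exact: iF|exact: (icst _)|].
  move=> t /=; rewrite in_itv/= => /andP[/ltW ct tc].
  by have := Fv t; rewrite ct tc ler_norml => /(_ erefl)/andP[_]; lra.
have dn : (v - ep) * h <= \int[mu]_(t in `]c, c + h]) F t.
  rewrite -[X in _ * X]mE -Rintegral_cst//.
  apply: le_Rintegral; [by []|exact: (icst _)|exact: iF|].
  move=> t /=; rewrite in_itv/= => /andP[/ltW ct tc].
  by have := Fv t; rewrite ct tc ler_norml => /(_ erefl)/andP[+ _]; lra.
move: up dn; move: (\int[mu]_(t in _) F t) => J up dn.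
by rewrite ler_norml; apply/andP; split; clear -up dn; lra.
Qed.

(** The [N.*2.+1] cells of width [h] tile [[- L, L]] exactly, and the sample points [h * (a - N)]
    are their midpoints, so each cell contributes an error of at most [ep * h]. *)
Lemma Rintegral_riemann (F : R -> R) (N : nat) (h L ep : R) :
  continuous F -> 0 < h -> h * N.*2.+1%:R = L *+ 2 ->
  (forall t, L <= `|t| -> F t = 0) ->
  (forall s t, `|s - t| <= h -> `|F s - F t| <= ep) ->
  `|\int[mu]_(t in setT) F t -
     h * \sum_(a < N.*2.+1) F (h * (a%:R - N%:R))| <= L *+ 2 * ep.
Proof.
move=> cF h0 hL F0 Fep.
pose I k := \int[mu]_(t in `[- L, - L + h * k%:R]) F t.
have step k : `|I k - h * \sum_(a < k) F (h * (a%:R - N%:R))| <= h * k%:R * ep.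
  elim: k => [|k IH].
    by rewrite /I big_ord0 !mulr0 addr0 set_itv1 Rintegral_set1 subr0 normr0 mul0r.
  rewrite big_ord_recr /= mulrDr.
  have hk : 0 <= h * k%:R by rewrite mulr_ge0// ltW.
  have E : - L + h * k.+1%:R = - L + h * k%:R + h by rewrite -natr1 mulrDr mulr1 addrA.
  have -> : I k.+1 = I k + \int[mu]_(t in `](- L + h * k%:R), (- L + h * k%:R + h)]) F t.
    have := @Rintegral_itvB _ F (BLeft (- L)) (BRight (- L + h * k%:R + h)) (- L + h * k%:R).
    rewrite !bnd_simp lerDl hk lerDl (ltW h0) => H.
    rewrite -H//; first by rewrite /I E [RHS]addrCA subrr addr0.
    exact: (continuous_integrable_itv cF (@subset_refl _ _)).
  have := @Rintegral_cell F (- L + h * k%:R) h (F (h * (k%:R - N%:R))) ep cF h0.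
  set J := \int[mu]_(t in _) F t => cell.
  have {}cell : `|J - h * F (h * (k%:R - N%:R))| <= ep * h.
    apply: cell => t /andP[t1 t2]; apply: Fep.
    have NL : L = h * N%:R + h / 2.
      by move: hL; rewrite -addnn -natr1 natrD mulr2n; clear; lra.
    move: t1 t2; rewrite NL mulrBr; set hk' := h * k%:R; set hN := h * N%:R => t1 t2.
    by rewrite ler_norml; apply/andP; split; lra.
  rewrite opprD addrACA (le_trans (ler_normD _ _))//.
  have -> : h * k.+1%:R * ep = h * k%:R * ep + ep * h by rewrite -natr1; ring.
  exact: lerD.
have := step N.*2.+1; rewrite hL; congr (`|_ - _| <= _).
rewrite /I hL [RHS]Rintegral_mkcond.
rewrite [LHS]Rintegral_mkcond; congr Rintegral; apply/funext => t.
rewrite /patch in_setT; case: ifPn => // /negP tn; symmetry; apply: F0.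
apply: contra_notP tn => /negP; rewrite -ltNge => tL.
rewrite inE /= in_itv/=; move: tL; rewrite ltr_norml mulr2n => /andP[a b].
by apply/andP; split; lra.
Qed.

End OneDim.

(** * Sup norm, complex modulus and sums over row vectors *)

Section SupNorm.
Variables (R : realType) (n : nat).
Implicit Types x y : 'rV[R]_n.

Lemma entry_le_norm x i : `|x 0 i| <= `|x|.
Proof.
rewrite /Num.Def.normr /= mx_normrE.
by apply: le_trans (le_bigmax_cond _ _ (_ : xpredT (0, i))); rewrite ?lexx.
Qed.

Lemma norm_le_entry x (r : R) : 0 <= r -> (forall i, `|x 0 i| <= r) -> `|x| <= r.
Proof.
move=> r0 xr; rewrite /Num.Def.normr /= mx_normrE.
by apply: bigmax_le => // -[i j] _; rewrite ord1.
Qed.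

Lemma norm_lt_entry x (r : R) : 0 < r -> (forall i, `|x 0 i| < r) -> `|x| < r.
Proof.
move=> r0 xr; rewrite /Num.Def.normr /= mx_normrE.
by apply: bigmax_lt => // -[i j] _; rewrite ord1.
Qed.

End SupNorm.

Section Normc.
Variable R : rcfType.
Implicit Types z w : R[i].

Lemma normc_ge0 z : 0 <= Normc.normc z.
Proof. by case: z => a b; rewrite /= sqrtr_ge0. Qed.

Lemma normc_re z : `|complex.Re z| <= Normc.normc z.
Proof.
case: z => a b /=; rewrite -sqrtr_sqr ler_sqrt ?lerDl ?sqr_ge0//.
by rewrite addr_ge0 ?sqr_ge0.
Qed.

Lemma normc_im z : `|complex.Im z| <= Normc.normc z.
Proof.
case: z => a b /=; rewrite -sqrtr_sqr ler_sqrt ?lerDr ?sqr_ge0//.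
by rewrite addr_ge0 ?sqr_ge0.
Qed.

Lemma normc_le_re_im z : Normc.normc z <= `|complex.Re z| + `|complex.Im z|.
Proof.
case: z => a b /=; rewrite -(ler_sqr (x := Num.sqrt _)) ?nnegrE ?sqrtr_ge0 ?addr_ge0//.
rewrite sqr_sqrtr ?addr_ge0 ?sqr_ge0// sqrrD !real_normK ?num_real//.
by rewrite lerD2r lerDl mulrn_wge0// mulr_ge0.
Qed.

Lemma normc_real (a : R) : Normc.normc a%:C%C = `|a|.
Proof. by rewrite /= expr0n addr0 sqrtr_sqr. Qed.

Lemma normcD z w : Normc.normc (z + w) <= Normc.normc z + Normc.normc w.
Proof. exact: le_normcD. Qed.

Lemma normc_opp z : Normc.normc (- z) = Normc.normc z.
Proof. exact: normcN. Qed.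

Lemma normcB z w : Normc.normc (z - w) = Normc.normc (w - z).
Proof. by rewrite -normc_opp opprB. Qed.

Lemma normcX z k : Normc.normc (z ^+ k) = Normc.normc z ^+ k.
Proof.
elim: k => [|k IH]; first by rewrite !expr0 Normc.normc1.
by rewrite !exprS Normc.normcM IH.
Qed.

Lemma normc_sum (I : Type) (r : seq I) (P : pred I) (F : I -> R[i]) :
  Normc.normc (\sum_(i <- r | P i) F i) <= \sum_(i <- r | P i) Normc.normc (F i).
Proof.
elim/big_ind2 : _ => //[|x1 x2 y1 y2 h1 h2]; first by rewrite Normc.normc0.
by rewrite (le_trans (normcD _ _))// lerD.
Qed.

End Normc.

Section RowSums.

Lemma sum_row_cons (V : nmodType) (T : finType) (m : nat) (F : 'rV[T]_m.+1 -> V) :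
  \sum_b F b = \sum_a \sum_b F (row_mx (const_mx a : 'rV[T]_1) b : 'rV[T]_m.+1).
Proof.
rewrite pair_big /=.
pose g (p : T * 'rV[T]_m) : 'rV[T]_m.+1 := row_mx (const_mx p.1 : 'rV[T]_1) p.2.
pose f (b : 'rV[T]_m.+1) := (b 0 0, rsubmx (b : 'rV[T]_(1 + m))).
rewrite (reindex g) //; exists f => [[a b] _|b _].
  by rewrite /f /g /= row_mxKr; congr (_, _); rewrite mxE; case: splitP => // j _; rewrite mxE.
rewrite /f /g /=.
have -> : const_mx (b 0 0) = lsubmx (b : 'rV[T]_(1 + m)) :> 'rV[T]_1.
  by apply/rowP => i; rewrite !mxE; congr (b _ _); apply/val_inj; rewrite /= ord1.
exact: (@hsubmxK _ 1 1 m b).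
Qed.

Lemma sum_row_prod (S : comNzRingType) (T : finType) (n : nat) (g : 'I_n -> T -> S) :
  \sum_(b : 'rV[T]_n) \prod_i g i (b 0 i) = \prod_i \sum_a g i a.
Proof.
rewrite bigA_distr_bigA /=.
rewrite (reindex (fun f : {ffun 'I_n -> T} => \row_i f i)) /=.
  by apply: eq_bigr => f _; apply: eq_bigr => i _; rewrite mxE.
exists (fun b : 'rV[T]_n => [ffun i => b 0 i]) => [f _|b _].
  by apply/ffunP => i; rewrite ffunE mxE.
by apply/rowP => i; rewrite mxE ffunE.
Qed.

End RowSums.

(** * Riemann sums for iterated integrals *)

Section Riemann.
Variable R : realType.

(** It serves both as the grid of positions (step [h]) and as the dual grid of frequencies (step
    [lam]); an odd number of points per axis makes both symmetric about [0]. *)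
Definition grid (n N : nat) (h : R) (b : 'rV['I_N.*2.+1]_n) : 'rV[R]_n :=
  \row_i (h * ((b 0 i)%:R - N%:R)).

Definition unif_cont (n : nat) (f : 'rV[R]_n -> R) :=
  forall ep, 0 < ep -> exists2 de, 0 < de &
    forall x y, `|x - y| <= de -> `|f x - f y| <= ep.

Definition supp_in (V : nmodType) (n : nat) (L : R) (f : 'rV[R]_n -> V) :=
  forall x, L <= `|x| -> f x = 0.

Definition has_modulus (n : nat) (h ep : R) (f : 'rV[R]_n -> R) :=
  forall x y, `|x - y| <= h -> `|f x - f y| <= ep.

Lemma exists_grid (L de : R) : 0 < L -> 0 < de ->
  exists (N : nat) (h : R), [/\ 0 < h, h <= de & h * N.*2.+1%:R = L *+ 2].
Proof.
move=> L0 de0; pose N := Num.trunc (L *+ 2 / de).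
have q0 : 0 <= L *+ 2 / de by rewrite divr_ge0 ?mulrn_wge0// ltW.
have N1 : 0 < N.*2.+1%:R :> R by rewrite ltr0n.
exists N, (L *+ 2 / N.*2.+1%:R); split.
- by rewrite divr_gt0// pmulrn_lgt0.
- rewrite ler_pdivrMr// mulrC -ler_pdivrMr//.
  have /andP[_] := truncn_itv q0; move/ltW/le_trans; apply.
  by rewrite ler_nat ltnS -addnn leq_addr.
- by rewrite divfK// lt0r_neq0.
Qed.

Definition slice (m : nat) (V : Type) (f : 'rV[R]_m.+1 -> V) (t : R) (y : 'rV[R]_m) : V :=
  f (row_mx (const_mx t : 'rV[R]_1) y : 'rV[R]_m.+1).

Lemma row_cons_entry (m : nat) (t : R) (y : 'rV[R]_m) (i : 'I_m.+1) :
  ((row_mx (const_mx t : 'rV[R]_1) y : 'rV[R]_m.+1) 0 i = t) \/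
  (exists j, (row_mx (const_mx t : 'rV[R]_1) y : 'rV[R]_m.+1) 0 i = y 0 j).
Proof. by rewrite mxE; case: fintype.split => j; [left; rewrite mxE|right; exists j]. Qed.

Lemma norm_row_cons_ge_tail (m : nat) (t : R) (y : 'rV[R]_m) :
  `|y| <= `|row_mx (const_mx t : 'rV[R]_1) y : 'rV[R]_m.+1|.
Proof.
apply: norm_le_entry => // i.
by rewrite -(row_mxEr (const_mx t : 'rV[R]_1) y); exact: entry_le_norm.
Qed.

Lemma norm_row_cons_ge_head (m : nat) (t : R) (y : 'rV[R]_m) :
  `|t| <= `|row_mx (const_mx t : 'rV[R]_1) y : 'rV[R]_m.+1|.
Proof.
have := entry_le_norm (row_mx (const_mx t : 'rV[R]_1) y : 'rV[R]_m.+1) (@lshift 1 m 0).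
by rewrite (@row_mxEl _ 1 1 m) mxE.
Qed.

Lemma norm_row_cons_le (m : nat) (t r : R) (y : 'rV[R]_m) : `|t| <= r -> `|y| <= r ->
  `|row_mx (const_mx t : 'rV[R]_1) y : 'rV[R]_m.+1| <= r.
Proof.
move=> tr yr; apply: norm_le_entry => [|i]; first exact: le_trans tr.
have [->|[j ->]] // := row_cons_entry t y i.
exact: le_trans (entry_le_norm _ _) yr.
Qed.

Lemma row_consB (m : nat) (t s : R) (y z : 'rV[R]_m) :
  (row_mx (const_mx t : 'rV[R]_1) y : 'rV[R]_m.+1) - row_mx (const_mx s : 'rV[R]_1) z =
  row_mx (const_mx (t - s) : 'rV[R]_1) (y - z).
Proof.
by apply/rowP => i; rewrite !mxE; case: fintype.split => j; rewrite !mxE.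
Qed.

Lemma slice_unif_cont (m : nat) (f : 'rV[R]_m.+1 -> R) t :
  unif_cont f -> unif_cont (slice f t).
Proof.
move=> uf ep /uf[de de0 H]; exists de => // x y xy; apply: H.
by rewrite row_consB subrr; apply: norm_row_cons_le => //; rewrite normr0 ltW.
Qed.

Lemma slice_supp (V : nmodType) (m : nat) L (f : 'rV[R]_m.+1 -> V) t :
  supp_in L f -> supp_in L (slice f t).
Proof. by move=> sf x Lx; apply: sf; exact: le_trans (norm_row_cons_ge_tail _ _). Qed.

Lemma slice_modulus (m : nat) (f : 'rV[R]_m.+1 -> R) t h ep : 0 <= h ->
  has_modulus h ep f -> has_modulus h ep (slice f t).
Proof.
move=> h0 mf x y xy; apply: mf.
by rewrite row_consB subrr; apply: norm_row_cons_le => //; rewrite normr0.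
Qed.

Lemma slice_grid (V : Type) (m N : nat) h (f : 'rV[R]_m.+1 -> V) a (b : 'rV['I_N.*2.+1]_m) :
  f (grid h (row_mx (const_mx a : 'rV_1) b : 'rV_m.+1)) =
  slice f (h * (a%:R - N%:R)) (grid h b).
Proof.
rewrite /slice; congr f; apply/rowP => i; rewrite !mxE.
by case: fintype.split => j; rewrite !mxE.
Qed.

(** Named as a property of the dimension, so that the comparison of two integrals below is available
    in dimension [m] inside the induction that proves the property in dimension [m.+1]. *)
Definition riemann_approx (n : nat) := forall (f : 'rV[R]_n -> R) (N : nat) (h L ep : R),
  0 < h -> h * N.*2.+1%:R = L *+ 2 -> unif_cont f -> supp_in L f -> has_modulus h ep f ->
  `|iter_integral f - h ^+ n * \sum_b f (grid (N := N) h b)| <= n%:R * (L *+ 2) ^+ n * ep.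

(** Both integrals are approximated on one common fine grid, where the sums are compared term by
    term: [N.*2.+1 ^ n] points of weight [h ^ n] have total mass [(L *+ 2) ^ n]. This replaces
    monotonicity of the iterated integral. *)
Lemma iter_integral_dist_of_approx (n : nat) : riemann_approx n ->
  forall (f g : 'rV[R]_n -> R) (L ep : R), 0 < L ->
  unif_cont f -> supp_in L f -> unif_cont g -> supp_in L g ->
  (forall x, `|f x - g x| <= ep) ->
  `|iter_integral f - iter_integral g| <= (L *+ 2) ^+ n * ep.
Proof.
move=> P f g L ep L0 uf sf ug sg fg.
pose c := n%:R * (L *+ 2) ^+ n *+ 2.
have c0 : 0 <= c by rewrite mulrn_wge0// mulr_ge0// exprn_ge0// mulrn_wge0// ltW.
apply/ler_addgt0Pr => e e0.
pose e' := e / (c + 1).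
have c1 : 0 < c + 1 by rewrite ltr_wpDl.
have e'0 : 0 < e' by rewrite divr_gt0.
have [d1 d10 H1] := uf _ e'0; have [d2 d20 H2] := ug _ e'0.
have [|N [h [h0 hd hL]]] := @exists_grid L (Num.min d1 d2) L0; first by rewrite lt_min d10.
move: hd; rewrite le_min => /andP[hd1 hd2].
have mf : has_modulus h e' f by move=> x y xy; apply: H1; exact: le_trans hd1.
have mg : has_modulus h e' g by move=> x y xy; apply: H2; exact: le_trans hd2.
have A := P f N h L e' h0 hL uf sf mf.
have B := P g N h L e' h0 hL ug sg mg.
set Sf := \sum_b f _ in A; set Sg := \sum_b g _ in B.
have D : `|h ^+ n * Sf - h ^+ n * Sg| <= (L *+ 2) ^+ n * ep.
  rewrite -mulrBr -sumrB normrM ger0_norm ?exprn_ge0 ?(ltW h0)//.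
  rewrite -hL exprMn -mulrA ler_wpM2l ?exprn_ge0 ?(ltW h0)//.
  apply: le_trans (ler_norm_sum _ _ _) _.
  apply: le_trans (ler_sum _ (fun b _ => fg _)) _.
  by rewrite sumr_const card_mx card_ord mul1n -[ep *+ _]mulr_natl natrX.
have ce : n%:R * (L *+ 2) ^+ n * e' *+ 2 <= e.
  rewrite -mulrnAl /e' mulrA ler_pdivrMr// mulrC ler_wpM2l// ?(ltW e0)//.
  by rewrite -/c lerDl.
have -> : iter_integral f - iter_integral g =
  (iter_integral f - h ^+ n * Sf) + (h ^+ n * Sf - h ^+ n * Sg) -
  (iter_integral g - h ^+ n * Sg) by ring.
apply: le_trans (ler_normB _ _) _.
have := ler_normD (iter_integral f - h ^+ n * Sf) (h ^+ n * Sf - h ^+ n * Sg).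
move: A B D ce; rewrite mulr2n.
move: (n%:R * _ * e') (`|iter_integral f - _|) (`|iter_integral g - _|) => z a b.
move: (`|h ^+ n * Sf - _|) (`|_ + _|) ((L *+ 2) ^+ n * ep) => c' d' t.
clear; lra.
Qed.

(** Induction on the dimension: the outer integral contributes one error term through the
    one-dimensional estimate, applied to the integral [F t] of the slice at [t], and the inner sums
    contribute [m] of them. *)
Lemma iter_integral_riemann (n : nat) : riemann_approx n.
Proof.
elim: n => [|m IH] f N h L ep h0 hL uf sf mf.
  rewrite !mul0r expr0 mul1r /= (eq_bigr (fun=> f 0)) => [|b _]; last first.
    by congr f; apply/rowP => -[].
  by rewrite sumr_const card_mx mul1n expn0 mulr1n subrr normr0.
have L0 : 0 < L by have : 0 < L *+ 2; [rewrite -hL mulr_gt0|rewrite pmulrn_lgt0].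
have ep0 : 0 <= ep by have := mf 0 0; rewrite !subrr !normr0; apply; exact: ltW.
have LL : 0 <= (L *+ 2) ^+ m by rewrite exprn_ge0// mulrn_wge0// ltW.
pose F t := iter_integral (slice f t).
have -> : iter_integral f = \int[lebesgue_measure]_(t in setT) F t by [].
have dist s t e : (forall y, `|slice f s y - slice f t y| <= e) ->
    `|F s - F t| <= (L *+ 2) ^+ m * e.
  move=> H; apply: iter_integral_dist_of_approx => //;
  solve [exact: slice_unif_cont | exact: slice_supp].
have near_slice de e : 0 <= de -> has_modulus de e f ->
    forall s t, `|s - t| <= de -> `|F s - F t| <= (L *+ 2) ^+ m * e.
  move=> de0 md s t st; apply: dist => y; apply: md.
  by rewrite row_consB subrr norm_row_cons_le// normr0.
have cF : continuous F.
  move=> t; apply/cvgrPdist_le => /= e e0.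
  have e'0 : 0 < e / ((L *+ 2) ^+ m + 1) by rewrite divr_gt0// ltr_wpDl.
  have [de de0 H] := uf _ e'0.
  near=> s.
  apply: le_trans (near_slice de _ (ltW de0) H t s _) _.
    by near: s; apply: cvgr_dist_le => //; exact: cvg_id.
  rewrite mulrA ler_pdivrMr ?ltr_wpDl// mulrC ler_wpM2l ?(ltW e0)//.
  by rewrite lerDl.
have F0 t : L <= `|t| -> F t = 0.
  move=> Lt; have E : slice f t = fun=> 0.
    by apply/funext => y; apply: sf; apply: le_trans Lt (norm_row_cons_ge_head _ _).
  (* A zero slice has modulus of continuity [0], so the induction hypothesis on any one grid gives
     its integral exactly. *)
  have [N' [h' [h'0 _ h'L]]] := exists_grid L0 L0.
  have := IH (slice f t) N' h' L 0 h'0 h'L (slice_unif_cont _ uf) (slice_supp _ sf).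
  rewrite mulr0 normr_le0 subr_eq0 => H; rewrite /F; apply/eqP.
  rewrite (eqP (H _)) ?E; first by rewrite big1 ?mulr0.
  by move=> x y _; rewrite subrr normr0.
have := Rintegral_riemann cF h0 hL F0 (near_slice _ _ (ltW h0) mf).
set I := Rintegral _ _ _ => H1.
rewrite sum_row_cons.
have H2 : `|h * \sum_(a < N.*2.+1) F (h * (a%:R - N%:R)) -
   h ^+ m.+1 * \sum_(a < N.*2.+1) \sum_b f (grid h (row_mx (const_mx a : 'rV_1) b : 'rV_m.+1))|
   <= (L *+ 2) * (m%:R * (L *+ 2) ^+ m * ep).
  rewrite exprS -mulrA -mulrBr mulr_sumr -sumrB normrM (ger0_norm (ltW h0)).
  rewrite -hL -[X in _ <= X]mulrA ler_wpM2l ?(ltW h0)//.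
  apply: le_trans (ler_norm_sum _ _ _) _.
  rewrite mulr_natl -[X in _ <= _ *+ X]card_ord -sumr_const.
  apply: ler_sum => a _.
  under eq_bigr do rewrite slice_grid.
  rewrite hL; apply: IH => //.
  - exact: slice_unif_cont.
  - exact: slice_supp.
  - by apply: slice_modulus => //; exact: ltW.
have E : m.+1%:R * (L *+ 2) ^+ m.+1 * ep =
  L *+ 2 * ((L *+ 2) ^+ m * ep) + L *+ 2 * (m%:R * (L *+ 2) ^+ m * ep).
  by rewrite exprS -natr1; ring.
by rewrite E; apply: le_trans (ler_distD (h * \sum_(a < N.*2.+1) F (h * (a%:R - N%:R))) _ _) _; exact: lerD.
Unshelve. all: end_near. Qed.

End Riemann.

(** * Unit complex numbers; integrals and Fourier transforms as limits of grid sums *)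

Section MeanValue.
Variable R : realType.

Lemma MVT_line (f df : R -> R) (a b : R) : a <= b ->
  (forall x : R, is_derive x 1 f (df x)) ->
  exists2 c, a <= c <= b & f b - f a = df c * (b - a).
Proof.
move=> ab fdf.
have cf : {within `[a, b], continuous f}.
  apply: continuous_subspaceT => x.
  by apply/differentiable_continuous/derivable1_diffP; have [] := fdf x.
have [c] := MVT_segment ab (fun x _ => fdf x) cf.
by rewrite in_itv/= => cab E; exists c.
Qed.

Lemma lipschitz_of_derive (f df : R -> R) (C : R) :
  (forall x : R, is_derive x 1 f (df x)) -> (forall x, `|df x| <= C) ->
  forall a b, `|f a - f b| <= C * `|a - b|.
Proof.
move=> fdf dfC a b; wlog ab : a b / a <= b.
  by move=> H; case/orP: (le_total a b) => [/H//|/H]; rewrite distrC (distrC b).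
have [c _ E] := MVT_line ab fdf.
by rewrite distrC E normrM (distrC a) ler_wpM2r.
Qed.

End MeanValue.

Section Cis.
Variable R : realType.

Definition cis (t : R) : R[i] := Complex (cos t) (sin t).

Lemma cis0 : cis 0 = 1.
Proof. by rewrite /cis cos0 sin0. Qed.

Lemma cisD s t : cis (s + t) = cis s * cis t.
Proof. by rewrite /cis cosD sinD; congr Complex; rewrite addrC mulrC [X in _ + X]mulrC. Qed.

Lemma normc_cis t : Normc.normc (cis t) = 1.
Proof. by rewrite /= cos2Dsin2 sqrtr1. Qed.

Lemma cis_sum (I : Type) (r : seq I) (P : pred I) (F : I -> R) :
  cis (\sum_(i <- r | P i) F i) = \prod_(i <- r | P i) cis (F i).
Proof. by rewrite (big_morph _ cisD cis0). Qed.

Lemma cisMn t n : cis (t *+ n) = cis t ^+ n.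
Proof. by elim: n => [|n IH]; rewrite ?mulr0n ?cis0 ?expr0// mulrS cisD IH exprS. Qed.

Lemma normc_cisB s t : Normc.normc (cis s - cis t) <= 2 * `|s - t|.
Proof.
apply: le_trans (normc_le_re_im _) _; rewrite mulr_natl mulr2n lerD//=.
- rewrite -[X in _ <= X]mul1r.
  by apply: (lipschitz_of_derive (df := fun x => - sin x)) => x; rewrite normrN sin_max.
- rewrite -[X in _ <= X]mul1r.
  by apply: (lipschitz_of_derive (df := fun x => cos x)) => x; rewrite cos_max.
Qed.

End Cis.

Section ComplexRiemann.
Variables (R : realType) (d : nat).
Local Notation Rd := 'rV[R]_d.
Implicit Types (f g : Rd -> R[i]) (L : R).

Definition cunif_cont f := forall ep, 0 < ep -> exists2 de, 0 < de &
  forall x y : Rd, `|x - y| <= de -> Normc.normc (f x - f y) <= ep.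

(** The class of integrands whose integrals are limits of grid sums; the bound [W] makes it stable
    under multiplication by bounded uniformly continuous functions. *)
Definition cc L f := [/\ cunif_cont f, supp_in L f &
  exists2 W, 0 <= W & forall x, Normc.normc (f x) <= W].

Definition csum N (h : R) f : R[i] :=
  (h ^+ d)%:C%C * \sum_b f (grid (N := N) h b).

Lemma dotp_le (x y : Rd) : `|dotp x y| <= d%:R * (`|x| * `|y|).
Proof.
apply: le_trans (ler_norm_sum _ _ _) _.
rewrite mulr_natl -[X in _ <= _ *+ X]card_ord -sumr_const; apply: ler_sum => i _.
by rewrite normrM ler_pM// entry_le_norm.
Qed.

Lemma dotpBl (x y z : Rd) : dotp (x - y) z = dotp x z - dotp y z.
Proof. by rewrite /dotp -sumrB; apply: eq_bigr => i _; rewrite !mxE mulrBl. Qed.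

Lemma dotpBr (x y z : Rd) : dotp x (y - z) = dotp x y - dotp x z.
Proof. by rewrite /dotp -sumrB; apply: eq_bigr => i _; rewrite !mxE mulrBr. Qed.

Lemma re_sum (I : Type) (r : seq I) (F : I -> R[i]) :
  complex.Re (\sum_(i <- r) F i) = \sum_(i <- r) complex.Re (F i).
Proof. exact: (raddf_sum (@complex.Re R : Rcomplex R -> R)). Qed.

Lemma im_sum (I : Type) (r : seq I) (F : I -> R[i]) :
  complex.Im (\sum_(i <- r) F i) = \sum_(i <- r) complex.Im (F i).
Proof. exact: (raddf_sum (@complex.Im R : Rcomplex R -> R)). Qed.

Lemma re_le f x y : `|complex.Re (f x) - complex.Re (f y)| <= Normc.normc (f x - f y).
Proof. by rewrite (le_trans _ (normc_re _))//; case: (f x) (f y) => a b []. Qed.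

Lemma im_le f x y : `|complex.Im (f x) - complex.Im (f y)| <= Normc.normc (f x - f y).
Proof. by rewrite (le_trans _ (normc_im _))//; case: (f x) (f y) => a b []. Qed.

Lemma cintegral_riemann f N h L ep : 0 < h -> h * N.*2.+1%:R = L *+ 2 ->
  cunif_cont f -> supp_in L f ->
  (forall x y : Rd, `|x - y| <= h -> Normc.normc (f x - f y) <= ep) ->
  Normc.normc (cintegral f - csum N h f) <= (d%:R * (L *+ 2) ^+ d * ep) *+ 2.
Proof.
move=> h0 hL uf sf mf; apply: le_trans (normc_le_re_im _) _.
have part (p : R[i] -> R) : p 0 = 0 ->
    (forall x y, `|p (f x) - p (f y)| <= Normc.normc (f x - f y)) ->
    `|iter_integral (p \o f) - h ^+ d * \sum_b (p \o f) (grid (N := N) h b)|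
      <= d%:R * (L *+ 2) ^+ d * ep.
  move=> p0 pf; apply: iter_integral_riemann => //.
  - move=> e /uf[de de0 H]; exists de => // x y /H; apply: le_trans; exact: pf.
  - by move=> x /sf /= ->.
  - by move=> x y /mf; apply: le_trans; exact: pf.
have := part (@complex.Re R) erefl (@re_le f).
have := part (@complex.Im R) erefl (@im_le f).
rewrite /csum -/(complex.Re _) => A B; rewrite mulr2n lerD//.
  apply: le_trans B; rewrite le_eqVlt; apply/orP; left; apply/eqP; congr `|_|.
  have -> : complex.Re (cintegral f - (h ^+ d)%:C%C * \sum_b f (grid (N:=N) h b)) =
    complex.Re (cintegral f) - complex.Re ((h ^+ d)%:C%C * \sum_b f (grid (N:=N) h b)).
    by case: (cintegral f); case: (_ * _).
  by rewrite -re_sum; case: (\sum_b _) => a b /=; rewrite mul0r subr0.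
apply: le_trans A; rewrite le_eqVlt; apply/orP; left; apply/eqP; congr `|_|.
have -> : complex.Im (cintegral f - (h ^+ d)%:C%C * \sum_b f (grid (N:=N) h b)) =
  complex.Im (cintegral f) - complex.Im ((h ^+ d)%:C%C * \sum_b f (grid (N:=N) h b)).
  by case: (cintegral f); case: (_ * _).
by rewrite -im_sum; case: (\sum_b _) => a b /=; rewrite mul0r addr0.
Qed.

Lemma eps_le_div (c e : R) : 0 <= c -> 0 < e -> exists2 e', 0 < e' & c * e' <= e.
Proof.
move=> c0 e0; exists (e / (c + 1)); first by rewrite divr_gt0// ltr_wpDl.
by rewrite mulrA ler_pdivrMr ?ltr_wpDl// mulrC ler_wpM2l ?(ltW e0)// lerDl.
Qed.

Lemma cintegral_lim f L : 0 < L -> cunif_cont f -> supp_in L f ->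
  forall ep, 0 < ep -> exists2 de, 0 < de & forall N h,
    0 < h -> h <= de -> h * N.*2.+1%:R = L *+ 2 ->
    Normc.normc (cintegral f - csum N h f) <= ep.
Proof.
move=> L0 uf sf ep ep0.
have c0 : 0 <= d%:R * (L *+ 2) ^+ d *+ 2.
  by rewrite mulrn_wge0// mulr_ge0// exprn_ge0// mulrn_wge0// ltW.
have [e' e'0 E] := eps_le_div c0 ep0.
have [de de0 H] := uf _ e'0; exists de => // N h h0 hd hL.
apply: le_trans (cintegral_riemann (ep := e') h0 hL uf sf _) _.
  by move=> x y xy; apply: H; exact: le_trans hd.
by rewrite -mulrnAl.
Qed.

Lemma csumD N h f g : csum N h (fun x => f x + g x) = csum N h f + csum N h g.
Proof. by rewrite /csum big_split mulrDr. Qed.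

Lemma cunif_contD f g : cunif_cont f -> cunif_cont g ->
  cunif_cont (fun x => f x + g x).
Proof.
move=> uf ug e e0; have e2 : 0 < e / 2 by rewrite divr_gt0.
have [d1 d10 H1] := uf _ e2; have [d2 d20 H2] := ug _ e2.
exists (Num.min d1 d2); first by rewrite lt_min d10.
move=> x y; rewrite le_min => /andP[/H1 A /H2 B].
have -> : f x + g x - (f y + g y) = (f x - f y) + (g x - g y) by ring.
by rewrite [e]splitr (le_trans (normcD _ _))// lerD.
Qed.

Lemma cunif_contM f g A B : 0 <= A -> 0 <= B ->
  cunif_cont f -> cunif_cont g ->
  (forall x, Normc.normc (f x) <= A) -> (forall x, Normc.normc (g x) <= B) ->
  cunif_cont (fun x => f x * g x).
Proof.
move=> A0 B0 uf ug fA gB e e0.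
have [e' e'0 E] := eps_le_div (addr_ge0 A0 B0) e0.
have [d1 d10 H1] := uf _ e'0; have [d2 d20 H2] := ug _ e'0.
exists (Num.min d1 d2); first by rewrite lt_min d10.
move=> x y; rewrite le_min => /andP[/H1 h1 /H2 h2].
have -> : f x * g x - f y * g y = f x * (g x - g y) + g y * (f x - f y) by ring.
rewrite (le_trans (normcD _ _))// (le_trans _ E)// mulrDl !Normc.normcM.
by rewrite lerD// ler_pM ?normc_ge0.
Qed.

Lemma ccD L f g : cc L f -> cc L g -> cc L (fun x => f x + g x).
Proof.
case=> uf sf [A A0 fA] [ug sg [B B0 gB]]; split.
- exact: cunif_contD.
- by move=> x Lx; rewrite sf// sg// addr0.
- exists (A + B); first exact: addr_ge0.
  by move=> x; rewrite (le_trans (normcD _ _))// lerD.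
Qed.

Lemma ccM L f g B : 0 <= B -> cc L f -> cunif_cont g ->
  (forall x, Normc.normc (g x) <= B) -> cc L (fun x => f x * g x).
Proof.
move=> B0 [uf sf [A A0 fA]] ug gB; split.
- exact: (cunif_contM A0 B0).
- by move=> x Lx; rewrite sf// mul0r.
- exists (A * B); first exact: mulr_ge0.
  by move=> x; rewrite Normc.normcM ler_pM ?normc_ge0.
Qed.

Lemma cc0 L : cc L (fun=> 0).
Proof.
split=> //; last by exists 0 => // x; rewrite Normc.normc0.
by move=> e e0; exists 1 => // x y _; rewrite subrr Normc.normc0 ltW.
Qed.

Lemma cc_widen L L' f : L <= L' -> cc L f -> cc L' f.
Proof. by move=> LL [uf sf bf]; split=> // x /(le_trans LL); exact: sf. Qed.

Lemma eq_of_normc_le (z w : R[i]) :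
  (forall e, 0 < e -> Normc.normc (z - w) <= e) -> z = w.
Proof.
move=> H; apply/eqP; rewrite -subr_eq0; apply/eqP/Normc.eq0_normc/le_anti.
rewrite normc_ge0 andbT; apply/ler_addgt0Pr => e e0; rewrite add0r; exact: H.
Qed.

(** Grid sums are exactly additive, and the identity passes to the limit on a grid fine enough for
    all three functions. *)
Lemma cintegralD L f g : 0 < L -> cc L f -> cc L g ->
  cintegral (fun x => f x + g x) = cintegral f + cintegral g.
Proof.
move=> L0 cf cg; have [uh sh _] := ccD cf cg.
have [uf sf _] := cf; have [ug sg _] := cg.
apply: eq_of_normc_le => e e0; have e3 : 0 < e / 3 by rewrite divr_gt0.
have [d1 d10 H1] := cintegral_lim L0 uf sf e3.
have [d2 d20 H2] := cintegral_lim L0 ug sg e3.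
have [d3 d30 H3] := cintegral_lim L0 uh sh e3.
have dm : 0 < Num.min d1 (Num.min d2 d3) by rewrite !lt_min d10 d20.
have [N [h [h0 hd hL]]] := exists_grid L0 dm.
move: hd; rewrite !le_min => /and3P[hd1 hd2 hd3].
have A := H1 N h h0 hd1 hL; have B := H2 N h h0 hd2 hL; have C := H3 N h h0 hd3 hL.
set F := cintegral f; set G := cintegral g; set H := cintegral _.
have -> : H - (F + G) = (H - csum N h (fun x => f x + g x)) +
  - ((F - csum N h f) + (G - csum N h g)) by rewrite csumD; ring.
apply: le_trans (normcD _ _) _; rewrite normc_opp.
have := normcD (F - csum N h f) (G - csum N h g).
move: A B C; rewrite -/F -/G -/H.
move: (Normc.normc _) (Normc.normc _) (Normc.normc _) (Normc.normc _) => a b c t.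
clear -a; lra.
Qed.

Lemma fourierE f xi : fourier f xi = cintegral (fun x => f x * cis (- dotp x xi)).
Proof. by rewrite /fourier /cis; congr cintegral; apply/funext => x; rewrite cosN sinN. Qed.

Lemma cunif_cont_cis_dotp xi : cunif_cont (fun x => cis (- dotp x xi)).
Proof.
move=> e e0; have c0 : 0 <= 2 * (d%:R * `|xi|) by rewrite !mulr_ge0.
have [e' e'0 E] := eps_le_div c0 e0.
exists e' => // x y xy; rewrite (le_trans (normc_cisB _ _))//.
rewrite (le_trans _ E)// -mulrA ler_wpM2l// opprK addrC -dotpBl -mulrA.
apply: le_trans (dotp_le _ _) _.
by rewrite ler_wpM2l// mulrC ler_wpM2l// distrC.
Qed.

Lemma cc_fourier_integrand L f xi : cc L f -> cc L (fun x => f x * cis (- dotp x xi)).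
Proof.
move=> cf; apply: (@ccM _ _ _ 1) => //; first exact: cunif_cont_cis_dotp.
by move=> x; rewrite normc_cis.
Qed.

Lemma cc_sum L (I : eqType) (r : seq I) (F : I -> Rd -> R[i]) :
  (forall i, i \in r -> cc L (F i)) -> cc L (fun x => \sum_(i <- r) F i x).
Proof.
elim: r => [|i r IH] H.
  rewrite (_ : (fun x => _) = fun=> 0); first exact: cc0.
  by apply/funext => x; rewrite big_nil.
rewrite (_ : (fun x => _) = fun x => F i x + \sum_(j <- r) F j x); last first.
  by apply/funext => x; rewrite big_cons.
apply: ccD; first by apply: H; rewrite mem_head.
by apply: IH => j jr; apply: H; rewrite in_cons jr orbT.
Qed.

Lemma fourierD L f g xi : 0 < L -> cc L f -> cc L g ->
  fourier (fun x => f x + g x) xi = fourier f xi + fourier g xi.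
Proof.
move=> L0 cf cg; rewrite !fourierE -(cintegralD L0); last 2 first.
- exact: cc_fourier_integrand.
- exact: cc_fourier_integrand.
by congr cintegral; apply/funext => x; rewrite mulrDl.
Qed.

Lemma fourier0 L xi : 0 < L -> @fourier R d (fun=> 0) xi = 0.
Proof.
move=> L0; have := fourierD xi L0 (cc0 L) (cc0 L).
rewrite (_ : (fun x => _) = fun=> 0); last by apply/funext => x; rewrite addr0.
by move/eqP; rewrite -subr_eq0 opprD addrA subrr sub0r oppr_eq0 => /eqP.
Qed.

Lemma fourier_sum L (I : eqType) (r : seq I) (F : I -> Rd -> R[i]) xi : 0 < L ->
  (forall i, i \in r -> cc L (F i)) ->
  fourier (fun x => \sum_(i <- r) F i x) xi = \sum_(i <- r) fourier (F i) xi.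
Proof.
move=> L0; elim: r => [|i r IH] H.
  rewrite big_nil (_ : (fun x => _) = fun=> 0) ?(fourier0 _ L0)//.
  by apply/funext => x; rewrite big_nil.
have Hr j : j \in r -> cc L (F j) by move=> jr; apply: H; rewrite in_cons jr orbT.
have Hi : cc L (F i) by apply: H; rewrite mem_head.
rewrite big_cons -(IH Hr) -(fourierD _ L0 Hi (cc_sum Hr)).
by congr fourier; apply/funext => x; rewrite big_cons.
Qed.

(** The grid is uniform over [|xi| <= B], since the oscillating factor has a modulus of continuity
    proportional to [|xi|]. In the multiplier estimate one grid has to serve all frequencies
    [xi - grid lam k] within [ka] of [xi] at once. *)
Lemma fourier_lim f L B : 0 < L -> cc L f ->
  forall ep, 0 < ep -> exists2 de, 0 < de & forall N h xi,
    0 < h -> h <= de -> h * N.*2.+1%:R = L *+ 2 -> `|xi| <= B ->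
    Normc.normc (fourier f xi - csum N h (fun x => f x * cis (- dotp x xi))) <= ep.
Proof.
move=> L0 cf ep ep0; have [uf sf [W W0 fW]] := cf.
have c0e1 : 0 <= ((d%:R * (L *+ 2) ^+ d) *+ 2) by rewrite mulrn_wge0// mulr_ge0// exprn_ge0// mulrn_wge0// ltW.
have [e1 e10 E1] := eps_le_div c0e1 ep0.
have e2 : 0 < e1 / 2 by rewrite divr_gt0.
have [d1 d10 H1] := uf _ e2.
have B0 : 0 <= Num.max B 0 by rewrite le_max lexx orbT.
have c0d2 : 0 <= (W * (2 * (d%:R * Num.max B 0))) by rewrite !mulr_ge0.
have [d2 d20 H2] := eps_le_div c0d2 e2.
exists (Num.min d1 d2); first by rewrite lt_min d10.
move=> N h xi h0; rewrite le_min => /andP[hd1 hd2] hL xiB.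
have [u' s' _] := cc_fourier_integrand xi cf.
rewrite fourierE; apply: le_trans (cintegral_riemann (ep := e1) h0 hL u' s' _) _; last first.
  by rewrite -mulrnAl.
move=> x y xy.
have -> : f x * cis (- dotp x xi) - f y * cis (- dotp y xi) =
  (f x - f y) * cis (- dotp x xi) + f y * (cis (- dotp x xi) - cis (- dotp y xi)) by ring.
rewrite [e1]splitr (le_trans (normcD _ _))// lerD// Normc.normcM.
  by rewrite normc_cis mulr1 H1// (le_trans xy).
rewrite (le_trans _ H2)// -mulrA ler_pM ?normc_ge0//.
rewrite (le_trans (normc_cisB _ _))// -mulrA ler_wpM2l// opprK addrC -dotpBl.
apply: le_trans (dotp_le _ _) _.
rewrite -mulrA ler_wpM2l// mulrC ler_pM//; first by rewrite le_max xiB.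
by rewrite distrC (le_trans xy).
Qed.

End ComplexRiemann.

(** * Characters of the grid: lower bounds and orthogonality *)

Section CisBounds.
Variable R : realType.

(** With [s = t / 4 <= pi / 4], doubling gives [sin (t / 2) = 2 * sin s * cos s]; the mean value
    theorem writes [sin s] as [s * cos c], and both cosines are at least [cos (pi / 4)], whose
    square is [1 / 2]. *)
Lemma sin_half_lower (t : R) : 0 <= t <= pi -> t / 4 <= sin (t / 2).
Proof.
move=> /andP[t0 tpi]; set s := t / 4.
have s0 : 0 <= s by rewrite /s divr_ge0.
have spi : s <= pi / 4 by rewrite /s ler_pM2r.
have pi0 := @pi_gt0 R.
have [c /andP[c0 cs] E] := MVT_line s0 (fun x => is_derive_sin x).
rewrite sin0 !subr0 in E.
pose q : R := cos (pi / 4).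
have q2 : q ^+ 2 = 2^-1.
  have := cos_mulr2n (pi / 4 : R).
  have -> : (pi / 4) *+ 2 = pi / 2 :> R by rewrite -mulr_natl; field.
  by rewrite cos_pihalf -/q mulr2n; lra.
have cosq x : 0 <= x <= s -> q <= cos x.
  move=> /andP[x0 xs]; rewrite leNgt ltr_cos ?in_itv/=; last 2 first.
  - by apply/andP; split; move: pi0 spi xs x0; clear -s; lra.
  - by apply/andP; split; move: pi0 spi xs x0; clear -s; lra.
  by rewrite -leNgt; apply: le_trans spi.
have q0 : 0 <= q by apply: cos_ge0_pihalf; apply/andP; split; move: pi0; clear; lra.
have -> : t / 2 = s *+ 2 by rewrite /s -mulr_natl; field.
rewrite sin_mulr2n E.
have A : q <= cos c by apply: cosq; rewrite c0.
have B : q <= cos s by apply: cosq; rewrite s0 lexx.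
have : s * q ^+ 2 <= cos s * (cos c * s).
  by rewrite mulrA mulrC ler_wpM2r// expr2 ler_pM.
by rewrite q2; move: (cos s * _) => X; rewrite -[X *+ 2]mulr_natr; clear; lra.
Qed.

Lemma normc_cis_sub1 (t : R) : Normc.normc (cis t - 1) ^+ 2 = 4 * sin (t / 2) ^+ 2.
Proof.
rewrite /cis /= sqr_sqrtr ?addr_ge0 ?sqr_ge0//.
have C2 := cos2Dsin2 t; have C1 := cos2Dsin2 (t / 2).
have := cos_mulr2n (t / 2); have -> : (t / 2) *+ 2 = t by rewrite -mulr_natl; field.
rewrite mulr2n => H; rewrite oppr0 addr0.
have -> : sin t ^+ 2 = 1 - cos t ^+ 2 by move: C2; clear; lra.
have : cos (t / 2) ^+ 2 = 1 - sin (t / 2) ^+ 2 by move: C1; clear; lra.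
by move=> Y; rewrite Y in H; rewrite H; ring.
Qed.

(** The lower bound through which summation by parts turns bounds on differences into decay of
    discrete Fourier coefficients. *)
Lemma normc_cis_sub1_ge (t : R) : `|t| <= pi -> `|t| / 2 <= Normc.normc (cis t - 1).
Proof.
move=> tpi; rewrite -(ler_sqr (x := _ / 2)) ?nnegrE ?normc_ge0 ?divr_ge0//.
have -> : Normc.normc (cis t - 1) ^+ 2 = 4 * sin (`|t| / 2) ^+ 2.
  rewrite normc_cis_sub1; congr (_ * _); case: (ler0P t) => // _.
  by rewrite mulNr sinN sqrrN.
have := @sin_half_lower `|t|; rewrite tpi normr_ge0 => /(_ erefl) H.
have : (`|t| / 4) ^+ 2 <= sin (`|t| / 2) ^+ 2.
  by rewrite ler_sqr ?nnegrE ?divr_ge0// (le_trans _ H)// divr_ge0.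
have -> : (`|t| / 4) ^+ 2 = (`|t| / 2) ^+ 2 / 4 by field.
by move: ((`|t| / 2) ^+ 2) (sin _ ^+ 2) => X Y; clear; lra.
Qed.

Lemma cis_neq1 (t : R) : 0 < `|t| < pi *+ 2 -> cis t != 1.
Proof.
move=> /andP[t0 t2]; apply/eqP => E.
have := normc_cis_sub1 t; rewrite E subrr Normc.normc0 expr0n /= => /esym/eqP.
rewrite mulf_eq0 (pnatr_eq0 R 4)/= expf_eq0/=.
have : 0 < sin (`|t| / 2).
  apply: sin_gt0_pi; rewrite divr_gt0//= ltr_pdivrMr//.
  by rewrite mulr_natr.
by case: (ler0P t) => _; rewrite ?mulNr ?sinN; [rewrite oppr_gt0 lt_neqAle|rewrite lt0r] => /andP[/negPf->].
Qed.

Lemma cis_2pi_nat (n : nat) : cis ((pi *+ 2) *+ n) = 1 :> R[i].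
Proof. by rewrite cisMn {1}/cis cos2pi sin2pi expr1n. Qed.

Lemma cisN_eq1 (t : R) : cis t = 1 -> cis (- t) = 1.
Proof. by move=> E; have := cisD t (- t); rewrite subrr cis0 E mul1r. Qed.

(** A geometric sum whose ratio is an [N.*2.+1]-th root of unity; for [a != b] the ratio differs
    from [1] because its phase is nonzero and below [2 * pi] in absolute value. *)
Lemma cis_orthogonality (N a b : nat) (w : R) : w * N.*2.+1%:R = pi *+ 2 ->
  (a < N.*2.+1)%N -> (b < N.*2.+1)%N ->
  \sum_(k < N.*2.+1) cis (w * (a%:R - b%:R) * (k%:R - N%:R)) =
  (if a == b then N.*2.+1%:R else 0) :> R[i].
Proof.
move=> wG aG bG; set G := N.*2.+1; set t := w * _.
have G0 : 0 < G%:R :> R by rewrite ltr0n.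
have -> : \sum_(k < G) cis (t * (k%:R - N%:R)) = cis (- (t * N%:R)) * \sum_(k < G) cis t ^+ k.
  by rewrite mulr_sumr; apply: eq_bigr => k _; rewrite -cisMn -cisD mulrBr addrC !mulr_natr.
case: eqP => [ab|/eqP ab].
  rewrite /t ab subrr mulr0 mul0r oppr0 cis0 mul1r.
  by under eq_bigr do rewrite expr1n; rewrite sumr_const card_ord.
have x1 : cis t != 1.
  apply: cis_neq1; rewrite normrM.
  have w0 : 0 < w by rewrite -(pmulr_lgt0 _ G0) wG pmulrn_lgt0// pi_gt0.
  rewrite (gtr0_norm w0) -wG ltr_pM2l// pmulr_rgt0// normr_gt0 subr_eq0 eqr_nat ab /=.
  rewrite ltr_norml; have a0 := ler0n R a; have b0 := ler0n R b.
  move: aG bG; rewrite -(ltr_nat R) -(ltr_nat R b) -/G.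
  by move: a0 b0; clear => ? ? ? ?; apply/andP; split; lra.
have xG : cis t ^+ G = 1.
  rewrite -cisMn -mulr_natr /t mulrAC wG.
  case: (leqP b a) => ba; first by rewrite -natrB// mulr_natr cis_2pi_nat.
  by rewrite -opprB -natrB ?(ltnW ba)// mulrN mulr_natr; apply/cisN_eq1/cis_2pi_nat.
have := subrX1 (cis t) G; rewrite xG subrr => /esym/eqP.
by rewrite mulf_eq0 subr_eq0 (negPf x1) /= => /eqP ->; rewrite mulr0.
Qed.

(** The correction [2 / N.+1] lets the induction close: the two new end terms add
    [2 * (N + 2) ^- 2], which is at most [2 / (N + 1) - 2 / (N + 2)]. *)
Lemma sum_inv_sq_le (N : nat) :
  \sum_(a < N.*2.+1) (1 + `|a%:R - N%:R|) ^- 2 <= 4 - 2 / N.+1%:R :> R.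
Proof.
elim: N => [|N IH].
  by rewrite big_ord1 subrr normr0 addr0 expr1n invr1; lra.
rewrite doubleS big_ord_recl big_ord_recr /=.
have E : \sum_(i < N.*2.+1) (1 + `|(bump 0 i)%:R - N.+1%:R|) ^- 2 =
   \sum_(a < N.*2.+1) (1 + `|a%:R - N%:R|) ^- 2 :> R.
  by apply: eq_bigr => i _; rewrite /bump /= add1n -!natr1 opprD addrACA subrr addr0.
rewrite E /bump leq0n add1n sub0r normrN.
have -> : (N.*2.+1.+1)%:R - N.+1%:R = N.+1%:R :> R.
  by rewrite -addnn -addSn -addnS natrD addrK.
rewrite ger0_norm //; set S := \sum_(_ < _) _ in IH *.
rewrite -[N.+2%:R]natr1; set x := N.+1%:R in IH *.
have x0 : 0 < x :> R by rewrite ltr0n.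
rewrite [1 + x]addrC.
have D : 2 * (x + 1) ^- 2 <= 2 / x - 2 / (x + 1).
  have -> : 2 / x - 2 / (x + 1) = 2 * (x * (x + 1))^-1.
    by field; rewrite !lt0r_neq0// ltr_wpDl// ltW.
  rewrite ler_pM2l// lef_pV2 ?posrE ?mulr_gt0 ?exprn_gt0 ?addr_gt0//.
  by rewrite expr2 ler_pM2r ?addr_gt0// lerDl.
by move: IH D; move: (2 / x) (2 / (x + 1)) ((x + 1) ^- 2) => p q r; clear; lra.
Qed.

Lemma sum_inv_sq_le4 (N : nat) :
  \sum_(a < N.*2.+1) (1 + `|a%:R - N%:R|) ^- 2 <= 4 :> R.
Proof. by apply: le_trans (sum_inv_sq_le N) _; rewrite gerBl divr_ge0. Qed.

End CisBounds.

(** * Finite differences and the discrete Fourier transform *)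

Section Differences.
Variables (R : realType) (d : nat).
Local Notation Rd := 'rV[R]_d.
Implicit Types (f g th w : Rd -> R[i]).

Definition fdiff (i : 'I_d) (h : R) f : Rd -> R[i] :=
  fun x => f (x + h *: delta_mx 0 i) - f x.

(** The case [p = 0] bounds [f] itself. Only iterates along one axis with one step are recorded,
    because a grid frequency will be estimated through its largest coordinate alone. *)
Definition dbound (l : nat) (h0 C : R) f := forall i p x h,
  (p <= l)%N -> 0 < h -> h <= h0 ->
  Normc.normc (iter p (fdiff i h) f x) <= C * h ^+ p.

Lemma norm_delta_scale i (h : R) : `|h *: delta_mx 0 i : Rd| <= `|h|.
Proof.
apply: norm_le_entry => // j; rewrite !mxE eqxx /=.
by case: eqP => _; rewrite ?mulr1// mulr0 normr0.
Qed.

Lemma fdiff_supp i h A f : 0 <= h -> supp_in A f -> supp_in (A + h) (fdiff i h f).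
Proof.
move=> h0 sf x Ax; rewrite /fdiff !sf ?subr0//; first by apply: le_trans Ax; rewrite lerDl.
have := lerB_normD x (h *: delta_mx 0 i); have := norm_delta_scale i h.
by rewrite (ger0_norm h0); move: Ax; clear; lra.
Qed.

Definition dft N (h lam : R) f (k : 'rV['I_N.*2.+1]_d) : R[i] :=
  \sum_(b : 'rV['I_N.*2.+1]_d) f (grid h b) * cis (- dotp (grid h b) (grid lam k)).

(** Summation by parts: a shift by one cell is the cyclic shift of the grid along axis [i]. The
    wrap-around is harmless, since [A + h <= L] puts both the point shifted out of the cube and the
    point it is wrapped to where [f] vanishes. *)
Lemma dft_fdiff N (h lam L A : R) f (k : 'rV['I_N.*2.+1]_d) i :
  0 < h -> h * N.*2.+1%:R = L *+ 2 -> supp_in A f -> A + h <= L ->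
  dft h lam (fdiff i h f) k =
  (cis (h * lam * ((k 0 i)%:R - N%:R)) - 1) * dft h lam f k.
Proof.
move=> h0 hL sf AL; set ph := grid lam k.
pose Y x := f x * cis (- dotp x ph).
pose S (b : 'rV['I_N.*2.+1]_d) : 'rV['I_N.*2.+1]_d :=
  \row_j (if j == i then ordS (b 0 j) else b 0 j).
(* Samples are midpoints, so the outermost ones lie half a cell inside [[- L, L]]. *)
have NL : h * N%:R = L - h / 2.
  by move: hL; rewrite -addnn -natr1 natrD mulr2n; clear; lra.
have YS b : Y (grid h b + h *: delta_mx 0 i) = Y (grid h (S b)).
  case: (ltnP (b 0 i).+1 N.*2.+1) => bi.
    congr Y; apply/rowP => j; rewrite !mxE eqxx /=.
    case: eqP => [->|_]; last by rewrite mulr0 addr0.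
    by rewrite /= modn_small// -natr1; ring.
  have {}bi : b 0 i = N.*2 :> nat.
    by apply/eqP; rewrite eqn_leq -ltnS ltn_ord /= -ltnS.
  have e1 : L <= `|grid h b + h *: delta_mx 0 i|.
    apply: le_trans (entry_le_norm _ i); rewrite !mxE !eqxx bi mulr1.
    rewrite -addnn natrD addrK NL ger0_norm; first by move: h0; clear; lra.
    by rewrite -NL addr_ge0// ?mulr_ge0// ltW.
  have e2 : L - h <= `|grid h (S b)|.
    apply: le_trans (entry_le_norm _ i); rewrite !mxE !eqxx /= bi modnn sub0r mulrN normrN NL.
    rewrite ger0_norm; first by move: h0; clear; lra.
    by rewrite -NL mulr_ge0// ltW.
  rewrite /Y !sf ?mul0r//; first by apply: le_trans e2; rewrite lerBrDr.
  by apply: le_trans e1; apply: le_trans AL; rewrite lerDl ltW.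
have Sinj : injective S.
  move=> b c /rowP E; apply/rowP => j; have := E j; rewrite !mxE.
  by case: eqP => // _ /ordS_inj.
have -> : dft h lam f k = \sum_(b : 'rV['I_N.*2.+1]_d) Y (grid h b) by [].
rewrite mulrBl mul1r {1}(reindex_inj Sinj) /= mulr_sumr -sumrB.
apply: eq_bigr => b _; rewrite -YS /Y /fdiff mulrBl; congr (_ - _).
rewrite mulrCA -cisD; congr (_ * cis _).
have -> : dotp (grid h b + h *: delta_mx 0 i) ph = dotp (grid h b) ph + h * ph 0 i.
  rewrite /dotp [X in _ = _ + X](_ : _ = \sum_(j < d) (h *: delta_mx 0 i : Rd) 0 j * ph 0 j).
    by rewrite -big_split; apply: eq_bigr => j _; rewrite !mxE mulrDl.
  rewrite (bigD1 i) //= big1 => [|j ji]; first by rewrite !mxE !eqxx mulr1 addr0.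
  by rewrite !mxE (negPf ji) andbF mulr0 mul0r.
by rewrite [ph 0 i]mxE; ring.
Qed.

(** Each difference enlarges the support by [h], hence the margin [p * h]. *)
Lemma dft_iter_fdiff N (h lam L A : R) f (k : 'rV['I_N.*2.+1]_d) i p :
  0 < h -> h * N.*2.+1%:R = L *+ 2 -> supp_in A f -> A + p%:R * h <= L ->
  dft h lam (iter p (fdiff i h) f) k =
  (cis (h * lam * ((k 0 i)%:R - N%:R)) - 1) ^+ p * dft h lam f k.
Proof.
move=> h0 hL sf AL.
have S q : supp_in (A + q%:R * h) (iter q (fdiff i h) f).
  elim: q => [|q IH]; first by rewrite mul0r addr0.
  rewrite iterS -natr1 mulrDl mul1r addrA; apply: fdiff_supp => //; exact: ltW.
have : (p <= p)%N by [].
elim: {-2}p => [|q IH] qp; first by rewrite expr0 mul1r.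
rewrite iterS (dft_fdiff _ _ _ h0 hL (S q)).
  by rewrite IH ?(ltnW qp)// exprS mulrA.
apply: le_trans AL; rewrite -addrA lerD2l -{2}[h]mul1r -mulrDl natr1.
by rewrite ler_pM2r// ler_nat.
Qed.

Lemma dft_bound N (h lam L A C : R) f (k : 'rV['I_N.*2.+1]_d) i p :
  0 < h -> 0 < lam -> h * N.*2.+1%:R = L *+ 2 -> lam * L = pi ->
  supp_in A f -> A + p%:R * h <= L ->
  (forall x, Normc.normc (iter p (fdiff i h) f x) <= C * h ^+ p) ->
  Normc.normc (dft h lam f k) * (lam * `|(k 0 i)%:R - N%:R| / 2) ^+ p <=
  C * N.*2.+1%:R ^+ d.
Proof.
move=> h0 lam0 hL lamL sf AL dC.
set z : R := (k 0 i)%:R - N%:R.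
have G0 : 0 < N.*2.+1%:R :> R by rewrite ltr0n.
have zN : `|z| <= N%:R.
  have : (k 0%R i <= N + N)%N by rewrite -ltnS addnn ltn_ord.
  rewrite /z ler_norml -(ler_nat R) natrD; have := ler0n R (k 0 i).
  by move: (_%:R) (N%:R) => u v; clear => ? ?; apply/andP; split; lra.
have tpi : `|h * lam * z| <= pi.
  rewrite normrM (gtr0_norm (mulr_gt0 _ _))//.
  have -> : h * lam * `|z| = lam * (h * `|z|) by ring.
  rewrite -lamL ler_pM2l//; apply: le_trans (_ : h * N%:R <= _).
    by rewrite ler_pM2l.
  have : h * N%:R *+ 2 <= L *+ 2.
    by rewrite -hL -mulrnAr -mulr_natr -natrM muln2 ler_pM2l// ler_nat.
  by rewrite ler_pMn2r.
have lowb := normc_cis_sub1_ge tpi.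
have E := @dft_iter_fdiff N h lam L A f k i p h0 hL sf AL.
have U : Normc.normc (dft h lam (iter p (fdiff i h) f) k) <= C * h ^+ p * N.*2.+1%:R ^+ d.
  apply: le_trans (normc_sum _ _ _) _.
  have T (b : 'rV['I_N.*2.+1]_d) : Normc.normc (iter p (fdiff i h) f (grid h b) *
      cis (- dotp (grid h b) (grid lam k))) <= C * h ^+ p.
    by rewrite Normc.normcM normc_cis mulr1.
  apply: le_trans (ler_sum _ (fun b _ => T b)) _.
  by rewrite sumr_const card_mx card_ord mul1n -[_ *+ _]mulr_natr natrX.
have hp : 0 < h ^+ p by rewrite exprn_gt0.
rewrite -(ler_pM2r hp) -[X in _ <= X]mulrAC; apply: le_trans U.
rewrite E Normc.normcM normcX.
rewrite -[X in X <= _]mulrA [X in X <= _]mulrC -exprMn ler_wpM2r ?normc_ge0//.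
have n0 : 0 <= lam * `|z| / 2 * h by rewrite mulr_ge0 ?(ltW h0)// divr_ge0// mulr_ge0// ltW.
rewrite lerXn2r ?nnegrE ?normc_ge0//.
apply: le_trans lowb; rewrite normrM (gtr0_norm (mulr_gt0 _ _))//.
by rewrite le_eqVlt; apply/orP; left; apply/eqP; ring.
Qed.

(** Exchanging the sums leaves a sum of characters over the frequency grid, which factors into
    one-dimensional orthogonality relations, one for each axis. *)
Lemma dft_inversion N (h lam L : R) f (b : 'rV['I_N.*2.+1]_d) :
  h * N.*2.+1%:R = L *+ 2 -> lam * L = pi ->
  \sum_(k : 'rV['I_N.*2.+1]_d) dft h lam f k * cis (dotp (grid h b) (grid lam k)) =
  (N.*2.+1%:R ^+ d) * f (grid h b).
Proof.
move=> hL lamL; set G : R[i] := N.*2.+1%:R.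
have wG : h * lam * N.*2.+1%:R = pi *+ 2.
  by rewrite mulrAC hL -lamL mulrnAl mulrC.
have O (b' : 'rV['I_N.*2.+1]_d) : \sum_(k : 'rV['I_N.*2.+1]_d) cis (dotp (grid h b - grid h b') (grid lam k)) =
    (if b == b' then G ^+ d else 0).
  pose g (i : 'I_d) (a : 'I_N.*2.+1) : R[i] :=
    cis (h * lam * ((b 0 i)%:R - (b' 0 i)%:R) * (a%:R - N%:R)).
  have E (k : 'rV['I_N.*2.+1]_d) :
      cis (dotp (grid h b - grid h b') (grid lam k)) = \prod_i g i (k 0 i).
    rewrite /dotp cis_sum; apply: eq_bigr => i _; congr cis.
    by rewrite !mxE; ring.
  rewrite (eq_bigr _ (fun k _ => E k)) sum_row_prod /g.
  under eq_bigr => i _ do rewrite cis_orthogonality//.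
  case: eqP => [->|/eqP bb].
    by under eq_bigr do rewrite eqxx; rewrite prodr_const card_ord.
  have [i bi] : exists i, b 0 i != b' 0 i.
    apply/existsP; apply: contraT; rewrite negb_exists => /forallP H.
    by case/negP: bb; apply/eqP/rowP => i; apply/eqP; have := H i; rewrite negbK.
  by rewrite (bigD1 i) //= -val_eqE /= in bi *; rewrite (negPf bi) mul0r.
have -> : \sum_(k : 'rV['I_N.*2.+1]_d) dft h lam f k * cis (dotp (grid h b) (grid lam k)) =
  \sum_(b' : 'rV['I_N.*2.+1]_d) f (grid h b') * \sum_(k : 'rV['I_N.*2.+1]_d) cis (dotp (grid h b - grid h b') (grid lam k)).
  under eq_bigr => k _ do rewrite /dft mulr_suml.
  rewrite exchange_big /=; apply: eq_bigr => b' _; rewrite mulr_sumr.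
  by apply: eq_bigr => k _; rewrite -mulrA -cisD dotpBl addrC.
rewrite (bigD1 b) //= O eqxx big1 ?addr0 1?mulrC// => b' bb'.
by rewrite O eq_sym (negPf bb') mulr0.
Qed.

End Differences.

(** * The multiplier estimate *)

Section Multiplier.
Variables (R : realType) (d : nat).
Local Notation Rd := 'rV[R]_d.
Implicit Types (f g th w : Rd -> R[i]).

(** On the grid [th] is exactly a combination of characters, and multiplying [w] by a character
    translates its transform by [grid lam k]. *)
Lemma csum_mul N (h lam L : R) th w (xi : Rd) :
  h * N.*2.+1%:R = L *+ 2 -> lam * L = pi ->
  csum N h (fun x => th x * w x * cis (- dotp x xi)) =
  \sum_(k : 'rV['I_N.*2.+1]_d) N.*2.+1%:R ^- d * dft h lam th k *
     csum N h (fun x => w x * cis (- dotp x (xi - grid lam k))).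
Proof.
move=> hL lamL; have G0 : N.*2.+1%:R ^+ d != 0 :> R[i].
  by rewrite expf_neq0// pnatr_eq0.
rewrite /csum.
under [RHS]eq_bigr => k _ do rewrite mulrCA; rewrite -mulr_sumr; congr (_ * _).
under [RHS]eq_bigr => k _ do rewrite mulr_sumr.
rewrite exchange_big /=; apply: eq_bigr => b _.
apply: (mulfI G0); rewrite !mulrA -(dft_inversion th b hL lamL) !mulr_suml mulr_sumr.
apply: eq_bigr => k _.
rewrite !mulrA divff// mul1r -!mulrA; congr (_ * _).
by rewrite dotpBr opprB cisD mulrCA.
Qed.

Lemma normc_csum_le N (h L W : R) f : 0 < h -> h * N.*2.+1%:R = L *+ 2 ->
  (forall x, Normc.normc (f x) <= W) -> Normc.normc (csum N h f) <= (L *+ 2) ^+ d * W.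
Proof.
move=> h0 hL fW; rewrite /csum Normc.normcM normc_real ger0_norm ?exprn_ge0 ?(ltW h0)//.
rewrite -hL exprMn -mulrA ler_wpM2l ?exprn_ge0 ?(ltW h0)//.
apply: le_trans (normc_sum _ _ _) _.
apply: le_trans (ler_sum _ (fun b _ => fW _)) _.
by rewrite sumr_const card_mx card_ord mul1n -[W *+ _]mulr_natl natrX.
Qed.

Definition zwt N (a : 'I_N.*2.+1) : R := 1 + `|a%:R - N%:R|.

Lemma zwt_ge1 N (a : 'I_N.*2.+1) : 1 <= zwt a.
Proof. by rewrite /zwt lerDl. Qed.

Lemma natr_complex_norm (n : nat) : Normc.normc (n%:R : R[i]) = n%:R.
Proof. by rewrite -(rmorph_nat (real_complex R)) normc_real normr_nat. Qed.

(** Orders [0] and [l] suffice: for a zero coordinate the weight is [1]; otherwise the integer [z]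
    has [|z| >= 1] and the weight is at most [2 * |z| = 4 / lam * (lam * |z| / 2)]. *)
Lemma dft_coeff_bound N (h lam L M C : R) th (k : 'rV['I_N.*2.+1]_d) i l h0 :
  0 < h -> h <= h0 -> 0 < lam -> h * N.*2.+1%:R = L *+ 2 -> lam * L = pi ->
  supp_in M th -> M + l%:R * h <= L -> dbound l h0 C th ->
  Normc.normc (N.*2.+1%:R ^- d * dft h lam th k) * zwt (k 0 i) ^+ l <=
  C * (1 + 4 / lam) ^+ l.
Proof.
move=> h_gt0 hh0 lam0 hL lamL sth ML db.
set z : R := (k 0 i)%:R - N%:R.
have Gd : 0 < N.*2.+1%:R ^+ d :> R by rewrite exprn_gt0// ltr0n.
have bnd p : (p <= l)%N ->
    Normc.normc (N.*2.+1%:R ^- d * dft h lam th k) * (lam * `|z| / 2) ^+ p <= C.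
  move=> pl; rewrite Normc.normcM Normc.normcV normcX natr_complex_norm -mulrA mulrC ler_pdivrMr//.
  apply: (@dft_bound R d N h lam L M C th k i p h_gt0 lam0 hL lamL sth) => [|x]; last exact: db.
  by apply: le_trans ML; rewrite lerD2l ler_pM2r// ler_nat.
have b0 := bnd 0%N isT; have bl := bnd l (leqnn l).
rewrite expr0 mulr1 in b0.
set c := Normc.normc _ in b0 bl *.
have c0 : 0 <= c by exact: normc_ge0.
have C0 : 0 <= C by exact: le_trans b0.
have A1 : 1 <= 1 + 4 / lam by rewrite lerDl divr_ge0// ltW.
have [z0|z0] := eqVneq z 0.
  rewrite /zwt -/z z0 normr0 addr0 expr1n mulr1 (le_trans b0)//.
  by rewrite -{1}[C]mulr1 ler_wpM2l// exprn_ege1.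
have z1 : 1 <= `|z|.
  rewrite /z; case: (leqP N (k 0 i)) => H.
    rewrite -natrB// normr_nat ler1n subn_gt0 ltn_neqAle H andbT.
    by apply: contraNneq z0 => E; rewrite /z -E subrr.
  by rewrite distrC -natrB ?(ltnW H)// normr_nat ler1n subn_gt0.
have step : zwt (k 0 i) <= (1 + 4 / lam) * (lam * `|z| / 2).
  rewrite /zwt -/z mulrDl mul1r.
  have -> : 4 / lam * (lam * `|z| / 2) = 2 * `|z| by field; rewrite lt0r_neq0.
  apply: (@le_trans _ _ (2 * `|z|)); first by move: z1; clear; lra.
  by rewrite lerDr divr_ge0// mulr_ge0// ltW.
apply: le_trans (_ : c * ((1 + 4 / lam) * (lam * `|z| / 2)) ^+ l <= _).
  rewrite ler_wpM2l// lerXn2r// nnegrE; first exact: le_trans (zwt_ge1 _).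
  exact: le_trans (le_trans ler01 (zwt_ge1 _)) step.
by rewrite exprMn mulrCA mulrC ler_wpM2r// exprn_ge0// (le_trans ler01).
Qed.

(** The [l] inverse powers of the largest weight [zm] are shared out: [d.*2] of them pay for the
    product of all [zwt ^- 2], which is summable over the grid uniformly in [N]; the other
    [l - d.*2] give smallness whenever some weight exceeds [ga]. When none does, the bound [al] on
    [V] applies. *)
Lemma weighted_coeff_bound N (c B al be ka ga : R) (k : 'rV['I_N.*2.+1]_d) (V : R) l :
  (0 < d)%N -> (d.*2 <= l)%N -> 0 <= c -> 0 <= B -> 0 <= al -> 0 <= be -> 0 < ga ->
  (forall i, c * zwt (k 0 i) ^+ l <= B) ->
  V <= be -> ((forall i, zwt (k 0 i) <= ga) -> V <= al) ->
  c * V <= B * (\prod_i zwt (k 0 i) ^- 2) * (al + be * ga^-1 ^+ (l - d.*2)).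
Proof.
move=> d0 dl c0 B0 al0 be0 ga0 cB Vbe Val.
have zp i : 0 < zwt (k 0 i) by exact: lt_le_trans (zwt_ge1 _).
pose i0 := Ordinal d0.
have [im _ imax] := @arg_maxP _ R 'I_d i0 xpredT (fun i => zwt (k 0 i)) isT.
set zm := zwt (k 0 im) in imax *.
have zm0 : 0 < zm by exact: zp.
have zm1 : 1 <= zm by exact: zwt_ge1.
set P := \prod_i _.
have P0 : 0 < P by apply: prodr_gt0 => i _; rewrite invr_gt0 exprn_gt0.
have cz : c <= B * zm^-1 ^+ l.
  by rewrite exprVn -ler_pdivrMr ?invr_gt0 ?exprn_gt0// invrK cB.
have zP : zm^-1 ^+ d.*2 <= P.
  rewrite -mul2n exprM -[X in _ ^+ X]card_ord -prodr_const; apply: ler_prod => i _.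
  rewrite exprn_ge0 ?invr_ge0 ?(ltW zm0)//= exprVn lef_pV2 ?posrE ?exprn_gt0//.
  by rewrite lerXn2r ?nnegrE ?(ltW (zp _)) ?(ltW zm0)//; exact: imax.
have g0 : 0 <= ga^-1 ^+ (l - d.*2) by rewrite exprn_ge0// invr_ge0 ltW.
have zl : zm^-1 ^+ l = zm^-1 ^+ d.*2 * zm^-1 ^+ (l - d.*2) by rewrite -exprD subnKC.
have zle1 : zm^-1 ^+ (l - d.*2) <= 1.
  by rewrite exprn_ile1 ?invr_ge0 ?(ltW zm0)// invf_le1.
have cP : c <= B * P.
  apply: le_trans cz _; rewrite ler_wpM2l// zl -[P]mulr1 ler_pM// ?exprn_ge0 ?invr_ge0 ?ltW//.
have [ok|/forallPn /= [j /negP jga]] := boolP [forall i, zwt (k 0 i) <= ga].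
  have {}Val := Val (fun i => forallP ok i).
  apply: le_trans (_ : c * al <= _); first by rewrite ler_wpM2l.
  rewrite ler_pM// lerDl mulr_ge0//.
apply: le_trans (_ : c * be <= _); first by rewrite ler_wpM2l.
have gz : ga <= zm by apply: le_trans (imax j isT); move/negP: jga; rewrite -ltNge => /ltW.
have gl : zm^-1 ^+ (l - d.*2) <= ga^-1 ^+ (l - d.*2).
  by rewrite lerXn2r ?nnegrE ?invr_ge0 ?(ltW zm0) ?(ltW ga0)// lef_pV2.
apply: le_trans (_ : B * P * (be * ga^-1 ^+ (l - d.*2)) <= _); last first.
  by rewrite ler_wpM2l ?mulr_ge0 ?(ltW P0)// lerDr.
rewrite [be * _]mulrC mulrA ler_wpM2r// (le_trans cz)// -mulrA ler_wpM2l// zl.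
by rewrite ler_pM// ?exprn_ge0 ?invr_ge0 ?ltW.
Qed.

(* The product is expanded into characters of the grid group: the coefficients
   of [th] decay by summation by parts, and multiplying by a character shifts
   the Fourier transform of [w]; the frequencies beyond [ka] only see the
   trivial bound [W]. *)
Lemma fourier_mul_bound (M : R) (l : nat) : (0 < d)%N -> 0 < M -> (d.*2 <= l)%N ->
  exists2 K, 0 < K & forall th w (h0 C W be ka : R) (xi : Rd),
    0 < h0 -> 0 < ka -> 0 <= be ->
    cunif_cont th -> supp_in M th -> dbound l h0 C th ->
    cc M w -> (forall x, Normc.normc (w x) <= W) ->
    (forall eta : Rd, `|xi - eta| <= ka -> Normc.normc (fourier w eta) <= be) ->
    Normc.normc (fourier (fun x => th x * w x) xi) <=
      K * (C * (be + W * ka^-1 ^+ (l - d.*2))).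
Proof.
(* The margin [1] beyond the support leaves room for [l] differences, since the grid step will be at
   most [1 / l.+1]. *)
move=> d0 M0 dl; pose L := M + 1; have L0 : 0 < L by rewrite addr_gt0.
pose lam := pi / L; have lam0 : 0 < lam by rewrite divr_gt0// pi_gt0.
have lamL : lam * L = pi by rewrite divfK// lt0r_neq0.
pose A := (1 + 4 / lam) ^+ l * 4 ^+ d.
have l40 : 0 < 1 + 4 / lam by apply: addr_gt0 => //; apply: divr_gt0.
have A0 : 0 < A by apply: mulr_gt0; apply: exprn_gt0.
(* The threshold on grid indices will be [ka / lam]; [T] absorbs the resulting power of [lam]
   together with the volume factor in the trivial bound on grid sums. *)
pose T := 1 + (L *+ 2) ^+ d * lam ^+ (l - d.*2).
have T1 : 1 <= T.
  by rewrite lerDl; apply: mulr_ge0; rewrite exprn_ge0 ?mulrn_wge0 ?ltW.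
exists (A * T); first by rewrite mulr_gt0// (lt_le_trans ltr01).
move=> th w h0 C W be ka xi h0_gt0 ka0 be0 uth sth db ccw wW wbe.
have W0 : 0 <= W by exact: le_trans (normc_ge0 _) (wW 0).
have thC x : Normc.normc (th x) <= C.
  by have := db (Ordinal d0) 0%N x h0 isT h0_gt0 (lexx _); rewrite expr0 mulr1.
have C0 : 0 <= C by exact: le_trans (normc_ge0 _) (thC 0).
have ccth : cc L (fun x => th x * w x).
  under eq_fun do rewrite mulrC.
  by apply: (ccM C0) => //; apply: cc_widen ccw; rewrite lerDl.
have ccw' : cc L w by apply: cc_widen ccw; rewrite lerDl.
apply/ler_addgt0Pr => e e0.
have CA0 : 0 <= C * A + 1 by rewrite addr_ge0// mulr_ge0// ltW.
have [e1 e10 E1] := eps_le_div CA0 e0.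
have [d1 d10 H1] := fourier_lim `|xi| L0 ccth e10.
have [d2 d20 H2] := fourier_lim (`|xi| + ka) L0 ccw' e10.
have dm : 0 < Num.min h0 (Num.min (l.+1%:R^-1) (Num.min d1 d2)).
  by rewrite !lt_min h0_gt0 invr_gt0 ltr0n d10.
have [N [h [h_gt0 hd hL]]] := exists_grid L0 dm.
move: hd; rewrite !le_min => /and4P[hh0 hl hd1 hd2].
have ML : M + l%:R * h <= L.
  rewrite lerD2l; apply: le_trans (_ : l.+1%:R * h <= _).
    by rewrite ler_pM2r// ler_nat.
  by rewrite -ler_pdivlMl ?ltr0n// mulr1.
have F1 := H1 N h xi h_gt0 hd1 hL (lexx _).
rewrite (csum_mul th w xi hL lamL) in F1.
set S := \sum_(k : 'rV_d) _ in F1.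
(* [A] and [T] do not depend on the grid, so the discretisation errors enter only through the
   arbitrary [e]. *)
suff SS : Normc.normc S <= A * T * (C * (be + W * ka^-1 ^+ (l - d.*2))) + C * A * e1.
  have -> : fourier (fun x => th x * w x) xi =
    (fourier (fun x => th x * w x) xi - S) + S by rewrite subrK.
  apply: le_trans (normcD _ _) _; move: E1 F1 SS; rewrite mulrDl mul1r.
  by move: (Normc.normc _) (Normc.normc _) (C * A * e1) (A * T * _) => a b c t; clear; lra.
pose ga := ka / lam.
have ga0 : 0 < ga by rewrite divr_gt0.
pose Q := (be + e1) + (L *+ 2) ^+ d * W * ga^-1 ^+ (l - d.*2).
have bk (k : 'rV['I_N.*2.+1]_d) : Normc.normc (N.*2.+1%:R ^- d * dft h lam th k *
     csum N h (fun x => w x * cis (- dotp x (xi - grid lam k)))) <=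
     C * (1 + 4 / lam) ^+ l * (\prod_i zwt (k 0 i) ^- 2) * Q.
  rewrite Normc.normcM; apply: weighted_coeff_bound => //.
  - exact: normc_ge0.
  - by rewrite mulr_ge0// exprn_ge0// ltW.
  - by rewrite addr_ge0// ltW.
  - by rewrite mulr_ge0// exprn_ge0// mulrn_wge0// ltW.
  - by move=> i; exact: (dft_coeff_bound k i h_gt0 hh0 lam0 hL lamL sth ML db).
  - by apply: normc_csum_le => // x; rewrite Normc.normcM normc_cis mulr1.
  - move=> zga; have fk : `|grid lam k| <= ka.
      apply: norm_le_entry => [|i]; first exact: ltW.
      rewrite mxE normrM (gtr0_norm lam0) mulrC -ler_pdivlMr//.
      by apply: le_trans (zga i); rewrite /zwt lerDr.
    have W2 := H2 N h (xi - grid lam k) h_gt0 hd2 hL.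
    rewrite -[csum _ _ _](subrK (fourier w (xi - grid lam k))) addrC.
    apply: le_trans (normcD _ _) _; rewrite lerD//.
      by apply: wbe; rewrite opprB addrC subrK.
    by rewrite normcB W2// (le_trans (ler_normB _ _))// lerD2l.
apply: le_trans (normc_sum _ _ _) _.
apply: le_trans (ler_sum _ (fun k _ => bk k)) _.
rewrite -mulr_suml -mulr_sumr.
rewrite (sum_row_prod (fun _ a => zwt a ^- 2)) /=.
have P4 : \prod_(i < d) \sum_a @zwt N a ^- 2 <= 4 ^+ d.
  rewrite -[X in _ ^+ X]card_ord -prodr_const; apply: ler_prod => i _.
  rewrite sum_inv_sq_le4 andbT; apply: sumr_ge0 => a _.
  by rewrite invr_ge0 exprn_ge0// (le_trans ler01 (zwt_ge1 _)).
have Q0 : 0 <= Q.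
  apply: addr_ge0; first by rewrite addr_ge0// ltW.
  apply: mulr_ge0; last by rewrite exprn_ge0// invr_ge0 ltW.
  by rewrite mulr_ge0// exprn_ge0// mulrn_wge0// ltW.
have c0 : 0 <= C * (1 + 4 / lam) ^+ l by rewrite mulr_ge0// exprn_ge0// ltW.
apply: le_trans (_ : C * A * Q <= _).
  by rewrite /A ler_wpM2r// mulrA ler_wpM2l.
have -> : A * T * (C * (be + W * ka^-1 ^+ (l - d.*2))) + C * A * e1 =
  C * A * (T * (be + W * ka^-1 ^+ (l - d.*2)) + e1) by ring.
apply: ler_wpM2l; first by rewrite mulr_ge0// ltW.
rewrite /Q (_ : ga^-1 = lam * ka^-1); last by rewrite /ga invfM invrK mulrC.
rewrite exprMn.
set x := ka^-1 ^+ _; have x0 : 0 <= x by rewrite exprn_ge0// invr_ge0 ltW.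
have -> : be + e1 + (L *+ 2) ^+ d * W * (lam ^+ (l - d.*2) * x) =
  be + (T - 1) * (W * x) + e1 by rewrite /T; ring.
rewrite lerD2r mulrDr; have Wx : 0 <= W * x by rewrite mulr_ge0.
have : be <= T * be by rewrite -{1}[be]mul1r ler_wpM2r.
have : (T - 1) * (W * x) <= T * (W * x) by rewrite ler_wpM2r// gerBl.
by move: (T * be) ((T - 1) * _) (T * _) => a b c; clear; lra.
Qed.

End Multiplier.

(** * Differences of products and quotients *)

Section SequenceDifferences.
Variable R : realType.
Implicit Types (s t : nat -> R[i]) (h C D S : R).

Definition sdiff s : nat -> R[i] := fun n => s n.+1 - s n.

(** The triangle [p + n <= l] involves only the terms with index up to [l], so a quotient can be
    bounded knowing its denominator at these points alone. *)
Definition sbound l h C s := forall p n, (p + n <= l)%N ->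
  Normc.normc (iter p sdiff s n) <= C * h ^+ p.

Lemma iter_sdiffD s t p n :
  iter p sdiff (fun k => s k + t k) n = iter p sdiff s n + iter p sdiff t n.
Proof.
elim: p n => [//|p IH] n; rewrite !iterS /sdiff !IH.
by rewrite opprD addrACA.
Qed.

Lemma iter_sdiffN s p n : iter p sdiff (fun k => - s k) n = - iter p sdiff s n.
Proof. by elim: p n => [//|p IH] n; rewrite !iterS /sdiff !IH opprD. Qed.

Lemma iter_sdiff_shift s p n : iter p sdiff (fun k => s k.+1) n = iter p sdiff s n.+1.
Proof. by elim: p n => [//|p IH] n; rewrite !iterS /sdiff !IH. Qed.

Lemma sbound_le l l' h C s : (l <= l')%N -> sbound l' h C s -> sbound l h C s.
Proof. by move=> ll sb p n pn; apply: sb; exact: leq_trans ll. Qed.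

Lemma sbound_sdiff l h C s : sbound l.+1 h C s -> sbound l h (C * h) (sdiff s).
Proof.
by move=> sb p n pn; rewrite -iterSr -mulrA -exprS; apply: sb; rewrite addSn ltnS.
Qed.

Lemma sbound_shift l h C s : sbound l.+1 h C s -> sbound l h C (fun n => s n.+1).
Proof. by move=> sb p n pn; rewrite iter_sdiff_shift; apply: sb; rewrite addnS ltnS. Qed.

Lemma sbound_ge0 l h C s : sbound l h C s -> 0 <= C.
Proof.
by move=> sb; have := sb 0%N 0%N isT; rewrite expr0 mulr1; apply: le_trans; exact: normc_ge0.
Qed.

(** The discrete product rule, with one factor shifted by one index, turns a bound of order [l.+1]
    into two of order [l]; hence the factor [2 ^ l]. *)
Lemma sboundM l h C D s t : 0 <= h -> sbound l h C s -> sbound l h D t ->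
  sbound l h (2 ^+ l * (C * D)) (fun n => s n * t n).
Proof.
move=> h0; elim: l C D s t => [|l IH] C D s t sC tD p n pn.
  have [C0 D0] := (sbound_ge0 sC, sbound_ge0 tD).
  move: pn; rewrite leqn0 addn_eq0 => /andP[/eqP -> /eqP ->].
  rewrite !expr0 mulr1 mul1r Normc.normcM.
  have := sC 0%N 0%N isT; have := tD 0%N 0%N isT; rewrite !expr0 !mulr1 => a b.
  by rewrite ler_pM ?normc_ge0.
have [C0 D0] := (sbound_ge0 sC, sbound_ge0 tD).
case: p pn => [|p] pn.
  rewrite expr0 mulr1 Normc.normcM.
  have := sC 0%N n pn; have := tD 0%N n pn; rewrite !expr0 !mulr1 => a b.
  apply: le_trans (_ : C * D <= _); first by rewrite ler_pM ?normc_ge0.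
  by rewrite ler_peMl ?mulr_ge0// exprn_ege1// ler1n.
rewrite iterSr.
have -> : sdiff (fun n => s n * t n) =
    fun n => (fun n => sdiff s n * t n) n + (fun n => s n.+1 * sdiff t n) n.
  by apply/funext => k; rewrite /sdiff /=; ring.
rewrite iter_sdiffD; apply: le_trans (normcD _ _) _.
have pl : (p + n <= l)%N by [].
have := IH _ _ _ _ (sbound_sdiff sC) (sbound_le (leqnSn l) tD) p n pl.
have := IH _ _ _ _ (sbound_shift sC) (sbound_sdiff tD) p n pl.
have -> : 2 ^+ l * (C * (D * h)) * h ^+ p = 2 ^+ l * (C * D) * h ^+ p.+1 by rewrite exprS; ring.
have -> : 2 ^+ l * (C * h * D) * h ^+ p = 2 ^+ l * (C * D) * h ^+ p.+1 by rewrite exprS; ring.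
move=> a b; have -> : 2 ^+ l.+1 * (C * D) * h ^+ p.+1 =
  2 ^+ l * (C * D) * h ^+ p.+1 + 2 ^+ l * (C * D) * h ^+ p.+1 by rewrite [2 ^+ l.+1]exprS; ring.
exact: lerD.
Qed.

(** The difference of [1 / s] is [- sdiff s] divided by two consecutive terms, so the order drops by
    one and the exponent obeys [c -> 2 * c + 1]. That [K] and [c] depend on [l] alone is what will
    make a slow-scale [S] harmless. *)
Lemma sboundV l : exists (K : R) (c : nat), 1 <= K /\ forall s h S, 0 <= h -> 1 <= S ->
  sbound l h S s -> (forall n, (n <= l)%N -> S^-1 <= Normc.normc (s n)) ->
  sbound l h (K * S ^+ c) (fun n => (s n)^-1).
Proof.
elim: l => [|l [K [c [K1 IH]]]].
  exists 1, 1%N; split=> // s h S h0 S1 sS Ss p n.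
  rewrite leqn0 addn_eq0 => /andP[/eqP -> /eqP ->].
  rewrite !expr0 mulr1 mul1r expr1 Normc.normcV -[S]invrK lef_pV2 ?Ss// posrE.
    by apply: lt_le_trans (Ss 0%N isT); rewrite invr_gt0 (lt_le_trans ltr01).
  by rewrite invr_gt0 (lt_le_trans ltr01).
pose K' := 2 ^+ l * 2 ^+ l * (K * K).
have K'1 : 1 <= K'.
  have e1 : 1 <= 2 ^+ l :> R by rewrite exprn_ege1// ler1n.
  exact: (mulr_ege1 (mulr_ege1 e1 e1) (mulr_ege1 K1 K1)).
exists K', (c + c).+1; split=> // s h S h0 S1 sS Ss p n pn.
have S0 : 0 < S by exact: lt_le_trans S1.
have s0 k : (k <= l.+1)%N -> 0 < Normc.normc (s k).
  by move=> kl; apply: lt_le_trans (Ss k kl); rewrite invr_gt0.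
case: p pn => [|p] pn.
  rewrite expr0 mulr1 Normc.normcV.
  apply: le_trans (_ : S <= _).
    by rewrite -[S]invrK lef_pV2 ?Ss// posrE ?s0// invr_gt0.
  rewrite -{1}[S]mul1r ler_pM ?(ltW S0)// exprS ler_peMr ?(ltW S0)//.
  by rewrite exprn_ege1.
rewrite iterSr.
have pl : (p + n <= l)%N by [].
have E k : (k <= l)%N -> sdiff (fun n => (s n)^-1) k = - (sdiff s k * (s k)^-1 * (s k.+1)^-1).
  move=> kl; have a : s k != 0.
    by apply: contraTneq (s0 k (leqW kl)) => ->; rewrite Normc.normc0 ltxx.
  have b : s k.+1 != 0.
    by apply: contraTneq (s0 k.+1 kl) => ->; rewrite Normc.normc0 ltxx.
  by rewrite /sdiff; field; rewrite b.
(* The formula [E] is known only where the terms are nonzero, so iterated differences are compared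
   within the window [q + k <= l]. *)
have iterE (u v : nat -> R[i]) : (forall k, (k <= l)%N -> u k = v k) ->
    forall q k, (q + k <= l)%N -> iter q sdiff u k = iter q sdiff v k.
  move=> uv; elim=> [|q IHq] k qk; first exact: uv.
  rewrite !iterS /sdiff !IHq//; first exact: ltnW.
  by rewrite addnS -addSn.
rewrite (iterE _ _ E)// iter_sdiffN normc_opp.
have i1 := IH s h S h0 S1 (sbound_le (leqnSn l) sS) (fun n nl => Ss n (leqW nl)).
have i2 := IH _ h S h0 S1 (sbound_shift sS) (fun n nl => Ss n.+1 nl).
have := sboundM h0 (sboundM h0 (sbound_sdiff sS) i1) i2 pl.
move/le_trans; apply; rewrite le_eqVlt; apply/orP; left; apply/eqP.
by rewrite /K' [h ^+ p.+1]exprS [S ^+ (c + c).+1]exprS exprD; ring.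
Qed.

End SequenceDifferences.

Section AxisDifferences.
Variables (R : realType) (d : nat).
Local Notation Rd := 'rV[R]_d.
Implicit Types (f g : Rd -> R[i]).

Definition sample f (x : Rd) i h : nat -> R[i] :=
  fun n => f (x + (h * n%:R) *: delta_mx 0 i).

Lemma iter_fdiff_sample f x i h p n :
  iter p (fdiff i h) f (x + (h * n%:R) *: delta_mx 0 i) = iter p (@sdiff R) (sample f x i h) n.
Proof.
elim: p n => [//|p IH] n; rewrite !iterS /fdiff -/(fdiff i h) /sdiff -!IH.
by rewrite -addrA -scalerDl -[n.+1%:R]natr1 mulrDr mulr1.
Qed.

Lemma iter_fdiff_sample0 f x i h p :
  iter p (fdiff i h) f x = iter p (@sdiff R) (sample f x i h) 0%N.
Proof. by rewrite -iter_fdiff_sample mulr0 scale0r addr0. Qed.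

Lemma dboundP l h0 C f : dbound l h0 C f <->
  forall x i h, 0 < h -> h <= h0 -> sbound l h C (sample f x i h).
Proof.
split=> [db x i h h_gt0 hh p n pn|sb i p x h pl h_gt0 hh].
  by rewrite -iter_fdiff_sample; apply: db => //; apply: leq_trans pn; exact: leq_addr.
by rewrite iter_fdiff_sample0; apply: sb => //; rewrite addn0.
Qed.

Lemma dboundM l h0 C D f g : dbound l h0 C f -> dbound l h0 D g ->
  dbound l h0 (2 ^+ l * (C * D)) (fun x => f x * g x).
Proof.
move=> /dboundP fC /dboundP gD; apply/dboundP => x i h h_gt0 hh.
exact: (sboundM (ltW h_gt0) (fC x i h h_gt0 hh) (gD x i h h_gt0 hh)).
Qed.

Lemma norm_axis_shift (x x0 : Rd) i (t : R) :
  `|x + t *: delta_mx 0 i - x0| <= `|x - x0| + `|t|.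
Proof.
rewrite addrAC; apply: le_trans (ler_normD _ _) _.
by rewrite lerD2l norm_delta_scale.
Qed.

Lemma norm_axis_shift_ge (x x0 : Rd) i (t : R) :
  `|x - x0| - `|t| <= `|x + t *: delta_mx 0 i - x0|.
Proof.
have := norm_axis_shift (x + t *: delta_mx 0 i) x0 i (- t).
by rewrite scaleNr addrK normrN lerBlDr.
Qed.

(** The samples along an axis span at most [l * h0]. If the base point is farther than [r1 + l * h0]
    from [x0], all samples of [ch] vanish; otherwise all samples lie within [r2], where [ph] is
    controlled. This explains the gap [2 * l * h0]. *)
Lemma dbound_quotient l : exists (K : R) (c : nat), 1 <= K /\
  forall (ch ph : Rd -> R[i]) (x0 : Rd) (C S r1 r2 h0 : R),
  1 <= S -> l%:R * h0 *+ 2 <= r2 - r1 ->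
  (forall x, r1 < `|x - x0| -> ch x = 0) -> dbound l h0 C ch ->
  (forall x, `|x - x0| <= r2 -> S^-1 <= Normc.normc (ph x)) ->
  (forall i x h p, (p <= l)%N -> 0 < h -> h <= h0 ->
     (forall t, 0 <= t <= p%:R * h -> `|x + t *: delta_mx 0 i - x0| <= r2) ->
     Normc.normc (iter p (fdiff i h) ph x) <= S * h ^+ p) ->
  dbound l h0 (C * (K * S ^+ c)) (fun x => ch x * (ph x)^-1).
Proof.
have [K [c [K1 HV]]] := sboundV R l.
exists (2 ^+ l * K), c; split; first by rewrite mulr_ege1// exprn_ege1// ler1n.
move=> ch ph x0 C S r1 r2 h0 S1 h0r sch /dboundP dch phS dph.
move=> i p x h pl h_gt0 hh.
rewrite iter_fdiff_sample0.
have C0 : 0 <= C by exact: (sbound_ge0 (dch x i h h_gt0 hh)).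
have hn n : (n <= l)%N -> h * n%:R <= l%:R * h0.
  by move=> nl; rewrite mulrC ler_pM ?ler_nat// ltW.
have h_ge n : 0 <= h * n%:R by rewrite mulr_ge0// ltW.
have [far|near] := ltP (r1 + l%:R * h0) `|x - x0|.
  have z n : (n <= l)%N -> sample (fun x => ch x * (ph x)^-1) x i h n = 0.
    move=> nl; rewrite /sample sch ?mul0r//.
    apply: lt_le_trans (norm_axis_shift_ge _ _ _ _); rewrite (ger0_norm (h_ge n)).
    by have := hn n nl; move: far; clear; lra.
  have zi q n : (q + n <= l)%N ->
      iter q (@sdiff R) (sample (fun x => ch x * (ph x)^-1) x i h) n = 0.
    elim: q n => [|q IH] n qn; first exact: z.
    rewrite iterS /sdiff !IH ?subr0//; first exact: ltnW.
    by rewrite addnS -addSn.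
  rewrite zi ?addn0// Normc.normc0 mulr_ge0 ?exprn_ge0 ?(ltW h_gt0)//.
  rewrite mulr_ge0// mulr_ge0 ?exprn_ge0 ?(le_trans ler01 S1)//.
  by rewrite mulr_ge0// ?exprn_ge0// (le_trans ler01).
have close t : 0 <= t -> t <= l%:R * h0 -> `|x + t *: delta_mx 0 i - x0| <= r2.
  move=> t0 tl; apply: le_trans (norm_axis_shift _ _ _ _) _.
  by rewrite (ger0_norm t0); move: near h0r tl; rewrite mulr2n; clear; lra.
have sph : sbound l h S (sample ph x i h).
  move=> q n qn; rewrite -iter_fdiff_sample; apply: dph => //.
    by apply: leq_trans qn; exact: leq_addr.
  move=> t /andP[t0 tq]; rewrite -(addrA x) -scalerDl; apply: close; first exact: addr_ge0.
  apply: le_trans (hn _ qn); rewrite natrD mulrDr [X in X + _ <= _]mulrC.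
  by move: tq; rewrite [h * q%:R]mulrC [h * n%:R]mulrC; move: (q%:R * h) (n%:R * h) => a b; clear; lra.
have := sboundM (ltW h_gt0) (dch x i h h_gt0 hh)
   (HV _ h S (ltW h_gt0) S1 sph (fun n nl => phS _ (close _ (h_ge n) (hn n nl)))).
move/(_ p 0%N); rewrite addn0 => /(_ pl)/le_trans; apply.
by rewrite le_eqVlt; apply/orP; left; apply/eqP; ring.
Qed.

End AxisDifferences.

(** * From derivatives to differences *)

Section LineDerivative.
Variable R : realType.

Lemma is_derive_line (V : normedModType R) (F : V -> R) (x v : V) (t D : R) :
  is_derive (x + t *: v) v F D -> is_derive t 1 (fun s : R => F (x + s *: v)) D.
Proof.
case=> dF DF.
have E : (fun h : R => h^-1 *: ((F \o shift (x + t *: v)) (h *: v) - F (x + t *: v))) =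
  (fun h : R => h^-1 *: (((fun s : R => F (x + s *: v)) \o shift t) (h *: (1 : R)) - F (x + t *: v))).
  apply/funext => h; congr (_ *: (F _ - _)); rewrite /= [h *: 1]mulr1 scalerDl.
  by rewrite addrCA.
split; first by move: dF; rewrite /derivable E.
by rewrite -DF /derive E.
Qed.

Definition rdiff (h : R) (g : R -> R) : R -> R := fun t => g (t + h) - g t.

Lemma is_derive_rdiff (g : R -> R) (h t a b : R) :
  is_derive (t + h) 1 g a -> is_derive t 1 g b -> is_derive t 1 (rdiff h g) (a - b).
Proof.
move=> ga gb; apply: is_deriveB.
have : is_derive (h + t *: (1 : R)) 1 g a by rewrite [t *: _]mulr1 addrC.
move/is_derive_line; congr is_derive.
by apply/funext => s; rewrite [s *: _]mulr1 addrC.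
Qed.

Lemma is_derive_iter_rdiff (g g' : R -> R) h p :
  (forall t : R, is_derive t 1 g (g' t)) ->
  forall t : R, is_derive t 1 (iter p (rdiff h) g) (iter p (rdiff h) g' t).
Proof.
move=> gg'; elim: p => [//|p IH] t; rewrite !iterS.
exact: is_derive_rdiff.
Qed.

(** One mean value step for each difference: it gains a factor [h], passes to the next function of
    the chain [G], and moves the point by at most [h], which accounts for the interval of length
    [p * h]. *)
Lemma rdiff_bound (p : nat) (G : nat -> R -> R) (h t B : R) :
  (forall k (s : R), (k < p)%N -> is_derive s 1 (G k) (G k.+1 s)) -> 0 < h ->
  (forall s, t <= s <= t + p%:R * h -> `|G p s| <= B) ->
  `|iter p (rdiff h) (G 0%N) t| <= B * h ^+ p.
Proof.
elim: p G t => [|p IH] G t GG h0 GB.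
  by rewrite expr0 mulr1; apply: GB; rewrite mul0r addr0 lexx.
have dG (s : R) : is_derive s 1 (iter p (rdiff h) (G 0%N)) (iter p (rdiff h) (G 1%N) s).
  by apply: is_derive_iter_rdiff => r; exact: GG.
have th : t <= t + h by rewrite lerDl ltW.
have [c /andP[tc ct] E] := MVT_line th dG.
rewrite iterS /rdiff -/(rdiff h) E addrAC subrr add0r normrM (gtr0_norm h0).
rewrite exprSr mulrA ler_pM2r//.
apply: (IH (fun k => G k.+1)) => // [k s kp|s /andP[cs sc]]; first exact: GG.
apply: GB; rewrite (le_trans tc)//= (le_trans sc)// -natr1 mulrDl mul1r.
by rewrite [_ + h]addrC addrA lerD2r.
Qed.

End LineDerivative.

Section PartialDerivatives.
Variables (R : realType) (d : nat).
Local Notation Rd := 'rV[R]_d.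
Implicit Types (f g : Rd -> R[i]).

Definition axis_restr (p : R[i] -> R) f (x : Rd) (i : 'I_d) (t : R) : R :=
  p (f (x + t *: delta_mx 0 i)).

Lemma iter_fdiff_re f (i : 'I_d) h p x :
  complex.Re (iter p (fdiff i h) f x) = iter p (rdiff h) (axis_restr (@complex.Re R) f x i) 0.
Proof.
have H : forall t, complex.Re (iter p (fdiff i h) f (x + t *: delta_mx 0 i)) =
    iter p (rdiff h) (axis_restr (@complex.Re R) f x i) t.
  elim: p => [//|p IH] t; rewrite !iterS /fdiff -/(fdiff i h) /rdiff -/(rdiff h).
  rewrite -!IH [in RHS]scalerDl addrA.
  by case: (iter _ _ _ _) => a b; case: (iter _ _ _ _).
by rewrite -H scale0r addr0.
Qed.

Lemma iter_fdiff_im f (i : 'I_d) h p x :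
  complex.Im (iter p (fdiff i h) f x) = iter p (rdiff h) (axis_restr (@complex.Im R) f x i) 0.
Proof.
have H : forall t, complex.Im (iter p (fdiff i h) f (x + t *: delta_mx 0 i)) =
    iter p (rdiff h) (axis_restr (@complex.Im R) f x i) t.
  elim: p => [//|p IH] t; rewrite !iterS /fdiff -/(fdiff i h) /rdiff -/(rdiff h).
  rewrite -!IH [in RHS]scalerDl addrA.
  by case: (iter _ _ _ _) => a b; case: (iter _ _ _ _).
by rewrite -H scale0r addr0.
Qed.

Lemma smooth_is_derive f : smooth f -> forall (s : seq 'I_d) i x (t : R),
  is_derive t 1 (axis_restr (@complex.Re R) (iter_pderiv s f) x i)
    (axis_restr (@complex.Re R) (pderiv i (iter_pderiv s f)) x i t) /\
  is_derive t 1 (axis_restr (@complex.Im R) (iter_pderiv s f) x i)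
    (axis_restr (@complex.Im R) (pderiv i (iter_pderiv s f)) x i t).
Proof.
move=> sf s i x t; have [_ _ /(_ i (x + t *: delta_mx 0 i))[dr di]] := sf s.
split.
- exact: (@is_derive_line _ _ (fun y => complex.Re (iter_pderiv s f y)) x _ t _ (DeriveDef dr erefl)).
- exact: (@is_derive_line _ _ (fun y => complex.Im (iter_pderiv s f y)) x _ t _ (DeriveDef di erefl)).
Qed.

(** The doubling of [B] comes from estimating real and imaginary parts separately, since the mean
    value theorem is real. *)
Lemma fdiff_le_pderiv f i h p x B : smooth f -> 0 < h ->
  (forall t, 0 <= t <= p%:R * h ->
     Normc.normc (iter_pderiv (nseq p i) f (x + t *: delta_mx 0 i)) <= B) ->
  Normc.normc (iter p (fdiff i h) f x) <= (B *+ 2) * h ^+ p.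
Proof.
move=> sf h0 fB; apply: le_trans (normc_le_re_im _) _.
rewrite iter_fdiff_re iter_fdiff_im mulrnAl mulr2n.
apply: lerD.
- apply: (@rdiff_bound _ p (fun k => axis_restr (@complex.Re R) (iter_pderiv (nseq k i) f) x i)) => //.
    by move=> k s _; have [] := smooth_is_derive sf (nseq k i) i x s.
  by move=> s; rewrite add0r => /fB; apply: le_trans; exact: normc_re.
- apply: (@rdiff_bound _ p (fun k => axis_restr (@complex.Im R) (iter_pderiv (nseq k i) f) x i)) => //.
    by move=> k s _; have [] := smooth_is_derive sf (nseq k i) i x s.
  by move=> s; rewrite add0r => /fB; apply: le_trans; exact: normc_im.
Qed.

Lemma mderiv_nseq f i p :
  mderiv (fun j => if j == i then p else 0%N) f = iter_pderiv (nseq p i) f.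
Proof.
rewrite /mderiv; congr iter_pderiv.
have E : forall s : seq 'I_d, uniq s ->
   flatten [seq nseq (if j == i then p else 0%N) j | j <- s] =
   if i \in s then nseq p i else [::].
  elim=> [//|j s IH] /= /andP[js us]; rewrite IH// in_cons eq_sym.
  case: eqP js => [<-|_ _] /=; last by [].
  by move/negPf => ->; rewrite cats0.
by rewrite E ?enum_uniq// mem_enum.
Qed.

End PartialDerivatives.

(** * Smooth cutoff functions with bounds on their differences *)

Section SmoothLine.
Variable R : realType.
Implicit Types f g : R -> R.

(** Finite orders are kept apart so that closure under products and inverses goes by induction on
    [n]: the derivative again contains the functions themselves, now one order lower. *)
Fixpoint smooth1n (n : nat) f : Prop :=
  if n is m.+1 then (forall x : R, derivable f x 1) /\ smooth1n m (derive1 f) else True.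

Definition smooth1 f := forall n, smooth1n n f.

Lemma smooth1n_is_derive n f f' : (forall x : R, is_derive x 1 f (f' x)) ->
  smooth1n n f' -> smooth1n n.+1 f.
Proof.
move=> ff' sf'; split; first by move=> x; have [] := ff' x.
suff -> : derive1 f = f' by [].
by apply/funext => x; rewrite derive1E; apply: derive_val.
Qed.

Lemma smooth1n_derive n f (x : R) : smooth1n n.+1 f -> is_derive x 1 f (derive1 f x).
Proof. by case=> df _; rewrite derive1E; apply: derivableP. Qed.

Lemma smooth1nW n f : smooth1n n.+1 f -> smooth1n n f.
Proof. by elim: n f => [//|n IH] f [df sf]; split=> //; exact: IH. Qed.

Lemma smooth1_derive1 f : smooth1 f -> smooth1 (derive1 f).
Proof. by move=> sf n; have [] := sf n.+1. Qed.

Lemma smooth1_is_derive f (x : R) : smooth1 f -> is_derive x 1 f (derive1 f x).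
Proof. by move=> sf; exact: (smooth1n_derive x (sf 1%N)). Qed.

Lemma smooth1_continuous f : smooth1 f -> continuous f.
Proof.
move=> sf x; apply/differentiable_continuous/derivable1_diffP.
by have [] := smooth1_is_derive x sf.
Qed.

Lemma smooth1nB n f g : smooth1n n f -> smooth1n n g -> smooth1n n (fun x => f x - g x).
Proof.
elim: n f g => [//|n IH] f g sf sg.
apply: (@smooth1n_is_derive _ _ (fun x => derive1 f x - derive1 g x)).
  move=> x; exact: (is_deriveB (smooth1n_derive x sf) (smooth1n_derive x sg)).
by apply: IH; [case: sf|case: sg].
Qed.

Lemma smooth1n_cst n (c : R) : smooth1n n (fun=> c).
Proof.
by elim: n c => [//|n IH] c; apply: (@smooth1n_is_derive _ _ (fun=> 0)).
Qed.

Lemma smooth1nN n f : smooth1n n f -> smooth1n n (fun x => - f x).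
Proof.
move=> sf; have := smooth1nB (smooth1n_cst n 0) sf.
by congr smooth1n; apply/funext => x; rewrite sub0r.
Qed.

Lemma smooth1nD n f g : smooth1n n f -> smooth1n n g -> smooth1n n (fun x => f x + g x).
Proof.
move=> sf sg; have := smooth1nB sf (smooth1nN sg).
by congr smooth1n; apply/funext => x; rewrite opprK.
Qed.

Lemma smooth1nM n f g : smooth1n n f -> smooth1n n g -> smooth1n n (fun x => f x * g x).
Proof.
elim: n f g => [//|n IH] f g sf sg.
apply: (@smooth1n_is_derive _ _ (fun x => f x * derive1 g x + g x * derive1 f x)).
  move=> x; exact: (is_deriveM (smooth1n_derive x sf) (smooth1n_derive x sg)).
by apply: smooth1nD; apply: IH; try exact: smooth1nW; [case: sg|case: sf].
Qed.

Lemma smooth1nV n f : (forall x, f x != 0) -> smooth1n n f -> smooth1n n (fun x => (f x)^-1).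
Proof.
move=> f0; elim: n f f0 => [//|n IH] f f0 sf.
apply: (@smooth1n_is_derive _ _ (fun x => - ((f x)^-1 * (f x)^-1 * derive1 f x))).
  move=> x; have := is_deriveV (f0 x) (smooth1n_derive x sf).
  by rewrite scaleNr expr2 invfM.
have sV := IH f f0 (smooth1nW sf).
by apply/smooth1nN/smooth1nM; [exact: smooth1nM|case: sf].
Qed.

Lemma is_derive_affine f (a b x D : R) : is_derive (a * x + b) 1 f D ->
  is_derive x 1 (fun t => f (a * t + b)) (D * a).
Proof.
move=> df; apply: (@is_derive1_comp _ f (fun t => a * t + b)) => //.
rewrite -[X in is_derive _ _ _ X]addr0; apply: is_deriveD.
rewrite -[X in is_derive _ _ _ X]mulr1; exact: (@is_deriveZ _ _ _ id a x 1 1).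
Qed.

Lemma smooth1n_affine n f a b : smooth1n n f -> smooth1n n (fun t => f (a * t + b)).
Proof.
elim: n f => [//|n IH] f sf.
apply: (@smooth1n_is_derive _ _ (fun t => derive1 f (a * t + b) * a)).
  by move=> x; exact: (is_derive_affine (smooth1n_derive _ sf)).
by apply: smooth1nM; [apply: IH; case: sf|exact: smooth1n_cst].
Qed.

(** [t ^- k * exp (- 1 / t)], extended by [0]. The derivatives are combinations of members of the
    same family, so smoothness is proved for all [k] at once. *)
Definition flat (k : nat) (t : R) : R :=
  if 0 < t then t^-1 ^+ k * expR (- t^-1) else 0.

Lemma flat_gt0 t : 0 < t -> 0 < flat 0 t.
Proof. by move=> t0; rewrite /flat t0 expr0 mul1r expR_gt0. Qed.

Lemma flat_le0 k t : t <= 0 -> flat k t = 0.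
Proof. by rewrite /flat ltNge => ->. Qed.

Lemma flat_ge0 k t : 0 <= flat k t.
Proof.
rewrite /flat; case: ifP => // t0.
by rewrite mulr_ge0 ?expR_ge0// exprn_ge0// invr_ge0 ltW.
Qed.

(** From [exp y >= y ^ (k + 1) / (k + 1)!] with [y = 1 / t]. Linear decay at [0] is enough, because
    the difference quotient of [flat k] at [0] is [flat k.+1]. *)
Lemma flat_small k t : `|flat k t| <= (k.+1)`!%:R * `|t|.
Proof.
rewrite /flat; case: ifP => [t0|_]; last by rewrite normr0 mulr_ge0.
set y := t^-1; have y0 : 0 < y by rewrite invr_gt0.
have f0 : 0 < (k.+1)`!%:R :> R by rewrite ltr0n fact_gt0.
rewrite ger0_norm ?mulr_ge0 ?expR_ge0 ?exprn_ge0 ?(ltW y0)// (gtr0_norm t0).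
rewrite expRN ler_pdivrMr ?expR_gt0//.
have := expR_ge1Dxn k (ltW y0) => H.
have {}H : y ^+ k.+1 <= (k.+1)`!%:R * expR y.
  rewrite -ler_pdivrMl// mulrC; apply: le_trans H; by rewrite lerDr.
rewrite mulrAC -ler_pdivrMr// -/y; move: H; by rewrite exprSr.
Qed.

Lemma is_derive_flat k (t : R) :
  is_derive t 1 (flat k) (flat k.+2 t - k%:R * flat k.+1 t).
Proof.
have [t0|t0|->] := ltgtP t 0.
- rewrite !flat_le0 ?(ltW t0)// mulr0 subr0.
  apply: (@near_eq_is_derive _ _ _ (cst 0) (flat k)).
  by near=> s; rewrite flat_le0// ltW//; near: s; exact: lt_nbhsl.
- pose f (y : R) := y ^+ k * expR (- y).
  have E s : 0 < s -> flat k s = f s^-1 by move=> s0; rewrite /flat s0.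
  apply: (@near_eq_is_derive _ _ _ (f \o (fun s => s^-1)) (flat k)).
  + by near=> s; rewrite /= E//; near: s; exact: lt_nbhsr.
  + set y := t^-1.
    have dV : is_derive t 1 (fun s : R => s^-1) (- y ^+ 2).
      have := @is_deriveV R id t 1 1 (lt0r_neq0 t0) (is_derive_id _ _).
      rewrite -exprVn -/y /GRing.scale /= mulr1; exact (fun H => H).
    have dE : is_derive y 1 (fun s => expR (- s)) (- expR (- y)).
      rewrite -[X in is_derive _ _ _ X]mulrN1.
      exact: (@is_derive1_comp _ expR -%R y _ _ (is_derive_expR _) (is_deriveNid _ _)).
    have dX : is_derive y 1 (fun s => s ^+ k) (k%:R * y ^+ k.-1).
      have := @is_deriveX _ _ id k y 1 1 (is_derive_id _ _).
      rewrite exprfctE /GRing.scale /= mulr1; exact (fun H => H).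
    have dF := is_deriveM dX dE.
    have -> : flat k.+2 t - k%:R * flat k.+1 t =
       (y ^+ k *: - expR (- y) + expR (- y) *: (k%:R * y ^+ k.-1)) * (- y ^+ 2).
      rewrite /flat t0 -/y /GRing.scale /=; case: (k) => [|m]; rewrite ?mul0r ?sub0r ?subr0 /= ?exprS; ring.
    exact: is_derive1_comp.
- have -> : flat k.+2 0 - k%:R * flat k.+1 0 = 0 by rewrite !flat_le0// mulr0 subrr.
  have cvg0 : (fun h : R => h^-1 *: ((flat k \o shift 0) (h *: (1 : R)) - flat k 0)) @ 0^' --> (0 : R).
    apply/cvgrPdist_le => e e0 /=; near=> h.
    have h0 : h != 0 by near: h; exact: nbhs_dnbhs_neq.
    rewrite [flat k 0]flat_le0// subr0 sub0r normrN addr0 [h *: 1]mulr1.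
    have -> : h^-1 *: flat k h = flat k.+1 h.
      rewrite /flat; case: ifP => _; rewrite /GRing.scale /= ?mulr0//.
      by rewrite exprS mulrA.
    apply: le_trans (flat_small _ _) _; rewrite -ler_pdivlMl ?ltr0n ?fact_gt0//.
    near: h; apply: dnbhs0_le; by rewrite mulr_gt0// invr_gt0 ltr0n fact_gt0.
  split; first by apply/cvg_ex; exists 0.
  exact: (cvg_lim _ cvg0).
Unshelve. all: end_near. Qed.

End SmoothLine.

Section Step.
Variable R : realType.
Implicit Types f g : R -> R.

Lemma smooth1n_flat n k : smooth1n n (@flat R k).
Proof.
elim: n k => [//|n IH] k; apply: (smooth1n_is_derive (is_derive_flat k)).
by apply: smooth1nB => //; apply: smooth1nM => //; exact: smooth1n_cst.
Qed.

Definition step (t : R) : R := flat 0 t / (flat 0 t + flat 0 (1 - t)).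

Lemma step_den_gt0 (t : R) : 0 < flat 0 t + flat 0 (1 - t).
Proof.
case: (ltP 0 t) => t0; first by rewrite ltr_wpDr ?flat_ge0// flat_gt0.
by rewrite ltr_wpDl ?flat_ge0// flat_gt0// subr_gt0 (le_lt_trans t0).
Qed.

Lemma step_le0 t : t <= 0 -> step t = 0.
Proof. by move=> t0; rewrite /step flat_le0// mul0r. Qed.

Lemma step_ge1 t : 1 <= t -> step t = 1.
Proof.
move=> t1; rewrite /step [flat 0 (1 - t)]flat_le0 ?subr_le0// addr0 divff//.
by rewrite gt_eqF// flat_gt0// (lt_le_trans ltr01).
Qed.

Lemma smooth1_step : smooth1 step.
Proof.
move=> n; apply: smooth1nM; first exact: smooth1n_flat.
apply: smooth1nV => [x|]; first by rewrite gt_eqF// step_den_gt0.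
apply: smooth1nD; first exact: smooth1n_flat.
have := smooth1n_affine (- 1) 1 (smooth1n_flat n 0).
by congr smooth1n; apply/funext => x; rewrite mulN1r addrC.
Qed.

Definition plateau (t : R) : R := step (t + 2) - step (t - 1).

(** Supported in [[0, 2]]; its integer translates telescope to [1]. *)
Definition part (t : R) : R := step t - step (t - 1).

Lemma smooth1_plateau : smooth1 plateau.
Proof.
move=> n; apply: smooth1nB.
  have := smooth1n_affine 1 2 (smooth1_step n).
  by congr smooth1n; apply/funext => x; rewrite mul1r.
have := smooth1n_affine 1 (- 1) (smooth1_step n).
by congr smooth1n; apply/funext => x; rewrite mul1r.
Qed.

Lemma smooth1_part : smooth1 part.
Proof.
move=> n; apply: smooth1nB; first exact: smooth1_step.
have := smooth1n_affine 1 (- 1) (smooth1_step n).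
by congr smooth1n; apply/funext => x; rewrite mul1r.
Qed.

Lemma plateau1 t : `|t| <= 1 -> plateau t = 1.
Proof.
rewrite ler_norml => /andP[a b]; rewrite /plateau step_ge1; last by move: a; clear; lra.
by rewrite step_le0 ?subr0//; move: b; clear; lra.
Qed.

Lemma plateau0 t : 2 <= `|t| -> plateau t = 0.
Proof.
rewrite ler_normr => /orP[] a; rewrite /plateau.
  rewrite !step_ge1 ?subrr//; move: a; clear; lra.
rewrite !step_le0 ?subrr//; move: a; clear; lra.
Qed.

Lemma part0 t : 2 <= `|t| -> part t = 0.
Proof.
rewrite ler_normr => /orP[] a; rewrite /part.
  rewrite !step_ge1 ?subrr//; move: a; clear; lra.
rewrite !step_le0 ?subrr//; move: a; clear; lra.
Qed.

Lemma sum_part (J : nat) t : `|t| + 1 <= J%:R ->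
  \sum_(j < J.*2) part (t + J%:R - j%:R) = 1.
Proof.
move=> tJ.
have tel n : \sum_(j < n) part (t + J%:R - j%:R) = step (t + J%:R) - step (t + J%:R - n%:R).
  elim: n => [|n IH]; first by rewrite big_ord0 subr0 subrr.
  rewrite big_ord_recr /= IH /part -[n.+1%:R]natr1 opprD addrA.
  by rewrite addrA subrK.
rewrite tel -addnn natrD opprD addrA addrK.
have : `|t| <= J%:R - 1 by rewrite lerBrDr.
rewrite ler_norml => /andP[a b]; rewrite step_ge1; last by move: a; clear; lra.
by rewrite step_le0 ?subr0//; move: b; clear; lra.
Qed.

Lemma derive1n_supp f A : smooth1 f -> (forall t, A < `|t| -> f t = 0) ->
  forall t, A < `|t| -> derive1 f t = 0.
Proof.
move=> sf f0 t At; rewrite derive1E; apply: derive_val.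
apply: (@near_eq_is_derive _ _ _ (cst 0) f).
near=> s; rewrite f0//; near: s.
by apply: (@cvgr_gt _ _ _ _ (fun s : R => `|s|) `|t|) => //; exact: norm_continuous.
Unshelve. all: end_near. Qed.

Lemma bounded_of_supp f A : continuous f -> (forall t, A < `|t| -> f t = 0) ->
  exists2 C, 0 <= C & forall t, `|f t| <= C.
Proof.
move=> cf f0; have A0 : - `|A| <= `|A| by rewrite ge0_cp.
have cn : {within `[- `|A|, `|A|], continuous (fun t => `|f t|)}.
  apply: continuous_subspaceT => t; apply: continuous_comp; first exact: cf.
  exact: norm_continuous.
have [c _ H] := EVT_max A0 cn; exists `|f c| => // t.
have [tA|tA] := leP `|t| `|A|; first by apply: H; rewrite in_itv /= -ler_norml.
by rewrite f0 ?normr0// (le_lt_trans _ tA)// ler_norm.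
Qed.

Definition rbound (l : nat) (C : R) f := forall p h t, (p <= l)%N -> 0 < h ->
  `|iter p (rdiff h) f t| <= C * h ^+ p.

(** All derivatives inherit the support, so each is bounded by its maximum on a compact interval;
    the mean value estimate then controls differences of every step length. *)
Lemma smooth1_rbound f A l : smooth1 f -> (forall t, A < `|t| -> f t = 0) ->
  exists2 C, 1 <= C & rbound l C f.
Proof.
move=> sf f0; pose G k := iter k (@derive1 R R) f.
have sG k : smooth1 (G k) by elim: k => [//|k IH]; exact: smooth1_derive1.
have G0 k t : A < `|t| -> G k t = 0.
  by elim: k t => [|k IH] t; [exact: f0|apply: (derive1n_supp (sG k))].
have [B B0 HB] : exists2 B, 1 <= B & forall k t, (k <= l)%N -> `|G k t| <= B.
  elim: l => [|l [B B1 IH]].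
    have [C C0 HC] := bounded_of_supp (smooth1_continuous (sG 0%N)) (G0 0%N).
    exists (1 + C); first by rewrite lerDl.
    by move=> k t; rewrite leqn0 => /eqP ->; rewrite (le_trans (HC t))// lerDr.
  have [C C0 HC] := bounded_of_supp (smooth1_continuous (sG l.+1)) (G0 l.+1).
  exists (B + C); first by rewrite (le_trans B1)// lerDl.
  move=> k t; rewrite leq_eqVlt => /orP[/eqP ->|kl].
    by rewrite (le_trans (HC t))// lerDr (le_trans ler01).
  by rewrite (le_trans (IH k t _))// lerDl.
exists B => // p h t pl h0; apply: (@rdiff_bound _ p G) => //.
- by move=> k s _; exact: smooth1_is_derive.
- by move=> s _; exact: HB.
Qed.

Lemma rdiff_affine f a b h p t :
  iter p (rdiff h) (fun t => f (a * t + b)) t = iter p (rdiff (a * h)) f (a * t + b).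
Proof.
elim: p t => [//|p IH] t; rewrite !iterS /rdiff -/(rdiff h) -/(rdiff (a * h)) !IH.
by rewrite mulrDr addrAC.
Qed.

Lemma rbound_affine f a b l C : 1 <= a -> rbound l C f ->
  rbound l (C * a ^+ l) (fun t => f (a * t + b)).
Proof.
move=> a1 fC p h t pl h0; have a0 : 0 < a by exact: lt_le_trans a1.
rewrite rdiff_affine; apply: le_trans (fC _ _ _ pl (mulr_gt0 a0 h0)) _.
have C0 : 0 <= C.
  by have := fC 0%N 1 0 isT ltr01; rewrite expr0 mulr1; apply: le_trans.
rewrite exprMn mulrA ler_wpM2r ?exprn_ge0 ?(ltW h0)// ler_wpM2l//.
by rewrite ler_weXn2l.
Qed.

End Step.

Section ProductBump.
Variables (R : realType) (d : nat).
Local Notation Rd := 'rV[R]_d.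

(** A derivative or a difference along one axis acts on a single factor, which reduces all cutoffs
    to one variable. *)
Definition tensor (g : 'I_d -> R -> R) : Rd -> R[i] :=
  fun x => (\prod_i g i (x 0 i))%:C%C.

Lemma axis_entry (x : Rd) i j (t : R) :
  (x + t *: delta_mx 0 i) 0 j = if j == i then x 0 i + t else x 0 j.
Proof.
by rewrite !mxE eqxx /=; case: eqP => [->|_]; rewrite ?mulr1// mulr0 addr0.
Qed.

Lemma tensor_axis g (x : Rd) i (t : R) :
  tensor g (x + t *: delta_mx 0 i) =
  ((\prod_(j | j != i) g j (x 0 j)) * g i (x 0 i + t))%:C%C.
Proof.
rewrite /tensor (bigD1 i) //= axis_entry eqxx mulrC; congr (_ * _)%:C%C.
by apply: eq_bigr => j ji; rewrite axis_entry (negPf ji).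
Qed.

Lemma is_derive_tensor g (x : Rd) i : (forall j, smooth1 (g j)) ->
  is_derive x (delta_mx 0 i) (fun y : Rd => \prod_j g j (y 0 j))
    (\prod_j (if j == i then derive1 (g j) else g j) (x 0 j)).
Proof.
move=> sg; set P := \prod_(j | j != i) g j (x 0 j).
have E (t : R) : \prod_j g j ((x + t *: delta_mx 0 i : Rd) 0 j) = P * g i (x 0 i + t).
  by have /(congr1 (@complex.Re R)) := tensor_axis g x i t.
have E2 : \prod_j (if j == i then derive1 (g j) else g j) (x 0 j) = P * derive1 (g i) (x 0 i).
  rewrite (bigD1 i) //= eqxx mulrC; congr (_ * _).
  by apply: eq_bigr => j /negPf ->.
have dg : is_derive (0 : R) 1 (fun t => P * g i (x 0 i + t)) (P * derive1 (g i) (x 0 i)).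
  have A : is_derive (0 : R) 1 (fun t => g i (x 0 i + t)) (derive1 (g i) (x 0 i)).
    have := @is_derive_affine _ (g i) 1 (x 0 i) 0 (derive1 (g i) (x 0 i)).
    rewrite mulr0 add0r mulr1 => /(_ (smooth1_is_derive _ (sg i))).
    by congr is_derive; apply/funext => t; rewrite mul1r addrC.
  exact: (@is_deriveZ _ _ _ (fun t => g i (x 0 i + t)) P 0 1 _ A).
have F : (fun h : R => h^-1 *: (((fun y : Rd => \prod_j g j (y 0 j)) \o shift x)
      (h *: delta_mx 0 i) - \prod_j g j (x 0 j))) =
   (fun h : R => h^-1 *: (((fun t => P * g i (x 0 i + t)) \o shift 0) (h *: (1 : R)) -
      (P * g i (x 0 i + 0)))).
  apply/funext => h; congr (_ *: (_ - _)).
    by rewrite /= addrC E addr0 [h *: 1]mulr1.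
  by rewrite -E scale0r addr0.
case: dg => dg1 dg2; split; first by move: dg1; rewrite /derivable F.
by rewrite E2 -dg2 /derive F.
Qed.

Lemma continuous_prod_coord (g : 'I_d -> R -> R) : (forall j, continuous (g j)) ->
  continuous (fun y : Rd => \prod_(j < d) g j (y 0 j) : R).
Proof.
move=> cg x.
have H (s : seq 'I_d) : {for x, continuous (fun y : Rd => \prod_(j <- s) g j (y 0 j) : R)}.
  elim: s => [|j s IH].
    have -> : (fun y : Rd => \prod_(j <- [::]) g j (y 0 j) : R) = cst 1.
      by apply/funext => y; rewrite big_nil.
    exact: (@cst_continuous _ _ (1 : R)).
  have -> : (fun y : Rd => \prod_(k <- j :: s) g k (y 0 k) : R) =
      (fun y => g j (y 0 j) * \prod_(k <- s) g k (y 0 k)).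
    by apply/funext => y; rewrite big_cons.
  have cgj : {for x, continuous (fun y : Rd => g j (y 0 j))}.
    apply: (@continuous_comp _ _ _ (fun y : Rd => y 0 j) (g j) x); last exact: cg.
    exact: coord_continuous.
  exact: (@continuousM _ _ (fun y : Rd => g j (y 0 j)) _ x cgj IH).
exact: H.
Qed.

Lemma pderiv_tensor g i : (forall j, smooth1 (g j)) ->
  pderiv i (tensor g) = tensor (fun j => if j == i then derive1 (g j) else g j).
Proof.
move=> sg; apply/funext => x; rewrite /pderiv /tensor; congr Complex.
  by have := is_derive_tensor x i sg => -[_].
have -> : (fun y : Rd => complex.Im ((\prod_j g j (y 0 j))%:C%C : R[i])) = cst 0 by apply/funext.
by rewrite derive_cst.
Qed.

Lemma smooth_tensor g : (forall j, smooth1 (g j)) -> smooth (tensor g).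
Proof.
move=> sg s.
have [g' sg' ->] : exists2 g', (forall j, smooth1 (g' j)) & iter_pderiv s (tensor g) = tensor g'.
  elim: s => [|i s [g' sg' E]]; first by exists g.
  exists (fun j => if j == i then derive1 (g' j) else g' j).
    by move=> j; case: eqP => _ //; exact: smooth1_derive1.
  by rewrite /= E pderiv_tensor.
split.
- by apply: continuous_prod_coord => j; exact: smooth1_continuous.
- have -> : (fun y : Rd => complex.Im (tensor g' y)) = cst 0 by apply/funext.
  exact: (@cst_continuous _ _ (0 : R)).
- move=> i x; split; first by have [] := is_derive_tensor x i sg'.
  have -> : (fun y : Rd => complex.Im (tensor g' y)) = cst 0 by apply/funext.
  exact: derivable_cst.
Qed.

Lemma dbound_tensor g l h0 C : (forall j, rbound l C (g j)) ->
  dbound l h0 (C ^+ d) (tensor g).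
Proof.
move=> gC i p x h pl h_gt0 _.
have gC0 j t : `|g j t| <= C by have := gC j 0%N 1 t isT ltr01; rewrite expr0 mulr1.
have C0 : 0 <= C by exact: le_trans (gC0 i 0).
set P := \prod_(j | j != i) g j (x 0 j).
have E t : iter p (fdiff i h) (tensor g) (x + t *: delta_mx 0 i) =
   (P * iter p (rdiff h) (g i) (x 0 i + t))%:C%C.
  elim: p {pl} t => [|p IH] t; first by rewrite /= tensor_axis.
  rewrite !iterS /fdiff -/(fdiff i h) -addrA -scalerDl !IH -rmorphB /= -mulrBr.
  by rewrite /rdiff addrA.
have := E 0; rewrite scale0r !addr0 => ->; rewrite normc_real normrM.
have -> : C ^+ d = C ^+ d.-1 * C by rewrite -exprSr prednK// (leq_ltn_trans _ (ltn_ord i)).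
rewrite -mulrA ler_pM//; last exact: gC.
rewrite normr_prod; have -> : C ^+ d.-1 = \prod_(j | j != i) C.
  by rewrite prodr_const cardC1 card_ord.
by apply: ler_prod => j _; rewrite normr_ge0 gC0.
Qed.

End ProductBump.

(** * Leibniz formula and compactly supported functions *)

Section Leibniz.
Variables (R : realType) (d : nat).
Local Notation Rd := 'rV[R]_d.
Local Notation e_ i := (delta_mx 0 i : Rd).
Implicit Types (f g : Rd -> R[i]).

Definition ccont f := continuous (fun y => complex.Re (f y)) /\
  continuous (fun y => complex.Im (f y)).

Definition is_pderive (i : 'I_d) f (x : Rd) (D : R[i]) :=
  is_derive x (e_ i) (fun y => complex.Re (f y)) (complex.Re D) /\
  is_derive x (e_ i) (fun y => complex.Im (f y)) (complex.Im D).

Lemma is_pderiveE i f x D : is_pderive i f x D -> pderiv i f x = D.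
Proof. by case: D => a b [[_ /= E1] [_ /= E2]]; rewrite /pderiv E1 E2. Qed.

Lemma smooth_is_pderive f s i x : smooth f ->
  is_pderive i (iter_pderiv s f) x (iter_pderiv (i :: s) f x).
Proof. by move=> /(_ s)[_ _ /(_ i x)[a b]]; split; split. Qed.

Lemma smooth_ccont f s : smooth f -> ccont (iter_pderiv s f).
Proof. by move=> /(_ s)[a b _]. Qed.

Lemma reD (z w : R[i]) : complex.Re (z + w) = complex.Re z + complex.Re w.
Proof. by case: z; case: w. Qed.
Lemma imD (z w : R[i]) : complex.Im (z + w) = complex.Im z + complex.Im w.
Proof. by case: z; case: w. Qed.
Lemma reM (z w : R[i]) : complex.Re (z * w) =
  complex.Re z * complex.Re w - complex.Im z * complex.Im w.
Proof. by case: z; case: w. Qed.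
Lemma imM (z w : R[i]) : complex.Im (z * w) =
  complex.Re z * complex.Im w + complex.Im z * complex.Re w.
Proof. by case: z => a b; case: w => a' b'. Qed.

Lemma is_pderiveD i f g x D E : is_pderive i f x D -> is_pderive i g x E ->
  is_pderive i (fun y => f y + g y) x (D + E).
Proof.
move=> [f1 f2] [g1 g2]; split; rewrite ?reD ?imD.
- under eq_fun do rewrite reD; exact: (is_deriveD f1 g1).
- under eq_fun do rewrite imD; exact: (is_deriveD f2 g2).
Qed.

Lemma is_pderiveM i f g x D E : is_pderive i f x D -> is_pderive i g x E ->
  is_pderive i (fun y => f y * g y) x (D * g x + f x * E).
Proof.
move=> [f1 f2] [g1 g2]; split.
- under eq_fun do rewrite reM.
  rewrite (_ : complex.Re (D * g x + f x * E) =
    (complex.Re (f x) *: complex.Re E + complex.Re (g x) *: complex.Re D) -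
    (complex.Im (f x) *: complex.Im E + complex.Im (g x) *: complex.Im D)).
    exact: (is_deriveB (is_deriveM f1 g1) (is_deriveM f2 g2)).
  by rewrite reD !reM /GRing.scale /=; ring.
- under eq_fun do rewrite imM.
  rewrite (_ : complex.Im (D * g x + f x * E) =
    (complex.Re (f x) *: complex.Im E + complex.Im (g x) *: complex.Re D) +
    (complex.Im (f x) *: complex.Re E + complex.Re (g x) *: complex.Im D)).
    exact: (is_deriveD (is_deriveM f1 g2) (is_deriveM f2 g1)).
  by rewrite imD !imM /GRing.scale /=; ring.
Qed.

Lemma is_pderive0 i x : is_pderive i (fun=> 0) x 0.
Proof. by split; exact: is_derive_cst. Qed.

Lemma ccont_cst (c : R[i]) : ccont (fun=> c).
Proof.
by split; [exact: (@cst_continuous _ _ (complex.Re c))|exact: (@cst_continuous _ _ (complex.Im c))].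
Qed.

Lemma ccontD f g : ccont f -> ccont g -> ccont (fun y => f y + g y).
Proof.
move=> [f1 f2] [g1 g2]; split=> x.
- under eq_fun do rewrite reD; exact: (continuousD (f1 x) (g1 x)).
- under eq_fun do rewrite imD; exact: (continuousD (f2 x) (g2 x)).
Qed.

Lemma ccontM f g : ccont f -> ccont g -> ccont (fun y => f y * g y).
Proof.
move=> [f1 f2] [g1 g2]; split=> x.
- under eq_fun do rewrite reM.
  exact: (continuousB (continuousM (f1 x) (g1 x)) (continuousM (f2 x) (g2 x))).
- under eq_fun do rewrite imM.
  exact: (continuousD (continuousM (f1 x) (g2 x)) (continuousM (f2 x) (g1 x))).
Qed.

(** All [2 ^ size s] ways of distributing the derivatives in [s] over two factors, kept as ordered
    subsequences so that the order of differentiation never changes. *)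
Fixpoint leibniz_terms (s : seq 'I_d) : seq (seq 'I_d * seq 'I_d) :=
  if s is i :: s' then
    [seq (i :: q.1, q.2) | q <- leibniz_terms s'] ++
    [seq (q.1, i :: q.2) | q <- leibniz_terms s']
  else [:: ([::], [::])].

Lemma leibniz_terms_subseq s q : q \in leibniz_terms s -> subseq q.1 s /\ subseq q.2 s.
Proof.
elim: s q => [|i s IH] q /=; first by rewrite inE => /eqP ->.
rewrite mem_cat => /orP[] /mapP[q' /IH[a b] ->] /=; rewrite eqxx; split=> //.
  by apply: subseq_trans b (subseq_cons _ _).
by apply: subseq_trans a (subseq_cons _ _).
Qed.

Lemma sum_pderive (F G : seq 'I_d * seq 'I_d -> Rd -> R[i]) (L : seq (seq 'I_d * seq 'I_d)) i x
    (D E : seq 'I_d * seq 'I_d -> R[i]) :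
  (forall q, is_pderive i (F q) x (D q)) -> (forall q, is_pderive i (G q) x (E q)) ->
  is_pderive i (fun y => \sum_(q <- L) F q y * G q y) x
    (\sum_(q <- L) (D q * G q x + F q x * E q)).
Proof.
move=> FD GE; elim: L => [|q L IH].
  under eq_fun do rewrite big_nil; rewrite big_nil; exact: is_pderive0.
under eq_fun do rewrite big_cons.
by rewrite big_cons; apply: is_pderiveD => //; exact: is_pderiveM.
Qed.

Lemma iter_pderivM f g s : smooth f -> smooth g ->
  iter_pderiv s (fun y => f y * g y) =
  fun x => \sum_(q <- leibniz_terms s) iter_pderiv q.1 f x * iter_pderiv q.2 g x.
Proof.
move=> sf sg; elim: s => [|i s IH].
  by apply/funext => x; rewrite big_seq1.
apply/funext => x; rewrite /= -/(iter_pderiv s _) IH.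
rewrite (is_pderiveE (sum_pderive (leibniz_terms s)
  (fun q => smooth_is_pderive q.1 i x sf) (fun q => smooth_is_pderive q.2 i x sg))).
by rewrite big_split big_cat !big_map.
Qed.

Lemma smoothM f g : smooth f -> smooth g -> smooth (fun y => f y * g y).
Proof.
move=> sf sg s; rewrite (iter_pderivM s sf sg).
have [c1 c2] : ccont (fun x => \sum_(q <- leibniz_terms s) iter_pderiv q.1 f x * iter_pderiv q.2 g x).
  elim: (leibniz_terms s) => [|q L IH].
    by under eq_fun do rewrite big_nil; exact: ccont_cst.
  under eq_fun do rewrite big_cons.
  by apply: ccontD => //; apply: ccontM; exact: smooth_ccont.
split=> // i x.
have [[a _] [b _]] := sum_pderive (leibniz_terms s)
  (fun q => smooth_is_pderive q.1 i x sf) (fun q => smooth_is_pderive q.2 i x sg).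
by split.
Qed.

(** Moderateness speaks of multi-indices while Leibniz terms are subsequences; a subsequence of a
    list grouped by axis is again grouped in this way. *)
Lemma subseq_mderiv (al : 'I_d -> nat) q :
  subseq q (flatten [seq nseq (al i) i | i <- enum 'I_d]) ->
  exists be : 'I_d -> nat, forall f, iter_pderiv q f = mderiv be f.
Proof.
suff H : forall e : seq 'I_d, uniq e -> forall q,
    subseq q (flatten [seq nseq (al i) i | i <- e]) ->
    exists be : 'I_d -> nat, q = flatten [seq nseq (be i) i | i <- e].
  by move=> /(H _ (enum_uniq _))[be E]; exists be => f; rewrite E.
elim=> [_ q'|i e IH /= /andP[ie ue] q'].
  by rewrite subseq0 => /eqP ->; exists (fun=> 0%N).
move=> /subseqP[m sm ->].
rewrite size_cat in sm.
rewrite -(cat_take_drop (size (nseq (al i) i)) m) mask_cat ?size_takel ?sm ?leq_addr//.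
set q1 := mask _ _; set q2 := mask _ _.
have [|be E] := IH ue q2; first exact: mask_subseq.
have Eq1 : q1 = nseq (size q1) i.
  apply/all_pred1P/allP => j jq1.
  by have := mem_mask jq1; rewrite mem_nseq => /andP[_ /eqP ->] /=.
exists (fun j => if j == i then size q1 else be j); rewrite eqxx -Eq1 E; congr (_ ++ flatten _).
apply/eq_in_map => j je; case: eqP => // ji; by rewrite -ji je in ie.
Qed.

Lemma iter_pderiv_zero_on (U : set Rd) f s : open U -> (forall x, U x -> f x = 0) ->
  forall x, U x -> iter_pderiv s f x = 0.
Proof.
move=> oU f0; elim: s => [//|i s IH] x Ux; apply: is_pderiveE.
have near0 : \near x, iter_pderiv s f x = 0.
  by move: (open_nbhs_nbhs (conj oU Ux)); apply: filterS => y; exact: IH.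
split; apply: (@near_eq_is_derive _ _ _ (cst 0)); apply: filterS near0 => y E.
- by rewrite -[RHS]/(complex.Re (iter_pderiv s f y)) E.
- by rewrite -[RHS]/(complex.Im (iter_pderiv s f y)) E.
Qed.

Lemma closed_norm_le (x0 : Rd) (r : R) : closed [set x : Rd | `|x - x0| <= r].
Proof.
apply: (@closed_comp _ _ (fun x : Rd => `|x - x0|) [set t | t <= r]); last exact: closed_le.
move=> x _; apply: continuous_comp; last exact: norm_continuous.
by apply: continuousB; [exact: cvg_id|exact: cst_continuous].
Qed.

Lemma compact_norm_sub_le (x0 : Rd) (r : R) : compact [set x : Rd | `|x - x0| <= r].
Proof.
apply: bounded_closed_compact; last exact: closed_norm_le.
exists (`|x0| + r); split; first exact: num_real.
move=> s rs x /= xr; apply: le_trans (ltW rs).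
by rewrite -[x](subrK x0) (le_trans (ler_normD _ _))// addrC lerD2l.
Qed.

Lemma compact_norm_le (r : R) : compact [set x : Rd | `|x| <= r].
Proof.
have := @compact_norm_sub_le 0 r; congr compact; apply/seteqP.
by split=> x /=; rewrite subr0.
Qed.

(** Compactness of the cube of radius [|M| + 1] gives a uniform step there. The extra [1] covers a
    first point outside the cube: a second point at distance at most [1] then also lies where [f]
    vanishes. *)
Lemma ccont_unif_cont (M : R) f : ccont f -> supp_in M f -> cunif_cont f.
Proof.
move=> [f1 f2] sf e e0.
pose B : set Rd := [set x | `|x| <= `|M| + 1].
have cB : compact B := @compact_norm_le _.
have cov : near_covering B by apply/compact_near_coveringP.
pose P (de : R) (x : Rd) := forall y, `|x - y| <= `|de| -> Normc.normc (f x - f y) <= e.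
have e4 : 0 < e / 4 by rewrite divr_gt0.
have C : forall x, B x -> \forall x' \near x & de \near (0 : R), P de x'.
  move=> x Bx.
  have n1 : \forall y \near x, `|complex.Re (f x) - complex.Re (f y)| <= e / 4.
    by have /cvgrPdist_le := f1 x; apply.
  have n2 : \forall y \near x, `|complex.Im (f x) - complex.Im (f y)| <= e / 4.
    by have /cvgrPdist_le := f2 x; apply.
  have [r r0 Hr] : exists2 r : R, 0 < r & forall y, `|x - y| < r ->
     Normc.normc (f x - f y) <= e / 2.
    have [r /= r0 H] := (nbhs_ballP _ _).1 (filterI n1 n2); exists r => // y xy.
    have yb : ball x r y by rewrite -ball_normE /=.
    have [/= a b] := H y yb.
    apply: le_trans (normc_le_re_im _) _.
    rewrite -[f x - f y]/(f x + - f y) reD imD.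
    by move: a b; case: (f y) => u v /=; clear; lra.
  exists (ball x (r / 2), ball 0 (r / 2)); first by split; apply: nbhsx_ballx; rewrite divr_gt0.
  move=> [x' de] [/= xx' dd] y x'y.
  have de2 : `|de| < r / 2 by move: dd; rewrite -ball_normE /= sub0r normrN.
  have xx2 : `|x - x'| < r / 2 by move: xx'; rewrite -ball_normE.
  have a := Hr x' (lt_trans xx2 _).
  have b : `|x - y| < r.
    rewrite -[x - y](subrKA x') (le_lt_trans (ler_normD _ _))//.
    by move: xx2 de2 x'y; clear; lra.
  have -> : f x' - f y = - (f x - f x') + (f x - f y) by ring.
  apply: le_trans (normcD _ _) _; rewrite normc_opp [e]splitr lerD//; last exact: Hr.
  by apply: a; move: r0; clear; lra.
have [r /= r0 HP] := (nbhs_ballP _ _).1 (cov R (nbhs (0 : R)) P _ C).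
have {}HP x de : B x -> `|de| < r -> P de x.
  by move=> Bx der; apply: (HP de) => //; rewrite -ball_normE /= sub0r normrN.
exists (Num.min (r / 2) 1); first by rewrite lt_min ltr01 divr_gt0.
move=> x y; rewrite le_min => /andP[xy1 xy2].
have [xB|xB] := leP `|x| (`|M| + 1).
  have r2 : `|r / 2| = r / 2 by rewrite gtr0_norm// divr_gt0.
  by apply: (HP x (r / 2)) => //; rewrite r2//; move: r0; clear; lra.
rewrite !sf ?subr0 ?Normc.normc0 ?(ltW e0)//.
  have := lerB_dist x y; have := ler_norm M; move: xB xy2.
  by move: (`|x|) (`|y|) (`|M|) (`|x - y|) => u v m t; clear; lra.
by have := ler_norm M; move: xB; clear; lra.
Qed.

Lemma ccont_cc (M : R) f : ccont f -> supp_in M f -> cc M f.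
Proof.
move=> cf sf; split=> //; first exact: ccont_unif_cont sf.
have [f1 f2] := cf.
have bnd (p : R[i] -> R) : p 0 = 0 -> continuous (fun y => p (f y)) ->
    exists2 C, 0 <= C & forall x, `|p (f x)| <= C.
  move=> p0 cp.
  have cn : {within [set x : Rd | `|x| <= `|M|], continuous (fun y => `|p (f y)|)}.
    apply: continuous_subspaceT => y; apply: continuous_comp; first exact: cp.
    exact: norm_continuous.
  have ne : [set x : Rd | `|x| <= `|M|] !=set0 by exists 0; rewrite /= normr0.
  have [c _ H] := EVT_max_rV ne (@compact_norm_le `|M|) cn.
  exists `|p (f c)| => // x; have [xM|xM] := leP `|x| `|M|; first by apply: H; rewrite inE.
  by rewrite sf ?p0 ?normr0// (le_trans (ler_norm M))// ltW.
have [A A0 HA] := bnd (@complex.Re R) erefl f1.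
have [B B0 HB] := bnd (@complex.Im R) erefl f2.
exists (A + B); first exact: addr_ge0.
by move=> x; apply: le_trans (normc_le_re_im _) _; exact: lerD.
Qed.

End Leibniz.

(** * Euclidean norm and directions *)

Section Euclid.
Variables (R : realType) (d : nat).
Local Notation Rd := 'rV[R]_d.
Implicit Types x y : Rd.

Lemma dotp_ge0 x : 0 <= dotp x x.
Proof. by apply: sumr_ge0 => i _; rewrite -expr2 sqr_ge0. Qed.

Lemma enorm_ge0 x : 0 <= enorm x.
Proof. exact: sqrtr_ge0. Qed.

Lemma sqr_enorm x : enorm x ^+ 2 = dotp x x.
Proof. by rewrite sqr_sqrtr// dotp_ge0. Qed.

Lemma norm_le_enorm x : `|x| <= enorm x.
Proof.
apply: norm_le_entry => [|i]; first exact: enorm_ge0.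
rewrite -(ler_sqr (x := `|_|)) ?nnegrE ?enorm_ge0// sqr_enorm real_normK ?num_real//.
by rewrite /dotp (bigD1 i) //= -expr2 lerDl; apply: sumr_ge0 => j _; rewrite -expr2 sqr_ge0.
Qed.

Lemma enorm_le_norm x : enorm x <= d%:R * `|x|.
Proof.
rewrite -(ler_sqr (x := enorm _)) ?nnegrE ?enorm_ge0 ?mulr_ge0// sqr_enorm.
apply: le_trans (ler_norm _) _; apply: le_trans (dotp_le _ _) _.
rewrite exprMn [`|x| ^+ 2]expr2 ler_wpM2r ?mulr_ge0// -natrX ler_nat.
by case: (d) => [//|n]; rewrite expnS expn1 leq_pmulr.
Qed.

Lemma enormZ (t : R) x : enorm (t *: x) = `|t| * enorm x.
Proof.
apply/eqP; rewrite -(eqrXn2 (n := 2))// ?mulr_ge0 ?enorm_ge0//.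
rewrite exprMn !sqr_enorm real_normK ?num_real// /dotp mulr_sumr.
by apply/eqP; apply: eq_bigr => i _; rewrite !mxE; ring.
Qed.

Lemma enorm_eq0 x : enorm x = 0 -> x = 0.
Proof.
move=> x0; apply/eqP; rewrite -normr_eq0 eq_le normr_ge0 andbT.
by rewrite -[X in _ <= X]x0 norm_le_enorm.
Qed.

Lemma enorm0 : enorm (0 : Rd) = 0.
Proof. by rewrite -(scale0r (0 : Rd)) enormZ normr0 mul0r. Qed.

Lemma enorm_unit_dir x : x != 0 -> enorm (unit_dir x) = 1.
Proof.
move=> x0; have e0 : enorm x != 0 by apply: contraNneq x0 => /enorm_eq0 ->.
by rewrite /unit_dir enormZ ger0_norm ?invr_ge0 ?enorm_ge0// mulVf.
Qed.

Lemma unit_dirZ (t : R) x : 0 < t -> unit_dir (t *: x) = unit_dir x.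
Proof.
move=> t0; rewrite /unit_dir enormZ gtr0_norm// scalerA invfM mulrAC.
by rewrite mulVf ?mul1r// gt_eqF.
Qed.

Lemma unit_dir_sphere x : enorm x = 1 -> unit_dir x = x.
Proof. by move=> x1; rewrite /unit_dir x1 invr1 scale1r. Qed.

(** Multiplied by [enorm x + enorm y], the difference of the norms becomes the dot product of
    [x - y] and [x + y], to which [dotp_le] applies. *)
Lemma enorm_dist x y : `|enorm x - enorm y| <= d%:R * `|x - y|.
Proof.
have [-> | xy] := eqVneq x y; first by rewrite !subrr !normr0 mulr0.
have s0 : 0 < enorm x + enorm y.
  rewrite lt_neqAle addr_ge0 ?enorm_ge0// andbT eq_sym.
  apply: contra_neqN xy; rewrite paddr_eq0 ?enorm_ge0// => /andP[/eqP a /eqP b].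
  by rewrite (enorm_eq0 a) (enorm_eq0 b).
rewrite -(ler_pM2r s0) -{1}(gtr0_norm s0) -normrM.
have -> : (enorm x - enorm y) * (enorm x + enorm y) = dotp (x - y) (x + y).
  have -> : dotp (x - y) (x + y) = dotp x x - dotp y y.
    by rewrite /dotp -sumrB; apply: eq_bigr => i _; rewrite !mxE; ring.
  by rewrite -!sqr_enorm; ring.
apply: le_trans (dotp_le _ _) _; rewrite -mulrA ler_wpM2l// ler_wpM2l//.
by apply: le_trans (ler_normD _ _) _; rewrite lerD// norm_le_enorm.
Qed.

(** Up to the factor [1 / enorm x], the difference is [(x - y) + (enorm y - enorm x) *: unit_dir y];
    the first summand gives the [1] in [d.+1], the second gives the [d]. *)
Lemma unit_dir_dist x y : x != 0 -> y != 0 ->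
  `|unit_dir x - unit_dir y| <= d.+1%:R * `|x - y| / enorm x.
Proof.
move=> x0 y0; have px : 0 < enorm x.
  by rewrite lt_neqAle enorm_ge0 andbT eq_sym; apply: contra_neq x0 => /enorm_eq0.
have py : 0 < enorm y.
  by rewrite lt_neqAle enorm_ge0 andbT eq_sym; apply: contra_neq y0 => /enorm_eq0.
have -> : unit_dir x - unit_dir y = (enorm x)^-1 *: ((x - y) + (enorm y - enorm x) *: unit_dir y).
  by apply/rowP => i; rewrite !mxE; field; rewrite !gt_eqF.
rewrite normrZ gtr0_norm ?invr_gt0// mulrC ler_pM2r ?invr_gt0//.
apply: le_trans (ler_normD _ _) _; rewrite -natr1 mulrDl mul1r addrC lerD2r.
rewrite normrZ distrC; apply: le_trans (_ : `|enorm x - enorm y| * 1 <= _); last by rewrite mulr1 enorm_dist.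
by rewrite ler_wpM2l// (le_trans (norm_le_enorm _))// enorm_unit_dir.
Qed.

End Euclid.

(** * Saturation principles and powers of epsilon *)

Section NetPrinciples.
Variable R : realType.
Local Notation E := (eps_index R).
Local Notation near_eps P := (\forall e \near @small_eps R, P e).

Lemma near_epsP (P : E -> Prop) : near_eps P <->
  exists2 e0 : R, 0 < e0 & forall e : E, sval e <= e0 -> P e.
Proof. by split=> -[e0 /= e00 H]; exists e0. Qed.

Lemma not_near_eps (P : E -> Prop) : ~ near_eps P ->
  forall b : R, 0 < b -> exists e : E, sval e <= b /\ ~ P e.
Proof.
move=> nP b b0; apply: contrapT => H; apply: nP; apply/near_epsP; exists b => // e eb.
by apply: contrapT => nPe; apply: H; exists e.
Qed.

Lemma eps_gt0 (e : E) : 0 < sval e.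
Proof. by case: e => e /= /andP[]. Qed.

Lemma eps_le1 (e : E) : sval e <= 1.
Proof. by case: e => e /= /andP[]. Qed.

(** Taking at each [e] a counterexample whenever there is one yields a single net that tests all
    points simultaneously; nonemptiness of [A e] supplies its other values. *)
Lemma internal_forall (T : Type) (A P : E -> T -> Prop) :
  near_eps (fun e => exists t, A e t) ->
  (forall x : E -> T, near_eps (fun e => A e (x e)) -> near_eps (fun e => P e (x e))) ->
  near_eps (fun e => forall t, A e t -> P e t).
Proof.
move=> neA H.
have [t0 _] : exists t : T, True.
  have /near_epsP[e0 e00 He] := neA.
  have h : 0 < Num.min e0 1 <= 1 by rewrite lt_min e00 ltr01 ge_min lexx orbT.
  have [|t _] := He (exist (fun e : R => 0 < e <= 1) _ h); last by exists t.
  by rewrite /= ge_min lexx.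
have /choice[x Hx] : forall e, exists t, (exists s, A e s) ->
    A e t /\ (P e t -> forall s, A e s -> P e s).
  move=> e.
  have [[t [At nPt]]|nb] := pselect (exists t, A e t /\ ~ P e t).
    by exists t => _; split.
  have [[t At]|nA] := pselect (exists t, A e t); last by exists t0.
  exists t => _; split=> // _ s As; apply: contrapT => nPs; apply: nb; by exists s.
have near1 : near_eps (fun e => A e (x e)).
  by apply: filterS neA => e /Hx[].
apply: filterS2 neA (H x near1) => e /Hx[_]; exact.
Qed.

(* If every [N] fails, the failures for each [N] can be placed on infinitely
   many terms of a single decreasing sequence, since [logn 2] takes every value
   infinitely often; the resulting net contradicts the hypothesis. *)
Lemma uniform_witness (T : Type) (A : E -> T -> Prop) (Q : nat -> nat -> E -> T -> Prop) :
  near_eps (fun e => exists t, A e t) ->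
  (forall x : E -> T, near_eps (fun e => A e (x e)) ->
     exists N, forall m, near_eps (fun e => Q N m e (x e))) ->
  exists N, forall m, near_eps (fun e => forall t, A e t -> Q N m e t).
Proof.
move=> neA H; apply: contrapT => nN.
have /choice[mm Hmm] : forall N, exists m,
    ~ near_eps (fun e => forall t, A e t -> Q N m e t).
  move=> N; apply: contrapT => H'; apply: nN; exists N => m; apply: contrapT => H''.
  by apply: H'; exists m.
pose bad N e t := A e t /\ ~ Q N (mm N) e t.
have freq N (b : R) : exists e : E, 0 < b -> sval e <= b /\ exists t, bad N e t.
  case: (ltP 0 b) => b0; last first.
    have h : 0 < (1 : R) <= 1 by rewrite ltr01 lexx.
    by exists (exist (fun e : R => 0 < e <= 1) 1 h).
  have [e [eb ne]] := not_near_eps (Hmm N) b0.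
  exists e => _; split=> //; apply: contrapT => nb; apply: ne => t At.
  by apply: contrapT => nQ; apply: nb; exists t.
have /choice[pick Hpick] : forall p : nat * R, exists e : E, 0 < p.2 ->
    sval e <= p.2 /\ exists t, bad p.1 e t.
  by move=> [N b]; exact: freq.
pose idx k := logn 2 k.+1.
pose es := fix es k : E := if k is j.+1 then
   pick (idx k, Num.min (sval (es j) / 2) (k.+1%:R^-1)) else pick (idx 0%N, 1).
have esP k : exists b, [/\ 0 < b, es k = pick (idx k, b), b <= k.+1%:R^-1 &
    forall j, k = j.+1 -> b < sval (es j)].
  case: k => [|k]; first by exists 1; split; rewrite ?invr1.
  exists (Num.min (sval (es k) / 2) (k.+2%:R^-1)); split=> //.
  - by rewrite lt_min divr_gt0 ?eps_gt0//= invr_gt0.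
  - by rewrite ge_min lexx orbT.
  - move=> j [<-]; rewrite gt_min; apply/orP; left.
    by rewrite ltr_pdivrMr// ltr_pMr ?eps_gt0// ltr1n.
have es_small k : sval (es k) <= k.+1%:R^-1.
  have [b [b0 -> bk _]] := esP k; have [+ _] := Hpick (idx k, b) b0.
  by move/le_trans; apply.
have es_bad k : exists t, bad (idx k) (es k) t.
  by have [b [b0 -> _ _]] := esP k; have [_] := Hpick (idx k, b) b0.
have es_lt k : sval (es k.+1) < sval (es k).
  have [b [b0 E1 _ /(_ k erefl) E2]] := esP k.+1; rewrite E1; have [+ _] := Hpick (idx k.+1, b) b0.
  by move/le_lt_trans; apply.
have es_mono j k : (j < k)%N -> sval (es k) < sval (es j).
  elim: k => [//|k IH]; rewrite ltnS leq_eqVlt => /orP[/eqP ->|/IH]; first exact: es_lt.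
  by apply: lt_trans; exact: es_lt.
have es_inj j k : es j = es k -> j = k.
  by move=> jk; case: (ltngtP j k) => // /es_mono; rewrite jk ltxx.
have [t0 _] : exists t : T, True by have [t _] := es_bad 0%N; exists t.
(* One net carrying all the failures: at [e = es k] it takes a failure for [idx k], unambiguously
   because [es] is injective. *)
have /choice[x Hx] : forall e, exists t,
    (forall k, e = es k -> bad (idx k) e t) /\ ((exists s, A e s) -> A e t).
  move=> e.
  have [[k ek]|nk] := pselect (exists k, e = es k).
    have [t bt] := es_bad k; exists t; split; last by move=> _; rewrite ek; case: bt.
    by move=> k' ek'; have -> : k' = k; [apply: es_inj; rewrite -ek -ek'|rewrite ek].
  have [[t At]|nA] := pselect (exists t, A e t); last first.
    by exists t0; split=> // k ek; case: nk; exists k.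
  by exists t; split=> // k ek; case: nk; exists k.
have nx : near_eps (fun e => A e (x e)) by apply: filterS neA => e; case: (Hx e).
have [N0 /(_ (mm N0)) /near_epsP[e1 e10 He1]] := H x nx.
pose j := Num.trunc e1^-1.
(* [k.+1] has 2-adic valuation [N0] and its odd factor exceeds [1 / e1], so [es k] lies in the range
   where success for [N0] was promised. *)
pose k := ((j.*2.+1) * 2 ^ N0).-1.
have kE : k.+1 = (j.*2.+1 * 2 ^ N0)%N by rewrite prednK// muln_gt0 expn_gt0.
have ik : idx k = N0.
  by rewrite /idx kE logn_Gauss ?pfactorK// coprime2n /= odd_double.
have ek : sval (es k) <= e1.
  apply: le_trans (es_small k) _; rewrite -[e1]invrK lef_pV2 ?posrE ?invr_gt0//.
  have i0 : 0 <= e1^-1 by rewrite invr_ge0 ltW.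
  have /andP[_ /ltW H1] := truncn_itv i0; apply: le_trans H1 _.
  rewrite ler_nat kE -/j; apply: leq_trans (_ : j.*2.+1 <= _)%N.
    by rewrite ltnS -addnn leq_addr.
  by rewrite leq_pmulr// expn_gt0.
have [/(_ k erefl)[_]] := Hx (es k); rewrite ik => nQ _; apply: nQ; exact: He1.
Qed.

Lemma eps_powR (e : E) (a : R) : sval e `^ a = expR (a * ln (sval e)).
Proof. by rewrite /powR gt_eqF// eps_gt0. Qed.

Lemma eps_powR_gt0 (e : E) (a : R) : 0 < sval e `^ a.
Proof. by rewrite eps_powR expR_gt0. Qed.

Lemma eps_powRD (e : E) (a b : R) : sval e `^ (a + b) = sval e `^ a * sval e `^ b.
Proof. by rewrite !eps_powR mulrDl expRD. Qed.

Lemma eps_powRN (e : E) (a : R) : sval e `^ (- a) = (sval e `^ a)^-1.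
Proof. by rewrite !eps_powR mulNr expRN. Qed.

Lemma eps_powRX (e : E) (a : R) n : (sval e `^ a) ^+ n = sval e `^ (a * n%:R).
Proof. by rewrite !eps_powR -expRM_natr mulrAC. Qed.

Lemma eps_powR_le (e : E) (a b : R) : a <= b -> sval e `^ b <= sval e `^ a.
Proof.
move=> ab; rewrite !eps_powR ler_expR ler_wnM2r//.
by rewrite ln_le0// eps_le1.
Qed.

Lemma near_const_le (c t : R) : 0 < t -> near_eps (fun e => c <= sval e `^ (- t)).
Proof.
move=> t0; apply/near_epsP; exists (expR (- (`|c| / t))); first exact: expR_gt0.
move=> e; rewrite -ler_ln ?posrE ?expR_gt0 ?eps_gt0// expRK => H.
rewrite eps_powR mulNr; apply: le_trans (ler_norm c) _.
apply: le_trans (_ : 1 + - (t * ln (sval e)) <= _); last exact: expR_ge1Dx.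
have : t * ln (sval e) <= - `|c|.
  by rewrite mulrC -ler_pdivlMr// mulNr.
by clear; lra.
Qed.

(** Constants in the estimates are absorbed in this way, at the price of an arbitrarily small loss
    in the exponent. *)
Lemma near_mul_eps_le (c a b : R) : b < a ->
  near_eps (fun e => c * sval e `^ a <= sval e `^ b).
Proof.
move=> ba; have ab : 0 < a - b by rewrite subr_gt0.
apply: filterS (near_const_le c ab) => e H.
have -> : sval e `^ b = sval e `^ (- (a - b)) * sval e `^ a.
  by rewrite -eps_powRD opprB subrK.
by rewrite ler_wpM2r// ltW// eps_powR_gt0.
Qed.

End NetPrinciples.

(** * The multiplier estimate in powers of epsilon *)

Section Asymptotics.
Variables (R : realType) (d : nat).
Local Notation Rd := 'rV[R]_d.
Local Notation E := (eps_index R).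
Local Notation near_eps P := (\forall e \near @small_eps R, P e).
Implicit Types (f g th w : Rd -> R[i]).

Lemma dbound_axis_dist l h0 C f (x : Rd) i (t : R) : (0 < l)%N -> dbound l h0 C f ->
  `|t| <= h0 -> Normc.normc (f (x + t *: delta_mx 0 i) - f x) <= C * `|t|.
Proof.
move=> l0 db th; have [t0|t0|->] := ltgtP t 0.
- have := db i 1%N (x + t *: delta_mx 0 i) (- t) l0; rewrite oppr_gt0 => /(_ t0).
  rewrite ltr0_norm// in th *; move=> /(_ th); rewrite expr1 /= /fdiff scaleNr addrK.
  by rewrite normcB.
- have := db i 1%N x t l0 t0; rewrite gtr0_norm// in th *; move=> /(_ th).
  by rewrite expr1.
- by rewrite scale0r addr0 subrr Normc.normc0 normr0 mulr0.
Qed.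

(** A path from [x] to [y] that changes one coordinate at a time reduces the claim to [d]
    first-order differences. *)
Lemma dbound_cunif_cont l h0 C f : (0 < l)%N -> 0 < h0 -> dbound l h0 C f -> cunif_cont f.
Proof.
move=> l0 h00 db e e0.
have C0 : 0 <= `|C| * d%:R by rewrite mulr_ge0.
have [e' e'0 E'] := eps_le_div C0 e0.
exists (Num.min e' h0); first by rewrite lt_min e'0.
move=> x y; rewrite le_min => /andP[xye xyh].
pose z k : Rd := \row_i (if (i < k)%N then y 0 i else x 0 i).
have step (k : 'I_d) : Normc.normc (f (z k.+1) - f (z k)) <= `|C| * e'.
  have -> : z k.+1 = z k + (y 0 k - x 0 k) *: delta_mx 0 k.
    apply/rowP => i; rewrite axis_entry; case: eqP => [->|/eqP ik]; rewrite !mxE ltnS.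
      by rewrite leqnn ltnn addrC subrK.
    by rewrite leq_eqVlt -val_eqE /= in ik *; rewrite (negPf ik).
  have tk : `|y 0 k - x 0 k| <= `|x - y|.
    by rewrite distrC; have := entry_le_norm (x - y) k; rewrite !mxE.
  apply: le_trans (dbound_axis_dist (z k) k l0 db (le_trans tk xyh)) _.
  apply: le_trans (_ : `|C| * `|y 0 k - x 0 k| <= _); first by rewrite ler_wpM2r// ler_norm.
  by rewrite ler_wpM2l// (le_trans tk).
have z0 : z 0%N = x by apply/rowP => i; rewrite mxE.
have zd : z d = y by apply/rowP => i; rewrite mxE ltn_ord.
have -> : f x - f y = - (\sum_(k < d) (f (z k.+1) - f (z k))).
  rewrite -(big_mkord xpredT (fun k => f (z k.+1) - f (z k))) telescope_sumr//.
  by rewrite z0 zd opprB.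
rewrite normc_opp; apply: le_trans (normc_sum _ _ _) _.
apply: le_trans (ler_sum _ (fun k _ => step k)) _.
by rewrite sumr_const card_ord -[_ *+ _]mulr_natr mulrAC.
Qed.

Lemma dbound_le l h0 C D f : C <= D -> dbound l h0 C f -> dbound l h0 D f.
Proof.
move=> CD db i p x h pl h_gt0 hh; apply: le_trans (db i p x h pl h_gt0 hh) _.
by rewrite ler_wpM2r// exprn_ge0// ltW.
Qed.

(** [l] and [m] come from [d], [N], [n] and [a], and one threshold for [e] serves all [th], [w] and
    [xi]. The scale of [th] may therefore be chosen after [l], as long as its differences cost at
    most [eps ^ -1]. *)
Lemma asym_bound (M : R) (N n : nat) (a : R) : (0 < d)%N -> 0 < M -> 0 < a ->
  exists l m : nat, near_eps (fun e => forall th w (h0 : R) (xi : Rd),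
    0 < h0 -> supp_in M th -> dbound l h0 (sval e `^ (- 1)) th ->
    cc M w -> (forall x, Normc.normc (w x) <= sval e `^ (- N%:R)) ->
    (forall eta : Rd, `|xi - eta| <= sval e `^ (- a) ->
       Normc.normc (fourier w eta) <= sval e `^ m%:R) ->
    Normc.normc (fourier (fun x => th x * w x) xi) <= sval e `^ n%:R).
Proof.
move=> d0 M0 a0.
(* [a * q >= N + n + 2] beats the growth [eps ^ (- N)] of [w]; the surplus [2] pays for the
   [eps ^ -1] of [th] and for the constants. *)
pose q := (Num.trunc ((N + n + 2)%:R / a)).+1.
have qa : (N + n + 2)%:R <= a * q%:R.
  have q0 : 0 <= (N + n + 2)%:R / a by rewrite divr_ge0// ltW.
  have /andP[_ /ltW] := truncn_itv q0.
  by rewrite -/q ler_pdivrMr// mulrC.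
pose l := (d.*2 + q)%N.
have dl : (d.*2 <= l)%N by rewrite leq_addr.
have l0 : (0 < l)%N by rewrite addn_gt0 orbT.
have [K K0 HK] := fourier_mul_bound d0 M0 dl.
exists l, (n + 2)%N.
have ba : (n%:R : R) < n%:R + 1 by rewrite ltrDl.
apply: filterS (near_mul_eps_le (K *+ 2) ba) => e He th w h0 xi h00 sth db cw wN wb.
have := HK th w h0 (sval e `^ (- 1)) (sval e `^ (- N%:R)) (sval e `^ (n + 2)%:R)
  (sval e `^ (- a)) xi h00 (eps_powR_gt0 _ _) (ltW (eps_powR_gt0 _ _))
  (dbound_cunif_cont l0 h00 db) sth db cw wN wb.
move/le_trans; apply; apply: le_trans He.
rewrite mulrnAl -mulrnAr ler_wpM2l ?(ltW K0)//.
have -> : (sval e `^ (- a))^-1 = sval e `^ a by rewrite eps_powRN invrK.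
rewrite eps_powRX -eps_powRD.
have E1 : sval e `^ (- N%:R + a * (l - d.*2)%:R) <= sval e `^ (n + 2)%:R.
  apply: eps_powR_le; rewrite /l addKn; move: qa; rewrite !natrD; clear; lra.
apply: le_trans (_ : sval e `^ (- 1) * (sval e `^ (n + 2)%:R *+ 2) <= _).
  by rewrite ler_wpM2l ?(ltW (eps_powR_gt0 _ _))// mulr2n lerD2l.
rewrite mulrnAr -eps_powRD (_ : -1 + (n + 2)%:R = n%:R + 1 :> R) ?lexx//.
by rewrite natrD; ring.
Qed.

End Asymptotics.

(** * From generalised points and functions to nets *)

Section Germs.
Variables (R : realType) (d : nat).
Local Notation Rd := 'rV[R]_d.
Local Notation E := (eps_index R).
Local Notation near_eps P := (\forall e \near @small_eps R, P e).
Implicit Types (U V : E -> Rd -> R[i]) (x y : E -> Rd).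

Lemma sle_sabs_rho (z : E -> R[i]) (a : R) : sle (sabs (germ z)) (rho_pow a) <->
  near_eps (fun e => Normc.normc (z e) <= sval e `^ a).
Proof. by rewrite /sle /sabs /rho_pow /rho !smap_germ; exact: srel_germ. Qed.

Lemma sapp_germ U x : sapp (germ U) (germ x) = germ (fun e => U e (x e)).
Proof. exact: smap2_germ. Qed.

Lemma sderiv_germ al U : sderiv al (germ U) = germ (fun e => mderiv al (U e)).
Proof. exact: smap_germ. Qed.

Lemma sfourier_germ U : sfourier (germ U) = germ (fun e => fourier (U e)).
Proof. exact: smap_germ. Qed.

Lemma smul_germ U V : smul (germ U) (germ V) = germ (fun e (t : Rd) => U e t * V e t).
Proof. exact: smap2_germ. Qed.

Lemma smooth_internal_germ U : smooth_internal (germ U) <-> near_eps (fun e => smooth (U e)).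
Proof. exact: internal_set_germ. Qed.

Lemma moderate_deriv_germ al U x : moderate (sapp (sderiv al (germ U)) (germ x)) <->
  exists N : nat, near_eps (fun e => Normc.normc (mderiv al (U e) (x e)) <= sval e `^ (- N%:R)).
Proof.
rewrite sderiv_germ sapp_germ /moderate.
by split=> -[N /sle_sabs_rho H]; exists N.
Qed.

Lemma approxeq0_germ (z : E -> R[i]) : approxeq0 (germ z) <->
  forall n : nat, near_eps (fun e => Normc.normc (z e) <= sval e `^ n%:R).
Proof. by split=> H n; apply/sle_sabs_rho; exact: H. Qed.

Lemma fast_scale_germ x : fast_scale (germ x) <->
  exists2 a : R, 0 < a & near_eps (fun e => sval e `^ (- a) <= enorm (x e)).
Proof.
rewrite /fast_scale /= /sle /snorm /rho_pow /rho !smap_germ.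
split=> -[a a0 H]; exists a => //; first by move: H; rewrite smap_germ => /srel_germ.
by rewrite smap_germ; apply/srel_germ.
Qed.

Lemma near_fast_germ x y : near_fast (germ x) (germ y) <->
  exists2 a : R, 0 < a & near_eps (fun e => enorm (x e - y e) <= sval e `^ a).
Proof.
rewrite /near_fast /sle /sdist /rho_pow /rho smap2_germ.
split=> -[a a0 H]; exists a => //; first by move: H; rewrite smap_germ => /srel_germ.
by rewrite smap_germ; apply/srel_germ.
Qed.

Lemma sball_germ x (x0 : Rd) r : sball (sconst R x0) r (germ x) <->
  near_eps (fun e => enorm (x e - x0) < r).
Proof. by rewrite /sball /= /slt /sdist /sconst smap2_germ; exact: srel_germ. Qed.

Lemma sdist_const_le_germ x (x0 : Rd) r : sle (sdist (germ x) (sconst R x0)) (sconst R r) <->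
  near_eps (fun e => enorm (x e - x0) <= r).
Proof. by rewrite /sle /sdist /sconst smap2_germ; exact: srel_germ. Qed.

Lemma star_set_germ (T : choiceType) (A : set T) (x : E -> T) :
  star_set R A (germ x) <-> near_eps (fun e => A (x e)).
Proof. exact: internal_set_germ. Qed.

Lemma star_c_germ (Omega K : set Rd) x : compact K -> K `<=` Omega ->
  near_eps (fun e => K (x e)) -> star_c Omega (germ x).
Proof.
move=> cK KO nK; exists K; split=> //; last exact/star_set_germ.
apply: contrapT => nK0.
have /near_epsP[e0 e00 He] := nK.
have h : 0 < Num.min e0 1 <= 1 by rewrite lt_min e00 ltr01 ge_min lexx orbT.
apply: nK0; exists (x (exist (fun e : R => 0 < e <= 1) _ h)); apply: He.
by rewrite /= ge_min lexx.
Qed.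

Lemma star_c_bounded (Omega : set Rd) x : star_c Omega (germ x) ->
  exists N : nat, near_eps (fun e => `|x e| <= N%:R).
Proof.
move=> [K [cK _ _ /star_set_germ nK]].
have [B [_ HB]] := compact_bounded cK.
exists (Num.trunc (`|B| + 1)).+1; apply: filterS nK => e Kx.
have B1 : B < `|B| + 1 by rewrite (le_lt_trans (ler_norm _))// ltrDl.
apply: le_trans (HB _ B1 _ Kx) _.
have b0 : 0 <= `|B| + 1 by rewrite addr_ge0.
by have /andP[_ /ltW] := truncn_itv b0.
Qed.

End Germs.

Section UniformBounds.
Variables (R : realType) (d : nat) (Omega : set 'rV[R]_d).
Hypothesis d_gt0 : (0 < d)%N.
Local Notation Rd := 'rV[R]_d.
Local Notation E := (eps_index R).
Local Notation near_eps P := (\forall e \near @small_eps R, P e).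
Implicit Types (U V : E -> Rd -> R[i]) (Ke : E -> set Rd).

Lemma mderiv0 (f : Rd -> R[i]) : mderiv (fun=> 0%N) f = f.
Proof.
rewrite /mderiv (_ : flatten _ = [::])//.
by elim: (enum _) => [//|i s IH] /=.
Qed.

Lemma exists_large (r : R) : exists x : Rd, r < `|x|.
Proof.
exists (const_mx (`|r| + 1)); apply: lt_le_trans (entry_le_norm _ (Ordinal d_gt0)).
rewrite mxE ger0_norm ?addr_ge0//; apply: le_lt_trans (ler_norm r) _.
by rewrite ltrDl.
Qed.

Lemma near_bounded_support Ke : near_eps (fun e => Ke e !=set0) ->
  (forall x, near_eps (fun e => Ke e (x e)) -> star_c Omega (germ x)) ->
  exists N : nat, near_eps (fun e => forall x, Ke e x -> `|x| <= N%:R).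
Proof.
move=> ne sK.
have [N HN] := uniform_witness (Q := fun N m e x => `|x| <= N%:R) ne
  (fun x nx => let: ex_intro N H := star_c_bounded (sK x nx) in ex_intro _ N (fun=> H)).
by exists N; exact: (HN 0%N).
Qed.

(** Passes from vanishing at generalised points to vanishing of [V e] off [Ke e] for small [e]. A
    net staying outside [Ke] has positive distance from every point of [K], so [internal_forall]
    applies. *)
Lemma compact_support_rep V : compactly_supported_in (star_c Omega) (germ V) ->
  exists Ke, [/\ near_eps (fun e => Ke e !=set0),
    forall x, near_eps (fun e => Ke e (x e)) -> star_c Omega (germ x) &
    near_eps (fun e => forall x, ~ Ke e x -> V e x = 0)].
Proof.
move=> [K [[Ke nKe KE] sub V0]]; exists Ke.
have ne : near_eps (fun e => Ke e !=set0) by apply: filterS nKe => e [].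
have sK x : near_eps (fun e => Ke e (x e)) -> star_c Omega (germ x).
  by move=> nx; apply: sub; rewrite KE; apply/internal_set_germ.
split=> //; have [N HN] := near_bounded_support ne sK.
apply: (internal_forall (A := fun e x => ~ Ke e x)) => [|x nx].
  (* The complement of [Ke e] is nonempty because [Ke e] is bounded and the dimension is
     positive. *)
  apply: filterS HN => e He; have [x xN] := exists_large N%:R.
  by exists x => /He; rewrite leNgt xN.
have := V0 (germ x); rewrite sapp_germ /sconst => H; apply/germP; apply: H => a Ka.
rewrite -(repK a) /sdist smap2_germ /slt; apply/srel_germ.
rewrite KE in Ka; apply: filterS2 nx Ka => e nKx Kax.
rewrite lt_neqAle enorm_ge0 andbT eq_sym; apply/eqP => /enorm_eq0/eqP.
by rewrite subr_eq0 => /eqP xa; apply: nKx; rewrite xa.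
Qed.

(** The exponent in moderateness depends on the point; [uniform_witness], with a [Q] constant in
    [m], makes it uniform over [Ke]. *)
Lemma M_space_uniform U Ke al : M_space (star_c Omega) (germ U) ->
  near_eps (fun e => Ke e !=set0) ->
  (forall x, near_eps (fun e => Ke e (x e)) -> star_c Omega (germ x)) ->
  exists N : nat, near_eps (fun e => forall x, Ke e x ->
    Normc.normc (mderiv al (U e) x) <= sval e `^ (- N%:R)).
Proof.
move=> [_ mU] ne sK.
have H x : near_eps (fun e => Ke e (x e)) -> exists N, forall m : nat,
    near_eps (fun e => Normc.normc (mderiv al (U e) (x e)) <= sval e `^ (- N%:R)).
  by move=> nx; have /moderate_deriv_germ[N HN] := mU al (germ x) (sK x nx); exists N.
have [N HN] := uniform_witness (Q := fun N m e x =>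
  Normc.normc (mderiv al (U e) x) <= sval e `^ (- N%:R)) ne H.
by exists N; exact: (HN 0%N).
Qed.

Lemma M_space_uniform_compact U (K : set Rd) al : M_space (star_c Omega) (germ U) ->
  compact K -> K `<=` Omega ->
  exists N : nat, near_eps (fun e => forall x, K x ->
    Normc.normc (mderiv al (U e) x) <= sval e `^ (- N%:R)).
Proof.
move=> mU cK KO; have [K0|K0] := pselect (K !=set0).
  apply: (M_space_uniform al mU (Ke := fun=> K)) => [|x nx]; first exact: nearW.
  exact: star_c_germ cK KO nx.
by exists 0%N; apply: nearW => e x Kx; exfalso; apply: K0; exists x.
Qed.

Lemma M_space_all_uniform V al : M_space setT (germ V) ->
  exists N : nat, near_eps (fun e => forall x,
    Normc.normc (mderiv al (V e) x) <= sval e `^ (- N%:R)).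
Proof.
move=> [_ mV].
have H x : near_eps (fun e => True) -> exists N, forall m : nat,
    near_eps (fun e => Normc.normc (mderiv al (V e) (x e)) <= sval e `^ (- N%:R)).
  by move=> _; have /moderate_deriv_germ[N HN] := mV al (germ x) I; exists N.
have ne : near_eps (fun e => exists t : Rd, True) by apply: nearW => e; exists 0.
have [N HN] := uniform_witness (A := fun _ _ => True) (Q := fun N m e x =>
  Normc.normc (mderiv al (V e) x) <= sval e `^ (- N%:R)) ne H.
by exists N; apply: filterS (HN 0%N) => e He x; exact: He.
Qed.

Lemma eps_powRN_nat_le (e : E) (m n : nat) : (m <= n)%N ->
  sval e `^ (- m%:R) <= sval e `^ (- n%:R).
Proof. by move=> mn; apply: eps_powR_le; rewrite lerN2 ler_nat. Qed.

(** What [asym_bound] asks of its factor [w], with one number for support and growth. The radius is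
    [N.+1] because [supp_in] demands vanishing on the boundary of the cube too, while supports are
    only known to lie in the closed cube of radius [N]. *)
Definition tame (N : nat) (e : E) (f : Rd -> R[i]) :=
  cc N.+1%:R f /\ forall x, Normc.normc (f x) <= sval e `^ (- N%:R).

Lemma Mc_tame V : Mc_space (star_c Omega) (germ V) ->
  exists N : nat, near_eps (fun e => tame N e (V e)).
Proof.
move=> [mV cV]; have [Ke [ne sK V0]] := compact_support_rep cV.
have [N1 H1] := near_bounded_support ne sK.
have [N2 H2] := M_space_all_uniform (fun=> 0%N) mV.
exists (maxn N1 N2); have /smooth_internal_germ sV := mV.1.
near=> e; split; last first.
  move=> x; have := near H2 e; rewrite mderiv0 => H.
  by apply: le_trans (H _ x) (eps_powRN_nat_le e (leq_maxr _ _)).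
apply: ccont_cc; first by apply: (smooth_ccont [::]); near: e.
move=> x Nx; apply: (near V0 e) => // Kx.
have := near H1 e _ x Kx; rewrite leNgt => /(_ _)/negP; apply => //.
by apply: lt_le_trans Nx; rewrite ltr_nat ltnS leq_maxl.
Unshelve. all: end_near. Qed.

(** [U] is controlled only at points of [star_c Omega], which is enough since [V] vanishes off
    [Ke]. *)
Lemma Mc_mul_tame V U : Mc_space (star_c Omega) (germ V) ->
  M_space (star_c Omega) (germ U) ->
  exists N : nat, near_eps (fun e => tame N e (fun x => V e x * U e x)).
Proof.
move=> [mV cV] mU; have [Ke [ne sK V0]] := compact_support_rep cV.
have [N1 H1] := near_bounded_support ne sK.
have [N2 H2] := M_space_all_uniform (fun=> 0%N) mV.
have [N3 H3] := M_space_uniform (fun=> 0%N) mU ne sK.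
exists (maxn N1 (N2 + N3)).
have /smooth_internal_germ sV := mV.1; have /smooth_internal_germ sU := mU.1.
near=> e; split; last first.
  move=> x; have [Kx|nKx] := pselect (Ke e x); last first.
    by rewrite (near V0 e)// mul0r Normc.normc0 ltW// eps_powR_gt0.
  apply: le_trans (_ : sval e `^ (- (N2 + N3)%:R) <= _); last first.
    exact: eps_powRN_nat_le (leq_maxr _ _).
  rewrite natrD opprD eps_powRD Normc.normcM ler_pM ?normc_ge0//.
    have := near H2 e; rewrite mderiv0; exact.
  have := near H3 e; rewrite mderiv0 => H; exact: H.
apply: ccont_cc.
  by apply: ccontM; apply: (smooth_ccont [::]); near: e.
move=> x Nx; rewrite (near V0 e) ?mul0r// => Kx.
have := near H1 e _ x Kx; rewrite leNgt => /(_ _)/negP; apply => //.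
by apply: lt_le_trans Nx; rewrite ltr_nat ltnS leq_maxl.
Unshelve. all: end_near. Qed.

End UniformBounds.

(** * Test functions, cutoffs and shifts of direction *)

Section TestFunctions.
Variables (R : realType) (d : nat) (Omega : set 'rV[R]_d).
Local Notation Rd := 'rV[R]_d.
Local Notation E := (eps_index R).
Local Notation near_eps P := (\forall e \near @small_eps R, P e).
Implicit Types (psi : Rd -> R[i]) (U V : E -> Rd -> R[i]).

Definition csupport psi : set Rd := closure [set x | psi x != 0].

Lemma test_deriv_zero psi s x : ~ csupport psi x -> iter_pderiv s psi x = 0.
Proof.
move=> nx; apply: (@iter_pderiv_zero_on _ _ (~` csupport psi)) => //.
  by apply: closed_openC; exact: closed_closure.
by move=> y ny; apply: contrapT => /eqP py; apply: ny; exact: subset_closure.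
Qed.

Lemma test_deriv_bound psi s : smooth psi -> compact (csupport psi) ->
  exists2 C, 0 <= C & forall x, Normc.normc (iter_pderiv s psi x) <= C.
Proof.
move=> sp /compact_bounded[B [_ HB]].
have sup : supp_in (`|B| + 2) (iter_pderiv s psi).
  move=> x Bx; apply: test_deriv_zero => cx.
  have B1 : B < `|B| + 1 by rewrite (le_lt_trans (ler_norm _))// ltrDl.
  have := HB _ B1 _ cx; rewrite /= => xB; move: (le_trans Bx xB); clear; lra.
by have [_ _] := ccont_cc (smooth_ccont s sp) sup.
Qed.

Lemma compactly_supported_const (K0 : set Rd) V : compact K0 -> K0 !=set0 -> K0 `<=` Omega ->
  near_eps (fun e => forall x, ~ K0 x -> V e x = 0) ->
  compactly_supported_in (star_c Omega) (germ V).
Proof.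
move=> cK [x1 Kx1] KO V0; exists (internal_set (fun=> K0)); split.
- by exists (fun=> K0) => //; apply: nearW => e; split => //; exists x1.
- by move=> a; rewrite -(repK a) => /internal_set_germ; exact: star_c_germ.
- move=> x; rewrite -(repK x) => H; rewrite sapp_germ /sconst; apply/germP.
  (* The net [a] agrees with [x] inside [K0]; a positive distance between the two therefore forces
     [x] out of [K0]. *)
  pose a e := if pselect (K0 (rep x e)) then rep x e else x1.
  have Ka : internal_set (fun=> K0) (germ a).
    by apply/internal_set_germ; apply: nearW => e; rewrite /a; case: pselect.
  have := H _ Ka; rewrite /slt /sdist smap2_germ /sconst => /srel_germ.
  apply: filterS2 V0 => e Ve; rewrite /a; case: pselect => [Kx|nKx _]; last exact: Ve.
  by rewrite subrr enorm0 ltxx.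
Qed.

Definition uniformly_moderate (F : E -> Rd -> R[i]) := exists N : nat,
  near_eps (fun e => forall x, Normc.normc (F e x) <= sval e `^ (- N%:R)).

Lemma uniformly_moderateD F G : uniformly_moderate F -> uniformly_moderate G ->
  uniformly_moderate (fun e x => F e x + G e x).
Proof.
move=> [N HN] [M HM]; exists (N + M).+1.
have lt1 : - (N + M).+1%:R < - (N + M)%:R :> R by rewrite ltrN2 ltr_nat.
apply: filterS3 HN HM (near_mul_eps_le 2 lt1) => e a b c x.
apply: le_trans (normcD _ _) _; apply: le_trans c; rewrite mulr_natl mulr2n lerD//.
  exact: le_trans (a x) (eps_powRN_nat_le e (leq_addr _ _)).
exact: le_trans (b x) (eps_powRN_nat_le e (leq_addl _ _)).
Qed.

(** Each Leibniz term needs a bound for [U] only on the support of [psi], a compact subset of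
    [Omega]; elsewhere the derivatives of [psi] vanish. *)
Lemma test_mul_moderate psi U al : smooth psi -> compact (csupport psi) ->
  csupport psi `<=` Omega -> M_space (star_c Omega) (germ U) ->
  uniformly_moderate (fun e => mderiv al (fun x => psi x * U e x)).
Proof.
move=> sp cp sO mU; set s := flatten [seq nseq (al i) i | i <- enum 'I_d].
have /smooth_internal_germ sU := mU.1.
have [N HN] : uniformly_moderate (fun e x => \sum_(q <- leibniz_terms s)
    iter_pderiv q.1 psi x * iter_pderiv q.2 (U e) x).
  have: all (fun q => subseq q.2 s) (leibniz_terms s).
    by apply/allP => q /leibniz_terms_subseq[].
  elim: (leibniz_terms s) => [_|q L IH /= /andP[qs aL]].
    exists 0%N; apply: nearW => e x; rewrite big_nil Normc.normc0 ltW//.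
    exact: eps_powR_gt0.
  have [N HN] : uniformly_moderate (fun e x => iter_pderiv q.1 psi x * iter_pderiv q.2 (U e) x +
      \sum_(q <- L) iter_pderiv q.1 psi x * iter_pderiv q.2 (U e) x).
    apply: uniformly_moderateD; last exact: IH.
    have [C C0 HC] := test_deriv_bound q.1 sp cp.
    have [be Ebe] := subseq_mderiv R qs.
    have [N HN] := M_space_uniform_compact be mU cp sO.
    exists N.+1; have lt1 : - N.+1%:R < - N%:R :> R by rewrite ltrN2 ltr_nat.
    apply: filterS2 HN (near_mul_eps_le C lt1) => e a b x.
    have [cx|ncx] := pselect (csupport psi x); last first.
      by rewrite test_deriv_zero// mul0r Normc.normc0 ltW// eps_powR_gt0.
    by rewrite Normc.normcM Ebe (le_trans _ b)// ler_pM ?normc_ge0// a.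
  by exists N; apply: filterS HN => e H x; rewrite big_cons; exact: H.
exists N; apply: filterS2 sU HN => e sUe H x.
by rewrite /mderiv -/s (iter_pderivM s sp sUe); exact: H.
Qed.

Lemma test_mul_Mc psi U : test_function Omega psi -> csupport psi !=set0 ->
  M_space (star_c Omega) (germ U) ->
  Mc_space (star_c Omega) (germ (fun e x => psi x * U e x)).
Proof.
move=> [sp cp sO] ne mU; have /smooth_internal_germ sU := mU.1.
split; last first.
  apply: (compactly_supported_const cp ne sO); apply: nearW => e x nx.
  have z : psi x = 0 := @test_deriv_zero psi [::] x nx.
  by rewrite z mul0r.
split; first by apply/smooth_internal_germ; apply: filterS sU => e; exact: smoothM.
move=> al x _; rewrite -(repK x); apply/moderate_deriv_germ.
have [N HN] := test_mul_moderate al sp cp sO mU.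
by exists N; apply: filterS HN => e H; exact: H.
Qed.

End TestFunctions.

Section Cutoff.
Variables (R : realType) (d : nat).
Hypothesis d_gt0 : (0 < d)%N.
Local Notation Rd := 'rV[R]_d.

Definition cutoff (x0 : Rd) (de : R) : Rd -> R[i] :=
  tensor (fun i t => plateau (de^-1 * t + - de^-1 * x0 0 i)).

Variables (x0 : Rd) (de : R).
Hypothesis de_gt0 : 0 < de.

Lemma smooth_cutoff : smooth (cutoff x0 de).
Proof.
by apply: smooth_tensor => i n; apply: smooth1n_affine; exact: smooth1_plateau.
Qed.

Lemma cutoff_arg (x : Rd) i : `|de^-1 * x 0 i + - de^-1 * x0 0 i| = `|(x - x0) 0 i| / de.
Proof.
by rewrite !mxE mulNr -mulrBr normrM gtr0_norm ?invr_gt0// mulrC.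
Qed.

Lemma cutoff1 x : `|x - x0| <= de -> cutoff x0 de x = 1.
Proof.
move=> xd; rewrite /cutoff /tensor big1// => i _; apply: plateau1.
by rewrite cutoff_arg ler_pdivrMr// mul1r (le_trans (entry_le_norm _ _)).
Qed.

Lemma cutoff0 x : de *+ 2 <= `|x - x0| -> cutoff x0 de x = 0.
Proof.
move=> xd; have [i xi] : exists i, de *+ 2 <= `|(x - x0) 0 i|.
  apply: contrapT => /forallNP H; move: xd; rewrite leNgt => /negP; apply.
  apply: norm_lt_entry => [|i]; first by rewrite pmulrn_lgt0.
  by rewrite ltNge; apply/negP; exact: H.
rewrite /cutoff /tensor (bigD1 i) //= plateau0 ?mul0r//.
by rewrite cutoff_arg ler_pdivlMr// mulr_natl.
Qed.

Lemma csupport_cutoff : csupport (cutoff x0 de) `<=` [set x | `|x - x0| <= de *+ 2].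
Proof.
apply: (@subset_trans _ (closure [set x : Rd | `|x - x0| <= de *+ 2])).
  apply: closure_subset => x /= /eqP cx; rewrite leNgt; apply/negP => /ltW.
  by move/cutoff0.
by have <- := (closure_id _).1 (@closed_norm_le R d x0 (de *+ 2)).
Qed.

Lemma compact_csupport_cutoff : compact (csupport (cutoff x0 de)).
Proof.
apply: subclosed_compact csupport_cutoff.
  exact: closed_closure.
exact: compact_norm_sub_le.
Qed.

Lemma csupport_cutoff_neq0 : csupport (cutoff x0 de) !=set0.
Proof.
exists x0; apply: subset_closure; rewrite /= cutoff1 ?oner_neq0//.
by rewrite subrr normr0 ltW.
Qed.

Lemma test_function_cutoff Omega : [set x | `|x - x0| <= de *+ 2] `<=` Omega ->
  test_function Omega (cutoff x0 de).
Proof.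
move=> cO; split; first exact: smooth_cutoff.
- exact: compact_csupport_cutoff.
- by apply: subset_trans cO; exact: csupport_cutoff.
Qed.

Lemma dbound_cutoff l h0 : exists2 C, 1 <= C & dbound l h0 C (cutoff x0 de).
Proof.
have Q0 (i : 'I_d) (t : R) : (`|x0| + de) *+ 2 < `|t| ->
    plateau (de^-1 * t + - de^-1 * x0 0 i) = 0.
  move=> tt; apply: plateau0; rewrite mulNr -mulrBr normrM gtr0_norm ?invr_gt0//.
  rewrite mulrC ler_pdivlMr// mulr_natl.
  have := lerB_dist t (x0 0 i); have := entry_le_norm x0 i; have := normr_ge0 x0.
  by move: tt; rewrite !mulr2n; move: (`|x0|) (`|x0 0 i|) (`|t|) => u v w; clear; lra.
have [C HC1 HC2] : exists2 C, 1 <= C & forall i, rbound l C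
    (fun t => plateau (de^-1 * t + - de^-1 * x0 0 i)).
  suff : forall r : seq 'I_d, exists2 C, 1 <= C & forall i, i \in r ->
      rbound l C (fun t => plateau (de^-1 * t + - de^-1 * x0 0 i)).
    by move=> /(_ (enum 'I_d))[C C1 H]; exists C => // i; apply: H; rewrite mem_enum.
  elim=> [|i r [C C1 IH]]; first by exists 1.
  have sm : smooth1 (fun t : R => plateau (de^-1 * t + - de^-1 * x0 0 i)).
    by move=> n; apply: smooth1n_affine; exact: smooth1_plateau.
  have [D D1 HD] := smooth1_rbound l sm (Q0 i).
  exists (C + D); first by rewrite (le_trans C1)// lerDl (le_trans ler01).
  move=> j; rewrite inE => /orP[/eqP -> p h t pl h0'|jr p h t pl h0'].
    apply: le_trans (HD p h t pl h0') _; rewrite ler_wpM2r ?exprn_ge0 ?ltW//.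
    by rewrite ltrDr (lt_le_trans ltr01).
  apply: le_trans (IH j jr p h t pl h0') _; rewrite ler_wpM2r ?exprn_ge0 ?ltW//.
  by rewrite ltrDl (lt_le_trans ltr01).
exists (C ^+ d); first by rewrite exprn_ege1.
exact: dbound_tensor.
Qed.

End Cutoff.

Section ShiftDirection.
Variables (R : realType) (d : nat).
Local Notation Rd := 'rV[R]_d.
Local Notation E := (eps_index R).
Local Notation near_eps P := (\forall e \near @small_eps R, P e).

Lemma enorm_gt0_neq0 (x : Rd) : 0 < enorm x -> x != 0.
Proof. by apply: contraTneq => ->; rewrite enorm0 ltxx. Qed.

Lemma near_eps_powR_le (c t : R) : 0 < c -> 0 < t -> near_eps (fun e => sval e `^ t <= c).
Proof.
move=> c0 t0; apply: filterS (near_const_le c^-1 t0) => e.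
by rewrite eps_powRN lef_pV2 ?posrE ?eps_powR_gt0.
Qed.

(** The shift has relative size [eps ^ (a / 2)], so the frequency stays fast scale and its direction
    turns by the same order. *)
Lemma near_shift (a : R) : 0 < a -> near_eps (fun e => forall eta ze : Rd,
  sval e `^ (- a) <= enorm eta -> `|eta - ze| <= sval e `^ (- (a / 2)) ->
  sval e `^ (- (a / 2)) <= enorm ze /\
  `|unit_dir ze - unit_dir eta| <= d.+1%:R * sval e `^ (a / 2)).
Proof.
move=> a0; have lt1 : - a < - (a / 2) by rewrite ltrN2 ltr_pdivrMr// ltr_pMr// ltr1n.
apply: filterS (near_mul_eps_le d.+1%:R lt1) => e He eta ze ea ez.
have z1 : sval e `^ (- (a / 2)) <= enorm ze.
  have := enorm_dist eta ze; rewrite ler_norml => /andP[_ H].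
  have H2 : d%:R * `|eta - ze| <= d%:R * sval e `^ (- (a / 2)) by rewrite ler_wpM2l.
  move: He; rewrite -natr1 mulrDl mul1r => He.
  by move: H H2 He ea; clear; lra.
split=> //.
have e0 : 0 < enorm eta by rewrite (lt_le_trans _ ea)// eps_powR_gt0.
have ze0 : 0 < enorm ze by rewrite (lt_le_trans _ z1)// eps_powR_gt0.
rewrite distrC; apply: le_trans (unit_dir_dist (enorm_gt0_neq0 e0) (enorm_gt0_neq0 ze0)) _.
rewrite -mulrA ler_wpM2l//.
have -> : sval e `^ (a / 2) = sval e `^ (- (a / 2)) * (sval e `^ (- a))^-1.
  by rewrite -eps_powRN opprK -eps_powRD; congr (_ `^ _); field.
by rewrite ler_pM ?invr_ge0 ?enorm_ge0// lef_pV2 ?posrE// eps_powR_gt0.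
Qed.

End ShiftDirection.

(** * Elliptic multipliers give microlocal regularity *)

Section EllipticToRegular.
Variables (R : realType) (d : nat) (Omega : set 'rV[R]_d).
Hypothesis d_gt0 : (0 < d)%N.
Local Notation Rd := 'rV[R]_d.
Local Notation E := (eps_index R).
Local Notation near_eps P := (\forall e \near @small_eps R, P e).
Variables (U Phi : E -> Rd -> R[i]) (S : E -> R) (x0 xi0 : Rd) (r : R).
Hypotheses (mU : M_space (star_c Omega) (germ U)) (xi1 : enorm xi0 = 1) (r_gt0 : 0 < r).
Hypothesis cPhi : Mc_space (star_c Omega) (germ Phi).
Hypothesis S_gt0 : near_eps (fun e => 0 < S e).
Hypothesis S_slow : forall a, 0 < a -> near_eps (fun e => `|S e| <= sval e `^ (- a)).
Hypothesis Phi_le : forall al x, near_eps (fun e => enorm (x e - x0) < r) ->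
  near_eps (fun e => Normc.normc (mderiv al (Phi e) (x e)) <= S e).
Hypothesis Phi_ge : forall x, near_eps (fun e => enorm (x e - x0) < r) ->
  near_eps (fun e => (S e)^-1 <= Normc.normc (Phi e (x e))).
Hypothesis decay : forall (xi : E -> Rd) (a : R) (n : nat), 0 < a ->
  near_eps (fun e => sval e `^ (- a) <= enorm (xi e)) ->
  near_eps (fun e => enorm (unit_dir (xi e) - xi0) <= r) ->
  near_eps (fun e => Normc.normc (fourier (fun x => Phi e x * U e x) (xi e)) <= sval e `^ n%:R).

Lemma uniform_Phi_le al : near_eps (fun e => forall x, enorm (x - x0) < r ->
  Normc.normc (mderiv al (Phi e) x) <= S e).
Proof.
apply: (internal_forall (A := fun e x => enorm (x - x0) < r)); last exact: Phi_le.
by apply: nearW => e; exists x0; rewrite subrr enorm0.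
Qed.

Lemma uniform_Phi_ge : near_eps (fun e => forall x, enorm (x - x0) < r ->
  (S e)^-1 <= Normc.normc (Phi e x)).
Proof.
apply: (internal_forall (A := fun e x => enorm (x - x0) < r)); last exact: Phi_ge.
by apply: nearW => e; exists x0; rewrite subrr enorm0.
Qed.

Lemma uniform_decay (a : R) (n : nat) : 0 < a -> near_eps (fun e => forall xi,
  sval e `^ (- a) <= enorm xi /\ enorm (unit_dir xi - xi0) <= r ->
  Normc.normc (fourier (fun x => Phi e x * U e x) xi) <= sval e `^ n%:R).
Proof.
move=> a0; apply: (internal_forall (A := fun e xi =>
  sval e `^ (- a) <= enorm xi /\ enorm (unit_dir xi - xi0) <= r)).
  apply: nearW => e; exists (sval e `^ (- a) *: xi0).
  rewrite enormZ xi1 mulr1 unit_dirZ ?eps_powR_gt0// unit_dir_sphere// subrr enorm0.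
  by rewrite ler_norm ltW.
by move=> xi H; apply: (decay n a0); apply: filterS H => e [].
Qed.

(** At [x0] itself, [1 / S <= |Phi| <= S]. *)
Lemma S_ge1 : near_eps (fun e => 1 <= S e).
Proof.
apply: filterS3 S_gt0 (uniform_Phi_le (fun=> 0%N)) uniform_Phi_ge => e S0 a b.
have xr : enorm (x0 - x0) < r by rewrite subrr enorm0.
have := le_trans (b _ xr) _; have := a _ xr; rewrite mderiv0 => h /(_ _ h).
rewrite leNgt => H; rewrite leNgt; apply/negP => S1; move/negP: H; apply.
by apply: (lt_trans S1); rewrite invf_gt1.
Qed.

(** Here slow scale is used: the fixed power [S ^ c] stays below [eps ^ (- 1 / 2)], and the other
    half power of [eps] absorbs the constants. *)
Lemma elliptic_dbound (de : R) l h0 C : 0 < de -> d%:R * (de *+ 4) < r ->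
  l%:R * h0 *+ 2 <= de *+ 2 -> dbound l h0 C (cutoff x0 de) -> 0 < h0 ->
  near_eps (fun e => dbound l h0 (sval e `^ (- 1)) (fun x => cutoff x0 de x * (Phi e x)^-1)).
Proof.
move=> de0 der lh dC h00.
have [K [c [K1 HQ]]] := dbound_quotient R d l.
(* Chosen so that [t * c <= 1 / 2]; the successor keeps [t] meaningful for [c = 0]. *)
pose t : R := (c.+1%:R *+ 2)^-1.
have t0 : 0 < t by rewrite invr_gt0 pmulrn_lgt0.
have tc : t * c%:R <= 1 / 2.
  rewrite /t -[_ *+ 2]mulr_natr invfM mulrAC ler_pM2r ?invr_gt0// mulrC.
  by rewrite ler_pdivrMr// mul1r ler_nat.
have /smooth_internal_germ sPhi := cPhi.1.1.
have lt1 : - (1 : R) < - (1 / 2) by lra.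
(* A common threshold for [e] exists for finitely many conditions; here they are indexed by an axis
   and an order up to [l]. *)
have nall : near_eps (fun e => forall i (p : nat), (p <= l)%N -> forall x, enorm (x - x0) < r ->
    Normc.normc (iter_pderiv (nseq p i) (Phi e) x) <= S e).
  have H (s : seq ('I_d * nat)) : near_eps (fun e => forall q, q \in s -> forall x, enorm (x - x0) < r ->
      Normc.normc (iter_pderiv (nseq q.2 q.1) (Phi e) x) <= S e).
    elim: s => [|q s IH]; first exact: nearW.
    apply: filterS2 IH (uniform_Phi_le (fun j => if j == q.1 then q.2 else 0%N)) => e a b q'.
    rewrite inE => /orP[/eqP -> x xr|]; last exact: a.
    by have := b x xr; rewrite mderiv_nseq.
  apply: filterS (H [seq (i, p) | i <- enum 'I_d, p <- iota 0 l.+1]) => e He i p pl.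
  by apply: (He (i, p)); apply/allpairsP; exists (i, p); rewrite mem_enum mem_iota.
near=> e.
have Se1 : 1 <= S e by near: e; exact: S_ge1.
have Se0 : 0 < S e by exact: lt_le_trans Se1.
have inb x : `|x - x0| <= de *+ 4 -> enorm (x - x0) < r.
  move=> xd; apply: le_lt_trans (enorm_le_norm _) _; apply: le_lt_trans (der).
  by rewrite ler_wpM2l.
apply: (@dbound_le _ _ _ _ (C * (K * (S e *+ 2) ^+ c))); last first.
  apply: (HQ _ _ x0 _ _ (de *+ 2) (de *+ 4)) => //.
  - by rewrite (le_trans Se1)// mulr2n lerDl ltW.
  - by apply: le_trans lh _; rewrite -mulrnBr.
  - by move=> x xd; apply: cutoff0 => //; exact: ltW.
  - move=> x xd; apply: le_trans (near uniform_Phi_ge e _ x (inb x xd)); last by [].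
    by rewrite lef_pV2 ?posrE ?pmulrn_lgt0// mulr2n lerDl ltW.
  - move=> i x h p pl h_gt0 hh seg; apply: fdiff_le_pderiv => //; first by near: e.
    move=> s ps; apply: (near nall e) => //; exact/inb/seg.
have C0 : 0 <= C by have := dC (Ordinal d_gt0) 0%N x0 h0 isT h00 (lexx _); rewrite expr0 mulr1; apply: le_trans; exact: normc_ge0.
apply: le_trans (_ : C * K * 2 ^+ c * sval e `^ (- (1 / 2)) <= _); last first.
  by near: e; exact: near_mul_eps_le.
rewrite -!mulrA ler_wpM2l// ler_wpM2l ?(le_trans ler01 K1)// -[S e *+ 2]mulr_natl exprMn ler_wpM2l ?exprn_ge0//.
apply: le_trans (_ : (sval e `^ (- t)) ^+ c <= _).
  rewrite lerXn2r ?nnegrE ?(ltW Se0) ?(ltW (eps_powR_gt0 _ _))//.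
  by apply: le_trans (ler_norm _) _; near: e; exact: S_slow.
by rewrite eps_powRX; apply: eps_powR_le; rewrite mulNr lerN2.
Unshelve. all: end_near. Qed.

(** The direction of [eta] is kept within [r / 2] so that the frequencies [ze] seen by the
    multiplier estimate, whose directions differ by [O(eps ^ (a / 2))], stay in the cone where
    [Phi * U] decays. *)
Lemma cutoff_mul_fourier_small (de : R) (eta : E -> Rd) (a : R) (n : nat) :
  0 < de -> d%:R * (de *+ 4) < r -> 0 < a ->
  near_eps (fun e => sval e `^ (- a) <= enorm (eta e)) ->
  near_eps (fun e => d%:R * `|unit_dir (eta e) - xi0| <= r / 2) ->
  near_eps (fun e => Normc.normc (fourier (fun x => cutoff x0 de x * U e x) (eta e)) <=
    sval e `^ n%:R).
Proof.
move=> de0 der a0 aeta deta.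
have [N HN] := Mc_mul_tame d_gt0 cPhi mU.
pose M := N.+1%:R + (`|x0| + de *+ 2).
have M0 : 0 < M by rewrite ltr_wpDr// addr_ge0// mulrn_wge0// ltW.
have a2 : 0 < a / 2 by rewrite divr_gt0.
have [l [m HA]] := asym_bound N n d_gt0 M0 a2.
(* Small enough for [dbound_quotient], whose radii will be [de *+ 2] and [de *+ 4]. *)
pose h0 := de / l.+1%:R; have h00 : 0 < h0 by rewrite divr_gt0.
have lh : l%:R * h0 *+ 2 <= de *+ 2.
  rewrite lerMn2r /= mulrCA ler_piMr ?(ltW de0)// ler_pdivrMr// mul1r ler_nat//.
have [C _ HC] := dbound_cutoff x0 de0 l h0.
have rd : 0 < r / 2 by rewrite divr_gt0.
have c0 : 0 < r / 2 / (d%:R * d.+1%:R).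
  by rewrite divr_gt0// mulr_gt0// ltr0n.
near=> e.
have de1 : sval e `^ (a / 2) <= r / 2 / (d%:R * d.+1%:R).
  by near: e; exact: near_eps_powR_le.
have E1 : (fun x => cutoff x0 de x * U e x) =
    (fun x => cutoff x0 de x * (Phi e x)^-1 * (Phi e x * U e x)).
  apply/funext => x.
  have [xd|xd] := leP (de *+ 2) `|x - x0|; first by rewrite cutoff0// !mul0r.
  have xr : enorm (x - x0) < r.
    apply: le_lt_trans (enorm_le_norm _) _; apply: le_lt_trans (der).
    rewrite ler_wpM2l// (le_trans (ltW xd))//.
    by rewrite -[_ *+ 4]mulr_natr -[_ *+ 2]mulr_natr; have := (de0); lra.
  have P0 : Phi e x != 0.
    have Se0 : 0 < S e by near: e.
    have : 0 < Normc.normc (Phi e x).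
      by apply: lt_le_trans (near uniform_Phi_ge e _ x xr) => //; rewrite invr_gt0.
    by apply: contraTneq => ->; rewrite Normc.normc0 ltxx.
  by rewrite mulrA divfK.
have [ccw wN] : tame N e (fun x => Phi e x * U e x) by near: e.
rewrite E1; apply: (near HA e _ _ _ h0) => //.
- move=> x Mx; rewrite cutoff0 ?mul0r//.
  have := lerB_dist x x0; have := ler0n R N.+1; move: Mx; rewrite /M.
  by move: (de *+ 2) (`|x|) (`|x - x0|) (`|x0|) (_%:R) => u v w z t; lra.
- by near: e; apply: (elliptic_dbound de0 der lh HC h00).
- by apply: cc_widen ccw; rewrite /M lerDl addr_ge0// mulrn_wge0// ltW.
- move=> ze eze.
  have ae : sval e `^ (- a) <= enorm (eta e) by near: e.
  have [z1 z2] : sval e `^ (- (a / 2)) <= enorm ze /\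
      `|unit_dir ze - unit_dir (eta e)| <= d.+1%:R * sval e `^ (a / 2).
    by apply: (near (near_shift d a0) e).
  apply: (near (uniform_decay m a2) e) => //; split=> //.
  apply: le_trans (enorm_le_norm _) _.
  rewrite -[unit_dir ze](subrK (unit_dir (eta e))) -addrA.
  apply: le_trans (ler_wpM2l _ (ler_normD _ _)) _ => //.
  rewrite mulrDr [r]splitr lerD//; last by near: e.
  apply: le_trans (ler_wpM2l _ z2) _ => //.
  by rewrite mulrA mulrC -ler_pdivlMr// mulr_gt0// ltr0n.
Unshelve. all: end_near. Qed.

(** A single [v], a fixed cutoff times [U], serves at all points [(x, xi)]. *)
Lemma regular_of_elliptic : open Omega -> Omega x0 -> exists r' : R,
  [/\ 0 < r', sball (sconst R x0) r' `<=` star_c Omega &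
    forall x xi : star R Rd, sball (sconst R x0) r' x ->
      star_set R (sphere R d) xi -> sle (sdist xi (sconst R xi0)) (sconst R r') ->
      microlocally_regular Omega (germ U) x xi].
Proof.
move=> oO Ox0.
have [q q0 Hq] : exists2 q : R, 0 < q & forall y, `|x0 - y| < q -> Omega y.
  have [q q0 H] := (nbhs_ballP _ _).1 (open_nbhs_nbhs (conj oO Ox0)).
  by exists q => // y xy; apply: H; rewrite -ball_normE.
have d0 : 0 < d%:R :> R by rewrite ltr0n.
pose de := Num.min (q / 4) (r / (8 * d%:R)).
have de0 : 0 < de by rewrite lt_min !divr_gt0// mulr_gt0.
have deq : de *+ 4 <= q.
  rewrite -[_ *+ 4]mulr_natr -ler_pdivlMr//; by rewrite ge_min lexx.
have der : d%:R * (de *+ 8) <= r.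
  have : de <= r / (8 * d%:R) by rewrite ge_min lexx orbT.
  rewrite ler_pdivlMr ?mulr_gt0// => H.
  by rewrite -[_ *+ 8]mulr_natr mulrCA [d%:R * 8]mulrC.
have der4 : d%:R * (de *+ 4) < r.
  apply: lt_le_trans der; rewrite ltr_pM2l//.
  by rewrite -[_ *+ 4]mulr_natr -[_ *+ 8]mulr_natr; move: de0; lra.
have cube : [set x | `|x - x0| <= de *+ 2] `<=` Omega.
  move=> x /= xd; apply: Hq; rewrite distrC (le_lt_trans xd)// (lt_le_trans _ deq)//.
  by rewrite -[_ *+ 4]mulr_natr -[_ *+ 2]mulr_natr; have := (de0); lra.
(* [de / 2] leaves the other half of the plateau to the fast-scale neighbours of [x]; [r / (4 * d)]
   ensures [d * (2 * r') <= r / 2] for directions that lie within [r'] of some [xi] which is itself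
   within [r'] of [xi0]. *)
pose r' := Num.min (de / 2) (r / (4 * d%:R)).
have r'0 : 0 < r' by rewrite lt_min !divr_gt0// mulr_gt0.
have r'd : r' <= de / 2 by rewrite ge_min lexx.
have r'r : d%:R * (r' *+ 4) <= r.
  have : r' <= r / (4 * d%:R) by rewrite ge_min lexx orbT.
  rewrite ler_pdivlMr ?mulr_gt0// => H.
  by rewrite -[_ *+ 4]mulr_natr mulrCA [d%:R * 4]mulrC.
exists r'; split=> //.
  move=> x; rewrite -(repK x) => /sball_germ nx.
  apply: (star_c_germ (@compact_norm_sub_le R d x0 (de *+ 2)) cube).
  apply: filterS nx => e H /=; apply: le_trans (norm_le_enorm _) _.
  by apply: le_trans (ltW H) _; rewrite -[_ *+ 2]mulr_natr; move: (r'd) (de0); lra.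
move=> x xi; rewrite -(repK x) -(repK xi); set X := rep x; set Xi := rep xi.
move=> /sball_germ nx _ /sdist_const_le_germ nxi.
exists (germ (fun e x => cutoff x0 de x * U e x)); split.
- apply: test_mul_Mc mU; first exact: test_function_cutoff.
  exact: csupport_cutoff_neq0.
- move=> y; rewrite -(repK y); set Y := rep y => /near_fast_germ[a a0 nY].
  rewrite !sapp_germ; apply/germP.
  near=> e; rewrite cutoff1 ?mul1r//.
  have h1 : enorm (Y e - X e) <= sval e `^ a by near: e.
  have h2 : enorm (X e - x0) < r' by near: e.
  have h3 : sval e `^ a <= de / 2.
    by near: e; apply: near_eps_powR_le => //; rewrite divr_gt0.
  rewrite -[Y e](subrK (X e)) -addrA (le_trans (ler_normD _ _))//.
  have := norm_le_enorm (Y e - X e); have := norm_le_enorm (X e - x0).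
  by move: h1 h2 h3 r'd; lra.
- move=> eta; rewrite -(repK eta); set Et := rep eta => /fast_scale_germ[a a0 aEt].
  rewrite smap_germ => /near_fast_germ[b b0 bEt].
  rewrite sfourier_germ sapp_germ; apply/approxeq0_germ => n.
  apply: (cutoff_mul_fourier_small n de0 der4 a0 aEt).
  near=> e.
  have h1 : enorm (unit_dir (Et e) - Xi e) <= sval e `^ b by near: e.
  have h2 : enorm (Xi e - xi0) <= r' by near: e.
  have h3 : sval e `^ b <= r'.
    by near: e; exact: near_eps_powR_le.
  rewrite -[unit_dir _](subrK (Xi e)) -addrA.
  have h4 : `|(unit_dir (Et e) - Xi e) + (Xi e - xi0)| <= r' *+ 2.
    apply: le_trans (ler_normD _ _) _; rewrite mulr2n lerD//.
      exact: le_trans (norm_le_enorm _) (le_trans h1 h3).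
    exact: le_trans (norm_le_enorm _) h2.
  apply: le_trans (ler_wpM2l _ h4) _ => //.
  by rewrite -[r' *+ 2]mulr_natr; move: (r'r); rewrite -[r' *+ 4]mulr_natr; lra.
Unshelve. all: end_near. Qed.

End EllipticToRegular.

(** * Partition of unity at a small scale *)

Section Partition.
Variables (R : realType) (d : nat).
Local Notation Rd := 'rV[R]_d.
Implicit Types (x : Rd) (de : R).

(** Since [part] lives on [[0, 2]], this is the lower corner of a cube of side [2 * de] containing
    the support of the cell. *)
Definition cell_center (x0 : Rd) (de : R) J (j : 'rV['I_J.*2]_d) : Rd :=
  \row_i (x0 0 i + de * ((j 0 i)%:R - J%:R)).

Definition cell (x0 : Rd) (de : R) J (j : 'rV['I_J.*2]_d) : Rd -> R[i] :=
  tensor (fun i t => part (de^-1 * t + (- de^-1 * x0 0 i + J%:R - (j 0 i)%:R))).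

Lemma smooth_cell (x0 : Rd) de J (j : 'rV['I_J.*2]_d) : smooth (cell x0 de j).
Proof. by apply: smooth_tensor => i n; apply: smooth1n_affine; exact: smooth1_part. Qed.

Lemma cell_arg (x0 : Rd) de J (j : 'rV['I_J.*2]_d) (x : Rd) i : 0 < de ->
  de^-1 * x 0 i + (- de^-1 * x0 0 i + J%:R - (j 0 i)%:R) = (x - cell_center x0 de j) 0 i / de.
Proof. by move=> de0; rewrite !mxE; field; rewrite gt_eqF. Qed.

Lemma cell0 (x0 : Rd) de J (j : 'rV['I_J.*2]_d) (x : Rd) : 0 < de ->
  cell x0 de j x != 0 -> `|x - cell_center x0 de j| <= de *+ 2.
Proof.
move=> de0; apply: contra_neqT; rewrite -ltNge => H.
have [i xi] : exists i, de *+ 2 <= `|(x - cell_center x0 de j) 0 i|.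
  apply: contrapT => /forallNP H'; move: H; rewrite ltNge => /negP; apply.
  apply: norm_le_entry => [|i]; first by rewrite mulrn_wge0// ltW.
  by rewrite ltW// ltNge; apply/negP; exact: H'.
rewrite /cell /tensor (bigD1 i) //= cell_arg// part0 ?mul0r//.
by rewrite normrM normfV (gtr0_norm de0) ler_pdivlMr// mulr_natl.
Qed.

Lemma sum_cell (x0 : Rd) de J (x : Rd) : 0 < de -> `|x - x0| / de + 1 <= J%:R ->
  \sum_j cell x0 de (J := J) j x = 1.
Proof.
move=> de0 xJ; rewrite /cell /tensor -(rmorph_sum (real_complex R)) /=.
pose g (i : 'I_d) (a : 'I_J.*2) : R := part ((x - x0) 0 i / de + J%:R - a%:R).
rewrite (eq_bigr (fun j : 'rV['I_J.*2]_d => \prod_i g i (j 0 i))); last first.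
  move=> j _; apply: eq_bigr => i _; rewrite /g; congr part.
  by rewrite !mxE; field; rewrite gt_eqF.
rewrite sum_row_prod big1 // => i _; apply: sum_part.
rewrite normrM normfV (gtr0_norm de0) (le_trans _ xJ)// lerD2r ler_pM2r ?invr_gt0//.
exact: entry_le_norm.
Qed.

Lemma dbound_cell l : exists2 C, 1 <= C & forall (x0 : Rd) de J (j : 'rV['I_J.*2]_d) h0,
  0 < de -> de <= 1 -> dbound l h0 ((C * de^-1 ^+ l) ^+ d) (cell x0 de j).
Proof.
have P0 (t : R) : 2 < `|t| -> part t = 0 by move=> t2; apply: part0; exact: ltW.
have [C C1 HC] := smooth1_rbound l (@smooth1_part R) P0.
exists C => // x0 de J j h0 de0 de1; apply: dbound_tensor => i.
by apply: rbound_affine => //; rewrite invf_ge1.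
Qed.

End Partition.

(** * Microlocal regularity gives decay after a fixed cutoff *)

Section RegularToDecay.
Variables (R : realType) (d : nat) (Omega : set 'rV[R]_d).
Hypothesis d_gt0 : (0 < d)%N.
Local Notation Rd := 'rV[R]_d.
Local Notation E := (eps_index R).
Local Notation near_eps P := (\forall e \near @small_eps R, P e).
Variables (U : E -> Rd -> R[i]) (x0 xi0 : Rd) (r : R).
Hypotheses (mU : M_space (star_c Omega) (germ U)) (xi1 : enorm xi0 = 1) (r_gt0 : 0 < r).

Local Notation tick m := ((m.+1%:R)^-1 : R).

(** [N] measures growth and support and stays fixed, while a larger [m] enlarges the neighbourhoods
    of size [eps ^ (1 / m.+1)] and raises the order of decay; so one integer stands for both the
    fast-scale exponents and the orders of negligibility. *)
Definition local_model (N m : nat) (e : E) (p : Rd * Rd) := exists v : Rd -> R[i],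
  [/\ tame N e v,
      forall y, enorm (y - p.1) <= sval e `^ tick m -> U e y = v y &
      forall eta, sval e `^ (- tick m) <= enorm eta ->
        enorm (unit_dir eta - p.2) <= sval e `^ tick m ->
        Normc.normc (fourier v eta) <= sval e `^ m%:R].

Definition base_set (p : Rd * Rd) :=
  [/\ enorm (p.1 - x0) < r, enorm p.2 = 1 & enorm (p.2 - xi0) <= r].

Lemma tick_gt0 m : 0 < tick m.
Proof. by rewrite invr_gt0. Qed.

(** Regularity gives one [v] for all fast-scale distances and all orders, so [N] is read off from
    [v] before [m] is given. *)
Lemma regular_local_model (p : E -> Rd * Rd) :
  microlocally_regular Omega (germ U) (germ (fst \o p)) (germ (snd \o p)) ->
  near_eps (fun e => base_set (p e)) ->
  exists N, forall m, near_eps (fun e => local_model N m e (p e)).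
Proof.
move=> [v]; rewrite -(repK v); set V := rep v => -[cV uv fv] np.
have [N HN] := Mc_tame d_gt0 cV; exists N => m.
have loc : near_eps (fun e => forall y, enorm (y - (p e).1) <= sval e `^ tick m -> U e y = V e y).
  apply: (internal_forall (A := fun e y => enorm (y - (p e).1) <= sval e `^ tick m)).
    by apply: nearW => e; exists (p e).1; rewrite subrr enorm0 ltW// eps_powR_gt0.
  move=> y ny; have nf : near_fast (germ y) (germ (fst \o p)).
    by apply/near_fast_germ; exists (tick m) => //; exact: tick_gt0.
  by have := uv _ nf; rewrite !sapp_germ => /germP.
have fou : near_eps (fun e => forall eta, sval e `^ (- tick m) <= enorm eta /\
    enorm (unit_dir eta - (p e).2) <= sval e `^ tick m ->
    Normc.normc (fourier (V e) eta) <= sval e `^ m%:R).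
  apply: (internal_forall (A := fun e eta => sval e `^ (- tick m) <= enorm eta /\
    enorm (unit_dir eta - (p e).2) <= sval e `^ tick m)).
    apply: filterS np => e [_ p1 _]; exists (sval e `^ (- tick m) *: (p e).2).
    rewrite enormZ p1 mulr1 unit_dirZ ?eps_powR_gt0// unit_dir_sphere// subrr enorm0.
    by rewrite ler_norm ltW// eps_powR_gt0.
  move=> eta neta; have fe : fast_scale (germ eta).
    by apply/fast_scale_germ; exists (tick m); [exact: tick_gt0|apply: filterS neta => e []].
  have nf : near_fast (smap (@unit_dir R d) (germ eta)) (germ (snd \o p)).
    rewrite smap_germ; apply/near_fast_germ; exists (tick m); first exact: tick_gt0.
    by apply: filterS neta => e [].
  by have := fv _ fe nf; rewrite sfourier_germ sapp_germ => /approxeq0_germ; apply.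
apply: filterS3 HN loc fou => e a b c; exists (V e); split => // eta e1 e2.
exact: c.
Qed.

Hypothesis regular : forall x xi : star R Rd, sball (sconst R x0) r x ->
  star_set R (sphere R d) xi -> sle (sdist xi (sconst R xi0)) (sconst R r) ->
  microlocally_regular Omega (germ U) x xi.

Lemma uniform_local_model : exists N, forall m,
  near_eps (fun e => forall p, base_set p -> local_model N m e p).
Proof.
apply: uniform_witness.
  by apply: nearW => e; exists (x0, xi0); split => //=; rewrite subrr enorm0// ltW.
move=> p np; apply: regular_local_model => //; apply: regular.
- by apply/sball_germ; apply: filterS np => e [].
- by apply/star_set_germ; apply: filterS np => e [].
- by apply/sdist_const_le_germ; apply: filterS np => e [].
Qed.

Lemma decay_of_regular (de0 : R) (xi : E -> Rd) (a : R) (n : nat) :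
  0 < de0 -> d%:R * (de0 *+ 2) <= r / 2 -> 0 < a ->
  near_eps (fun e => enorm (unit_dir (xi e) - xi0) <= r) ->
  near_eps (fun e => sval e `^ (- a) <= enorm (xi e)) ->
  near_eps (fun e => Normc.normc (fourier (fun x => cutoff x0 de0 x * U e x) (xi e)) <=
     sval e `^ n%:R).
Proof.
move=> de00 der a0 dxi axi.
have [N HN] := uniform_local_model.
pose M := N.+1%:R + (`|x0| + de0 *+ 2).
have xM : 0 <= `|x0| + de0 *+ 2 by rewrite addr_ge0// mulrn_wge0// ltW.
have M0 : 0 < M by rewrite ltr_wpDr.
have a2 : 0 < a / 2 by rewrite divr_gt0.
(* Order [n.+1] leaves one power of [eps] for the number of cells. *)
have [l [m0 HA]] := asym_bound N n.+1 d_gt0 M0 a2.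
(* Four demands: [m >= m0]; [l * d < m.+1] and [d < m.+1], so that the difference bound of a cell
   and the number of cells each cost at most [eps ^ -1]; and [tick m < a / 2], so that frequencies
   shifted by up to [eps ^ (- a / 2)] stay where the models decay. *)
pose m := (m0 + l * d + d + (Num.trunc (2 / a)).+1)%N.
have dm : (d < m.+1)%N by rewrite ltnS /m addnAC leq_addl.
have ldm : (l * d < m.+1)%N by rewrite ltnS /m addnAC -2!addnA addnCA leq_addr.
have m0m : (m0 <= m)%N by rewrite /m -!addnA leq_addr.
have tk0 := tick_gt0 m.
have tka : tick m < a / 2.
  have q0 : 0 <= 2 / a by rewrite divr_ge0// ltW.
  have /andP[_ H] := truncn_itv q0.
  rewrite -[a / 2]invrK ltf_pV2 ?posrE ?invr_gt0// invf_div (lt_le_trans H)// ler_nat.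
  by rewrite leqW// /m leq_addl.
have d0 : 0 < d%:R :> R by rewrite ltr0n.
have [C0 C01 HC0] := dbound_cutoff x0 de00 l 1.
have [C1 C11 HC1] := dbound_cell R d l.
(* Chosen so that [d * (2 * D) = eps ^ tick m]: the support of a cell then fits into the Euclidean
   ball about its centre on which [U] agrees with the local model. *)
pose D (e : E) : R := sval e `^ tick m / (d%:R *+ 2).
pose K := (d%:R *+ 2 * de0 *+ 4 + 4) ^+ d.
pose K2 := 2 ^+ l * (C0 * (C1 ^+ d * (d%:R *+ 2) ^+ (l * d))).
have frac k : (k < m.+1)%N -> - (1 : R) < - (tick m * k%:R).
  move=> km; rewrite ltrN2 mulrC ltr_pdivrMr// mul1r ltr_nat.
  done.
have d20 : 0 < d%:R *+ 2 :> R by rewrite pmulrn_lgt0.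
have r20 : 0 < r / 2 by rewrite divr_gt0.
have /smooth_internal_germ sU := mU.1.
near=> e.
have D0 : 0 < D e by rewrite divr_gt0// eps_powR_gt0.
have D1 : D e <= 1.
  rewrite ler_pdivrMr// mul1r; apply: le_trans (_ : 1 <= _).
    by have := @eps_powR_le _ e 0 (tick m) (ltW tk0); rewrite [X in _ <= X]powRr0.
  by rewrite -mulr_natr -natrM ler1n muln_gt0 d_gt0.
have dD : d%:R * (D e *+ 2) = sval e `^ tick m.
  rewrite /D -[_ *+ 2]mulr_natr -[d%:R *+ 2]mulr_natr; field.
  by rewrite pnatr_eq0 -lt0n.
pose J := (Num.trunc (de0 *+ 2 / D e)).+2.
have q0 : 0 <= de0 *+ 2 / D e by rewrite divr_ge0 ?mulrn_wge0 ?ltW.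
have /andP[J1 J2] := truncn_itv q0.
pose T := 'rV['I_J.*2]_d.
have split_cutoff : (fun x => cutoff x0 de0 x * U e x) =
    (fun x => \sum_(j <- index_enum T) (cutoff x0 de0 x * cell x0 (D e) j x) * U e x).
  apply/funext => x; rewrite -mulr_suml -mulr_sumr.
  have [xd|xd] := leP (de0 *+ 2) `|x - x0|; first by rewrite cutoff0// !mul0r.
  rewrite sum_cell ?mulr1// /J -[X in _ <= X]natr1 lerD2r.
  by apply: ltW; apply: le_lt_trans J2; rewrite ler_pM2r ?invr_gt0// ltW.
have sUe : smooth (U e) by near: e.
have supM f : supp_in M (fun x => cutoff x0 de0 x * f x).
  move=> x Mx; rewrite cutoff0 ?mul0r//.
  have := lerB_dist x x0; have := ler0n R N.+1; move: Mx; rewrite /M.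
  by move: (de0 *+ 2) (`|x|) (`|x - x0|) (`|x0|) (_%:R) => u v w z t; lra.
have ccj (j : T) : cc M (fun x => cutoff x0 de0 x * cell x0 (D e) j x * U e x).
  apply: ccont_cc; last by move=> x Mx; rewrite supM ?mul0r.
  apply: (smooth_ccont [::]); apply: smoothM => //.
  by apply: smoothM; [exact: smooth_cutoff|exact: smooth_cell].
rewrite split_cutoff (fourier_sum _ M0)//.
have xi_big : sval e `^ (- a) <= enorm (xi e) by near: e.
have xi_dir : enorm (unit_dir (xi e) - xi0) <= r by near: e.
have xie0 : xi e != 0.
  by apply: enorm_gt0_neq0; apply: lt_le_trans xi_big; exact: eps_powR_gt0.
have small1 : sval e `^ tick m <= r / 4.
  by near: e; apply: near_eps_powR_le => //; rewrite divr_gt0.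
have DV : (D e)^-1 = (d%:R *+ 2) * sval e `^ (- tick m) by rewrite /D invf_div eps_powRN.
have bj (j : T) : Normc.normc (fourier (fun x => cutoff x0 de0 x * cell x0 (D e) j x * U e x) (xi e))
    <= sval e `^ n.+1%:R.
  have [inr|outr] := ltP (enorm (cell_center x0 (D e) j - x0)) r; last first.
    (* A common point of the supports of cutoff and cell would bring the centre within
       [eps ^ tick m + r / 2 <= 3 * r / 4] of [x0]. *)
    have -> : (fun x => cutoff x0 de0 x * cell x0 (D e) j x * U e x) = fun=> 0.
      apply/funext => x; apply/eqP; apply: contraT; rewrite !mulf_eq0 !negb_or.
      move=> /andP[/andP[c1 c2] _].
      have h1 : `|x - x0| <= de0 *+ 2.
        by rewrite leNgt; apply: contra c1 => /ltW/cutoff0 ->.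
      have h2 := cell0 D0 c2.
      have h3 : `|cell_center x0 (D e) j - x0| <= D e *+ 2 + de0 *+ 2.
        rewrite -[cell_center x0 (D e) j](subrK x) -addrA.
        by apply: le_trans (ler_normD _ _) _; rewrite lerD// distrC.
      have := le_trans outr (enorm_le_norm _).
      move/le_trans => /(_ _ (ler_wpM2l (ltW d0) h3)).
      by rewrite mulrDr dD; move: (small1) (der) (r_gt0); lra.
    by rewrite (fourier0 _ M0) Normc.normc0 ltW// eps_powR_gt0.
  have bs : base_set (cell_center x0 (D e) j, unit_dir (xi e)).
    by split => //; exact: enorm_unit_dir.
  have HNe : forall p, base_set p -> local_model N m e p by near: e.
  have [v [[ccv vN] Uv fv]] := HNe _ bs.
  have -> : (fun x => cutoff x0 de0 x * cell x0 (D e) j x * U e x) =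
      (fun x => cutoff x0 de0 x * cell x0 (D e) j x * v x).
    apply/funext => x; have [->|c2] := eqVneq (cell x0 (D e) j x) 0; first by rewrite mulr0 !mul0r.
    rewrite Uv //=; apply: le_trans (enorm_le_norm _) _; rewrite -dD ler_wpM2l//.
    exact: cell0.
  apply: (near HA e _ _ _ 1) => //.
  - have B := dboundM HC0 (HC1 x0 (D e) J j 1 D0 D1).
    apply: dbound_le B.
    apply: le_trans (_ : K2 * sval e `^ (- (tick m * (l * d)%:R)) <= _); last first.
      by near: e; exact: near_mul_eps_le (frac _ ldm).
    rewrite DV exprMn_comm; last exact: mulrC.
    rewrite -exprM exprMn eps_powRX mulNr /K2.
    by rewrite le_eqVlt; apply/orP; left; apply/eqP; ring.
  - by apply: cc_widen ccv; rewrite lerDl.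
  - move=> eta xe.
    have [z1 z2] : sval e `^ (- (a / 2)) <= enorm eta /\
      `|unit_dir eta - unit_dir (xi e)| <= d.+1%:R * sval e `^ (a / 2).
      by apply: (near (near_shift d a0) e).
    apply: le_trans (fv eta _ _) _.
    + by apply: le_trans z1; apply: eps_powR_le; rewrite lerN2 ltW.
    + apply: le_trans (enorm_le_norm _) _; apply: le_trans (ler_wpM2l (ltW d0) z2) _.
      by rewrite mulrA; near: e; exact: near_mul_eps_le.
    + by apply: eps_powR_le; rewrite ler_nat.
apply: le_trans (normc_sum _ _ _) _.
apply: le_trans (ler_sum _ (fun j _ => bj j)) _.
rewrite sumr_const card_mx card_ord mul1n.
have Jd : (J.*2 ^ d)%:R <= sval e `^ (- 1).
  apply: le_trans (_ : K * sval e `^ (- (tick m * d%:R)) <= _); last first.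
    by near: e; exact: near_mul_eps_le (frac _ dm).
  rewrite -mulNr -eps_powRX /K -exprMn natrX lerXn2r ?nnegrE//.
    rewrite mulr_ge0 ?(ltW (eps_powR_gt0 _ _))// addr_ge0// mulrn_wge0// mulr_ge0 ?(ltW d20)//.
    exact: ltW.
  have t1 : 1 <= sval e `^ (- tick m).
    by rewrite -[X in X <= _](powRr0 (sval e)); apply: eps_powR_le; rewrite oppr_le0 ltW.
  have J1' : (Num.trunc (de0 *+ 2 / D e))%:R <= de0 *+ 2 * ((d%:R *+ 2) * sval e `^ (- tick m)).
    by rewrite -DV.
  have -> : J.*2%:R = (Num.trunc (de0 *+ 2 / D e))%:R * 2 + 4 :> R.
    by rewrite /J -muln2 natrM -addn2 natrD; ring.
  move: (J1') (t1); rewrite -[d%:R *+ 2 * de0 *+ 4]mulr_natr -[de0 *+ 2]mulr_natr -[d%:R *+ 2]mulr_natr.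
  by move: (Num.trunc _)%:R (sval e `^ _) => u v; lra.
rewrite -[_ *+ (J.*2 ^ d)]mulr_natr -[n.+1%:R]natr1 eps_powRD -mulrA ler_piMr ?(ltW (eps_powR_gt0 _ _))//.
apply: le_trans (ler_wpM2l (ltW (eps_powR_gt0 _ _)) Jd) _.
by rewrite -eps_powRD subrr powRr0.
Unshelve. all: end_near.
Qed.

End RegularToDecay.

(** * The three implications *)

Section Implications.
Variables (R : realType) (d : nat) (Omega : set 'rV[R]_d).
Local Notation Rd := 'rV[R]_d.
Local Notation E := (eps_index R).
Local Notation near_eps P := (\forall e \near @small_eps R, P e).
Variables (U : E -> Rd -> R[i]) (x0 xi0 : Rd).
Hypotheses (oO : open Omega) (mU : M_space (star_c Omega) (germ U)) (Ox0 : Omega x0)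
  (xi1 : enorm xi0 = 1).

(** In dimension zero the only vector has norm [0], so the unit vector [xi0] excludes it. *)
Lemma dim_gt0 : (0 < d)%N.
Proof.
rewrite lt0n; apply/negP => /eqP d0; move: (xi1).
rewrite /enorm /dotp big1 ?sqrtr0 => [/esym/eqP|i _]; first by rewrite oner_eq0.
by have := ltn_ord i; rewrite {2}d0.
Qed.

Let d_gt0 := dim_gt0.

Lemma exists_cube (r : R) : 0 < r -> exists2 de : R, 0 < de &
  d%:R * (de *+ 2) <= r /\ [set x | `|x - x0| <= de *+ 2] `<=` Omega.
Proof.
move=> r0; have [q q0 Hq] := (nbhs_ballP _ _).1 (open_nbhs_nbhs (conj oO Ox0)).
have d0 : 0 < d%:R :> R by rewrite ltr0n.
exists (Num.min (q / 4) (r / (2 * d%:R))); first by rewrite lt_min !divr_gt0// mulr_gt0.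
set de := Num.min _ _; split.
  have : de <= r / (2 * d%:R) by rewrite ge_min lexx orbT.
  rewrite ler_pdivlMr ?mulr_gt0// => H.
  by rewrite -[_ *+ 2]mulr_natr mulrCA [d%:R * 2]mulrC.
move=> x /= xd; apply: Hq; rewrite -ball_normE /= distrC (le_lt_trans xd)//.
have : de <= q / 4 by rewrite ge_min lexx.
by rewrite -[_ *+ 2]mulr_natr; have := q0; rewrite /=; lra.
Qed.

Lemma conic_nbhs_directions (r : R) : 0 < r ->
  conic_nbhs xi0 [set xi : Rd | enorm (unit_dir xi - xi0) <= r].
Proof.
move=> r0; split=> [t x t0 /=|]; first by rewrite unit_dirZ.
have d0 : 0 < d%:R * d.+1%:R :> R by rewrite mulr_gt0// ltr0n.
have n0 : 0 < `|xi0|.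
  by rewrite normr_gt0; apply: enorm_gt0_neq0; rewrite xi1.
apply/nbhs_ballP; exists (Num.min `|xi0| (r / (d%:R * d.+1%:R))) => /=.
  by rewrite lt_min n0 divr_gt0.
move=> xi; rewrite -ball_normE /= lt_min => /andP[h1 h2].
have x0' : xi0 != 0 by rewrite -normr_gt0.
have xi0' : xi != 0 by apply: contraTneq h1 => ->; rewrite subr0 ltxx.
apply: le_trans (enorm_le_norm _) _.
rewrite distrC -{1}(unit_dir_sphere xi1).
apply: le_trans (ler_wpM2l _ (unit_dir_dist x0' xi0')) _ => //.
rewrite xi1 divr1 mulrA mulrC -ler_pdivlMr//; exact: ltW.
Qed.

Definition regular_prop := exists r : R,
  [/\ 0 < r, sball (sconst R x0) r `<=` star_c Omega &
    forall x xi : star R Rd, sball (sconst R x0) r x -> star_set R (sphere R d) xi ->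
      sle (sdist xi (sconst R xi0)) (sconst R r) -> microlocally_regular Omega (germ U) x xi].

Definition elliptic_prop := exists (phi : star R (Rd -> R[i])) (r : R) (S : star R R),
  [/\ Mcinf_space (star_c Omega) phi, 0 < r, slow_scale S /\ slt (sconst R 0) S,
    forall (alpha : 'I_d -> nat) (x : star R Rd), sball (sconst R x0) r x ->
      sle (sabs (sapp (sderiv alpha phi) x)) S /\
      sle (smap (fun s : R => s^-1) S) (sabs (sapp phi x)) &
    forall xi : star R Rd, fast_scale xi ->
      sle (sdist (smap (@unit_dir R d) xi) (sconst R xi0)) (sconst R r) ->
      approxeq0 (sapp (sfourier (smul phi (germ U))) xi)].

Definition test_prop := exists (psi : Rd -> R[i]) (Gamma : set Rd),
  [/\ test_function Omega psi, psi x0 = 1, conic_nbhs xi0 Gamma &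
    forall xi : star R Rd, star_set R Gamma xi -> fast_scale xi ->
      approxeq0 (sapp (sfourier (smul (sconst R psi) (germ U))) xi)].

Lemma test_of_regular : regular_prop -> test_prop.
Proof.
move=> [r [r0 _ reg]]; have r20 : 0 < r / 2 by rewrite divr_gt0.
have [de de0 [der cube]] := exists_cube r20.
exists (cutoff x0 de), [set xi : Rd | enorm (unit_dir xi - xi0) <= r]; split.
- exact: test_function_cutoff.
- by apply: cutoff1 => //; rewrite subrr normr0 ltW.
- exact: conic_nbhs_directions.
- move=> xi; rewrite -(repK xi) => /star_set_germ G /fast_scale_germ[a a0 aX].
  rewrite /sconst smul_germ sfourier_germ sapp_germ; apply/approxeq0_germ => n.
  exact: (decay_of_regular d_gt0 mU xi1 r0 reg n de0 der a0 G aX).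
Qed.

Lemma regular_of_elliptic_prop : elliptic_prop -> regular_prop.
Proof.
move=> [phi [r [S [[_ cphi] r0 [Ss S0] est dec]]]].
rewrite -(repK phi) in cphi est dec; rewrite -(repK S) in Ss S0 est.
have S0' : near_eps (fun e => 0 < rep S e).
  by move: S0; rewrite /slt /sconst => /srel_germ.
have Ss' a : 0 < a -> near_eps (fun e => `|rep S e| <= sval e `^ (- a)).
  by move=> a0; have := Ss a a0; rewrite /sle /rho_pow /rho !smap_germ => /srel_germ.
apply: (regular_of_elliptic d_gt0 mU xi1 r0 cphi S0' Ss') => //.
- move=> al x /sball_germ nx; have [+ _] := est al (germ x) nx.
  by rewrite sderiv_germ sapp_germ /sle /sabs smap_germ => /srel_germ.
- move=> x /sball_germ nx; have [_] := est (fun=> 0%N) (germ x) nx.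
  by rewrite sapp_germ /sle /sabs !smap_germ => /srel_germ.
- move=> xi a n a0 aX dX.
  have fX : fast_scale (germ xi) by apply/fast_scale_germ; exists a.
  have := dec (germ xi) fX; rewrite smap_germ => H.
  have /H : sle (sdist (germ (fun e => unit_dir (xi e))) (sconst R xi0)) (sconst R r).
    exact/sdist_const_le_germ.
  by rewrite smul_germ sfourier_germ sapp_germ => /approxeq0_germ; apply.
Qed.

(** In general no constant bounds all derivatives of [psi], so [S] has to exceed every constant for
    small [eps] and yet be slow scale. *)
Let log_scale (e : E) : R := 1 - ln (sval e).

Lemma log_scale_ge1 e : 1 <= log_scale e.
Proof. by rewrite /log_scale lerBrDr gerDl ln_le0// eps_le1. Qed.

Lemma log_scale_large (C : R) : near_eps (fun e => C <= log_scale e).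
Proof.
apply/near_epsP; exists (expR (- `|C|)); first exact: expR_gt0.
move=> e; rewrite -ler_ln ?posrE ?expR_gt0 ?eps_gt0// expRK => H.
by rewrite /log_scale; have := ler_norm C; move: H; lra.
Qed.

(** With [y = - ln eps] and [c] the minimum of [1] and [a / 2], one has [c * (1 + y) <= 1 + a / 2 *
    y <= eps ^ (- a / 2)]; a second factor [eps ^ (- a / 2)] absorbs [1 / c]. *)
Lemma log_scale_slow (a : R) : 0 < a -> near_eps (fun e => `|log_scale e| <= sval e `^ (- a)).
Proof.
move=> a0; have a2 : 0 < a / 2 by rewrite divr_gt0.
pose c := Num.min 1 (a / 2); have c0 : 0 < c by rewrite lt_min ltr01.
apply: filterS (near_const_le c^-1 a2) => e He.
have L1 := log_scale_ge1 e; rewrite ger0_norm ?(le_trans ler01)//.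
have -> : - a = - (a / 2) + - (a / 2) by field.
rewrite eps_powRD -[log_scale e](mulKf (lt0r_neq0 c0)) ler_pM ?invr_ge0 ?(ltW c0)//.
  by rewrite mulr_ge0 ?(ltW c0)// (le_trans ler01).
rewrite eps_powR; apply: le_trans (expR_ge1Dx _).
have y0 : 0 <= - ln (sval e) by rewrite oppr_ge0 ln_le0// eps_le1.
have -> : - (a / 2) * ln (sval e) = a / 2 * - ln (sval e) by rewrite mulNr mulrN.
rewrite /log_scale mulrDr mulr1 lerD//; first by rewrite ge_min lexx.
by rewrite ler_wpM2r// ge_min lexx orbT.
Qed.

Lemma elliptic_of_test : test_prop -> elliptic_prop.
Proof.
move=> [psi [Gamma [tpsi psi1 [coneG nG] dec]]]; have [sp cp sO] := tpsi.
have [q q0 Hq] := (nbhs_ballP _ _).1 nG.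
have [c1 c2] := smooth_ccont [::] sp.
have h4 : 0 < 1 / 4 :> R by [].
have [b b0 Hb] : exists2 b : R, 0 < b & forall x, `|x0 - x| < b ->
    2^-1 <= Normc.normc (psi x).
  have := c1 x0; rewrite /= => /cvgrPdist_le /(_ _ h4) /nbhs_ballP[b b0 Hb].
  exists b => // x xb; have := Hb x; rewrite -ball_normE /= psi1 /= => /(_ xb) H.
  apply: le_trans (normc_re _).
  have := ler_norm (complex.Re (psi x)); move: H; rewrite ler_norml => /andP[_].
  by lra.
(* Halving [q] makes the closed condition with [r] imply membership in the open ball of radius [q]
   inside [Gamma]; [b] is a radius on which [|psi| >= 1 / 2]. *)
pose r := Num.min (q / 2) b; have r0 : 0 < r by rewrite lt_min b0 divr_gt0.
have rq : r < q.
  by apply: le_lt_trans (_ : q / 2 < q); [rewrite ge_min lexx|rewrite ltr_pdivrMr// ltr_pMr// ltr1n].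
have rb : r <= b by rewrite ge_min lexx orbT.
exists (sconst R psi), r, (germ log_scale); split.
- have bnd al : exists2 C, 0 <= C & forall x, Normc.normc (mderiv al psi x) <= C.
    exact: test_deriv_bound.
  have si : smooth_internal (sconst R psi) by apply/smooth_internal_germ; exact: nearW.
  have lp : forall al (x : E -> Rd),
      near_eps (fun e => Normc.normc (mderiv al psi (x e)) <= sval e `^ (- 1%:R)).
    move=> al x; have [C _ HC] := bnd al.
    by apply: filterS (near_const_le C (@ltr01 R)) => e; apply: le_trans; exact: HC.
  split; first split=> // x _.
    (* The exponent [1] serves all [al]: only the threshold for [e] depends on the bound of the
       derivative. *)
    exists 1%N => al; rewrite -(repK x) /sconst sderiv_germ sapp_germ.
    by apply/sle_sabs_rho; exact: lp.
  split; first split=> // al x _.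
    rewrite -(repK x); apply/moderate_deriv_germ; exists 1%N; exact: lp.
  apply: (compactly_supported_const cp _ sO).
    by exists x0; apply: subset_closure; rewrite /= psi1 oner_neq0.
  by apply: nearW => e x; exact: (@test_deriv_zero _ _ psi [::]).
- exact: r0.
- split; last first.
    rewrite /slt /sconst; apply/srel_germ; apply: nearW => e.
    exact: lt_le_trans (log_scale_ge1 e).
  move=> a a0; rewrite /sle /rho_pow /rho !smap_germ; apply/srel_germ.
  exact: log_scale_slow.
- move=> al x; rewrite -(repK x) => /sball_germ nx; split.
    rewrite /sconst sderiv_germ sapp_germ /sle /sabs smap_germ; apply/srel_germ.
    have [C _ HC] := test_deriv_bound (flatten [seq nseq (al i) i | i <- enum 'I_d]) sp cp.
    by apply: filterS (log_scale_large C) => e; apply: le_trans; exact: HC.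
  rewrite /sconst sapp_germ /sle /sabs !smap_germ; apply/srel_germ.
  apply: filterS2 nx (log_scale_large 2) => e nx L2.
  apply: le_trans (Hb _ _).
    by rewrite lef_pV2 ?posrE//; exact: lt_le_trans L2.
  rewrite distrC (le_lt_trans (norm_le_enorm _))//; exact: lt_le_trans rb.
- move=> xi; rewrite -(repK xi) => fX; rewrite smap_germ => /sdist_const_le_germ nX.
  apply: dec => //; apply/star_set_germ; have /fast_scale_germ[a a0 aX] := fX.
  apply: filterS2 nX aX => e h1 h2.
  have e0 : 0 < enorm (rep xi e) by apply: lt_le_trans h2; exact: eps_powR_gt0.
  have -> : rep xi e = enorm (rep xi e) *: unit_dir (rep xi e).
    by rewrite /unit_dir scalerA divff ?scale1r// gt_eqF.
  apply: coneG => //; apply: Hq; rewrite -ball_normE /= distrC.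
  by apply: le_lt_trans rq; apply: le_trans (norm_le_enorm _) h1.
Qed.

End Implications.

Theorem theorem8p2 (R : realType) (d : nat) (Omega : set 'rV[R]_d)
    (u : star R ('rV[R]_d -> R[i])) (x0 xi0 : 'rV[R]_d) :
  open Omega -> M_space (star_c Omega) u -> Omega x0 -> sphere R d xi0 ->
  [<-> exists r : R,
         [/\ 0 < r,
             sball (sconst R x0) r `<=` star_c Omega &
             forall x xi : star R 'rV[R]_d,
               sball (sconst R x0) r x ->
               star_set R (sphere R d) xi ->
               sle (sdist xi (sconst R xi0)) (sconst R r) ->
               microlocally_regular Omega u x xi];
       exists (phi : star R ('rV[R]_d -> R[i])) (r : R) (S : star R R),
         [/\ Mcinf_space (star_c Omega) phi, 0 < r,
             slow_scale S /\ slt (sconst R 0) S,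
             forall (alpha : 'I_d -> nat) (x : star R 'rV[R]_d),
               sball (sconst R x0) r x ->
               sle (sabs (sapp (sderiv alpha phi) x)) S /\
               sle (smap (fun s : R => s^-1) S) (sabs (sapp phi x)) &
             forall xi : star R 'rV[R]_d,
               fast_scale xi ->
               sle (sdist (smap (@unit_dir R d) xi) (sconst R xi0))
                   (sconst R r) ->
               approxeq0 (sapp (sfourier (smul phi u)) xi)];
       exists (psi : 'rV[R]_d -> R[i]) (Gamma : set 'rV[R]_d),
         [/\ test_function Omega psi, psi x0 = 1, conic_nbhs xi0 Gamma &
             forall xi : star R 'rV[R]_d,
               star_set R Gamma xi -> fast_scale xi ->
               approxeq0 (sapp (sfourier (smul (sconst R psi) u)) xi)] ].
Proof.
move=> oO + Ox0 xi1; rewrite -(repK u) => mU.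
(* The natural cycle is (1), (3), (2), (1), while the goals follow the listed order; each goal is
   therefore a composition of two implications. *)
tfae.
- by move=> /(test_of_regular oO mU Ox0 xi1)/elliptic_of_test.
- by move=> /(regular_of_elliptic_prop oO mU Ox0 xi1)/(test_of_regular oO mU Ox0 xi1).
- by move=> /elliptic_of_test/(regular_of_elliptic_prop oO mU Ox0 xi1).
Qed.
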